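(* Let $r\ge 1$, and let $\mathsf{K}=\mathbb{S}^{n}_{++}\cap\mathbb{V}$, with blocks $\mathbb{V}_{ij}$ $(1\le i\le j\le r)$, be any Ishi spectrahedral representation of a homogeneous convex cone of rank $r$. (a) The Carathéodory number of the closure $\bar{\mathsf{K}}=\mathbb{S}^n_+\cap\mathbb{V}$ equals $r$ if and only if for all $1\le i<j<k\le r$ with $\mathbb{V}_{ij}\neq\{0\}$ one has $\dim\mathbb{V}_{ik}=\dim\mathbb{V}_{jk}$. In this case, for every nontrivial (i.e., $\ne\{0\}$) face $\mathsf{F}$ of $\bar{\mathsf{K}}$, the Carathéodory number of $\mathsf{F}$ equals the rank of the relative interior of $\mathsf{F}$ (which is a homogeneous convex cone). (b) Dually, the Carathéodory number of the dual cone $\bar{\mathsf{K}}^{*}$ equals $r$ if and only if for all $1\le k<j<i\le r$ with $\mathbb{V}_{ji}\neq\{0\}$ one has $\dim\mathbb{V}_{ki}=\dim\mathbb{V}_{kj}$. In this case, for every nontrivial face $\mathsf{F}$ of $\bar{\mathsf{K}}^{*}$, the Carathéodory number of $\mathsf{F}$ equals the rank of the relative interior of $\mathsf{F}$ (which is a homogeneous convex cone).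
   Context: All vector spaces are real and finite-dimensional. $\mathbb{S}^n$ is the space of real symmetric $n\times n$ matrices; $\mathbb{S}^n_{++}$ and $\mathbb{S}^n_+$ are the cones of positive definite and positive semidefinite matrices. Spaces of matrices carry the trace inner product $\langle X|Y\rangle_{\mathrm F}=\operatorname{trace}(X^\top Y)$. A homogeneous convex cone is a convex cone $\mathsf{K}$ in a vector space that is pointed (contains no line), relatively open, and on which the group of linear automorphisms of its linear span mapping $\mathsf{K}$ onto itself acts transitively. Ishi spectrahedral representation: let $n_1,\dots,n_r\ge 1$ with $n_1+\dots+n_r=n$, let $\mathbb{V}_{ij}\subseteq\mathbb{R}^{n_i\times n_j}$ $(1\le i<j\le r)$ be linear subspaces, and put $\mathbb{V}_{ii}=\mathbb{R}I_{n_i}$. Let $\mathbb{V}\subseteq\mathbb{S}^n$ be the space of symmetric block matrices $X=(X_{ij})_{1\le i,j\le r}$ with $X_{ij}\in\mathbb{V}_{ij}$ for $i\le j$ and $X_{ji}=X_{ij}^\top$. The cone $\mathbb{S}^n_{++}\cap\mathbb{V}$ is called an Ishi spectrahedral representation (of any homogeneous convex cone linearly isomorphic to it) if [V1] $A_{ij}B_{jk}\in\mathbb{V}_{ik}$ for all $A_{ij}\in\mathbb{V}_{ij}$, $B_{jk}\in\mathbb{V}_{jk}$, $1\le i\le j\le k\le r$; [V2] $A_{ij}^\top B_{ik}\in\mathbb{V}_{jk}$ for all $A_{ij}\in\mathbb{V}_{ij}$, $B_{ik}\in\mathbb{V}_{ik}$, $1\le i\le j<k\le r$; [V3] $A_{ij}^\top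 A_{ij}\in\mathbb{V}_{jj}$ for all $A_{ij}\in\mathbb{V}_{ij}$, $1\le i\le j\le r$. Every homogeneous convex cone has an Ishi spectrahedral representation (Ishi), and every such $\mathbb{S}^n_{++}\cap\mathbb{V}$ is a homogeneous convex cone. Rank: the rank of a homogeneous convex cone (Vinberg: the dimension of a maximal connected commutative group of its automorphisms consisting of semisimple transformations with real eigenvalues) is the number $r$ of diagonal blocks in any of its Ishi spectrahedral representations; equivalently, it is the length $l$ of any maximal chain $\bar{\mathsf{K}}=\mathsf{F}(1)\supsetneq\dots\supsetneq\mathsf{F}(l)\ne\{0\}$ of nonzero faces of its closure. Dual cone: $\bar{\mathsf{K}}^*=\{Y\in\mathbb{V}\mid\langle X|Y\rangle_{\mathrm F}\ge0\ \forall X\in\mathsf{K}\}$ (dual taken in the linear span $\mathbb{V}$), which equals the orthogonal projection of $\mathbb{S}^n_+$ onto $\mathbb{V}$. Its relative interior is a homogeneous convex cone of the same rank $r$. A face of a closed convex cone $\bar{\mathsf{C}}$ is a nonempty convex subset containing both endpoints of every open line segment in $\bar{\mathsf{C}}$ that it meets; an extreme ray is a one-dimensional face. The relative interior of every face of $\bar{\mathsf K}$ or $\bar{\mathsf K}^*$ other than $\{0\}$ is a homogeneous convex cone. Carathéodory number: for a closed pointed convex cone $\bar{\mathsf{C}}$ and $x\in\bar{\mathsf{C}}$, $\kappa_{\bar{\mathsf{C}}}(x)$ is the least number of extreme rays of $\bar{\mathsf{C}}$ whose Minkowski sum contains $x$; the Carathéodory number of $\bar{\mathsf{C}}$ is $\max_{x\in\bar{\mathsf{C}}}\kappa_{\bar{\mathsf{C}}}(x)$.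 *)

(* Defs.v *)
From HB Require Import structures.
From mathcomp Require Import all_boot all_order all_algebra.
From mathcomp Require Import all_classical all_reals all_analysis.

Set Implicit Arguments.
Unset Strict Implicit.
Unset Printing Implicit Defensive.

Import Order.TTheory GRing.Theory Num.Theory.
Import numFieldNormedType.Exports.

Local Open Scope classical_set_scope.
Local Open Scope ring_scope.

Section Cones.
Variables (R : realType) (E : vectType R).
Implicit Types (C F K : set E) (x y : E).

Definition convex_cone C :=
  [/\ C !=set0, @convex_set R E C & forall x (t : R), C x -> 0 < t -> C (t *: x)].

Definition pointed C :=
  ~ exists x d : E, d != 0 /\ forall t : R, C (x + t *: d).

Definition lspan C : set E :=
  [set x | forall U : {vspace E}, C `<=` [set` U] -> x \in U].

Definition is_face C F :=
  [/\ F !=set0, F `<=` C, @convex_set R E F &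
      forall x y (t : R), C x -> C y -> 0 < t < 1 ->
        F ((1 - t) *: x + t *: y) -> F x /\ F y].

(* A face of a closed convex cone contains 0, so its dimension, that of its
   affine hull, is that of its linear span. *)
Definition extreme_ray C F :=
  is_face C F /\ exists U : {vspace E}, lspan F = [set` U] /\ \dim U = 1%N.

(* x is in the Minkowski sum of k extreme rays; the empty sum is {0}. *)
Definition in_sum_of_rays C x (k : nat) :=
  exists ray : 'I_k -> set E, (forall i, extreme_ray C (ray i)) /\
    exists2 y : 'I_k -> E, (forall i, ray i (y i)) & x = \sum_(i < k) y i.

Definition caratheodory_at C x (k : nat) :=
  in_sum_of_rays C x k /\ forall l : nat, in_sum_of_rays C x l -> (k <= l)%N.

Definition caratheodory_number C (N : nat) :=
  (exists2 x, C x & caratheodory_at C x N) /\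
  (forall x, C x -> exists2 k : nat, caratheodory_at C x k & (k <= N)%N).

(* Linear automorphisms of lspan K are given by endomorphisms of E that
   restrict to a bijection of lspan K. *)
Definition transitive_automorphisms K :=
  forall x y, K x -> K y -> exists g : 'End(E),
    [/\ set_bij (lspan K) (lspan K) g, g @` K = K & g x = y].

End Cones.

Definition linearly_isomorphic (R : realType) (E E' : vectType R)
    (K : set E) (K' : set E') :=
  exists f : 'Hom(E, E'), set_bij (lspan K) (lspan K') f /\ f @` K = K'.

Section MatrixCones.
Variables (R : realType) (n : nat).
Implicit Types (C K : set 'M[R]_n) (X Y : 'M[R]_n).

(* Only used for convex cones, whose affine hull is their linear span. *)
Definition relative_interior C : set 'M[R]_n :=
  [set X | C X /\ \forall Y \near X, lspan C Y -> C Y].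

Definition homogeneous_cone K :=
  [/\ convex_cone K, pointed K, K `<=` relative_interior K &
      transitive_automorphisms K].

Definition psd_cone : set 'M[R]_n :=
  [set X | X^T = X /\ forall v : 'cV[R]_n, 0 <= (v^T *m X *m v) ord0 ord0].

Definition pd_cone : set 'M[R]_n :=
  [set X | X^T = X /\
     forall v : 'cV[R]_n, v != 0 -> 0 < (v^T *m X *m v) ord0 ord0].

Definition frob X Y : R := \tr (X^T *m Y).

End MatrixCones.

Section Ishi.
Variables (R : realType) (r : nat) (p : 'I_r -> nat).
Variable V : forall i j : 'I_r, {vspace 'M[R]_(p i, p j)}.

(* Only V i j with i <= j is used; the members with i > j are irrelevant. *)
Definition ishi_space : set 'M[R]_(\sum_i p i) :=
  [set X | X^T = X /\
     forall i j : 'I_r, (i <= j)%N -> submxblock X i j \in V i j].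

Record ishi_axioms : Prop := IshiAxioms {
  ishi_size : forall i, (0 < p i)%N;
  ishi_diag : forall i, V i i = <[1%:M]>%VS;
  ishi_V1 : forall i j k : 'I_r, (i <= j)%N -> (j <= k)%N ->
    forall A B, A \in V i j -> B \in V j k -> A *m B \in V i k;
  ishi_V2 : forall i j k : 'I_r, (i <= j)%N -> (j < k)%N ->
    forall A B, A \in V i j -> B \in V i k -> A^T *m B \in V j k;
  ishi_V3 : forall i j : 'I_r, (i <= j)%N ->
    forall A, A \in V i j -> A^T *m A \in V j j
}.

Definition ishi_cone : set 'M[R]_(\sum_i p i) :=
  @pd_cone R (\sum_i p i) `&` ishi_space.

Definition ishi_dual : set 'M[R]_(\sum_i p i) :=
  [set Y | ishi_space Y /\ forall X, ishi_cone X -> 0 <= frob X Y].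

End Ishi.

Definition has_ishi_representation (R : realType) (n : nat) (K : set 'M[R]_n)
    (r : nat) :=
  exists (p : 'I_r -> nat) (V : forall i j : 'I_r, {vspace 'M[R]_(p i, p j)}),
    ishi_axioms V /\ linearly_isomorphic K (ishi_cone V).

(* That the number of diagonal blocks does not depend on the representation is
   part of the definition. *)
Definition cone_rank (R : realType) (n : nat) (K : set 'M[R]_n) (r : nat) :=
  has_ishi_representation K r /\
  forall s : nat, has_ishi_representation K s -> s = r.

Definition caratheodory_rank_on_faces (R : realType) (n : nat)
    (C : set 'M[R]_n) :=
  forall F : set 'M[R]_n, is_face C F -> F <> [set 0] ->
    homogeneous_cone (relative_interior F) /\
    exists2 m : nat, cone_rank (relative_interior F) m &
      caratheodory_number F m.

(* Main.v *)
Require Import Defs.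
From HB Require Import structures.
From mathcomp Require Import all_boot all_order all_algebra.
From mathcomp Require Import all_classical all_reals all_analysis.
From mathcomp Require Import ring lra.

Set Implicit Arguments.
Unset Strict Implicit.
Unset Printing Implicit Defensive.

Import Order.TTheory GRing.Theory Num.Theory.
Import numFieldNormedType.Exports.

Local Open Scope classical_set_scope.
Local Open Scope ring_scope.

(* Let T range over the algebra of block upper triangular matrices with T_ij in
   V_ij. Block Cholesky elimination never leaves V, by [V2] and [V3], so the
   closed cone consists of the matrices T^T T whose nonzero block rows carry a
   positive pivot. Each such row contributes an extreme ray and all extreme rays
   are of this form; in particular r rays always suffice.
   If V_ij <> 0 and dim V_ik <> dim V_jk, then E_i + E_j + E_k is a sum of two
   extreme rays, and by homogeneity every point needs at most r - 1 of them. If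
   the dimension condition holds, two rows with the same pivot index can be
   rotated into one such row and a row whose pivot lies further to the right, so
   a sum of l rays has a Cholesky factor with at most l nonzero rows; hence the
   identity needs r rays.
   A face generated by T^T T is isomorphic to the closed cone of the subsystem
   of V indexed by the nonzero rows of T, which inherits the condition. The
   number of blocks is an invariant, namely the maximal length of a chain of
   faces. Finally the dual cone has an Ishi representation in which the block
   order is reversed, of dimensions dim V'_ij = dim V_(r+1-j)(r+1-i), so (b) is
   (a) transported along a linear isomorphism. *)

(** For a nonzero A in V_ij, [V3] makes A^T A a positive multiple of the identity, so left
    multiplication by A is injective from V_jk to V_ik. Hence dim V_jk <= dim V_ik always, and the
    dimension condition says exactly that A divides every block of V_ik. Divisibility is what makes
    A^T, suitably scaled, preserve the Gram matrix of a row that starts with A; when the condition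
    fails, A^T kills some nonzero B in V_ik and the cross terms of A and B vanish.

    Most statements about a point of the closed cone are checked at a sum of idempotents E_k: a
    Cholesky factor, completed by identity rows, is an invertible triangular G, and congruence by G
    preserves the cone.

    The axioms are not symmetric under transposition (T T^T need not lie in V), so reversing the
    blocks of V is not enough for the dual. Instead the form U -> tr(U Y U^T) on the triangular
    algebra is written in orthonormal coordinates. It couples the block columns of U through right
    multiplication by the blocks of Y, so each space of block columns supplies one block of the dual
    representation. *)

Lemma convex_setE (R : realType) (E : lmodType R) (C : set E) :
  @convex_set R E C <->
  forall x y (t : R), C x -> C y -> 0 <= t -> t <= 1 ->
    C (t *: x + (1 - t) *: y).
Proof.
split=> [h x y t Cx Cy t0 t1|h x y t /set_mem Cx /set_mem Cy].
  exact: (set_mem (h x y (Itv01 t0 t1) (mem_set Cx) (mem_set Cy))).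
by apply/mem_set; apply: h.
Qed.

(** * Linear spans and linear left inverses *)

Section LinearSpan.
Variables (R : realType) (E : vectType R).
Implicit Types (C : set E) (x y : E).

Lemma sub_lspan C : C `<=` lspan C.
Proof. by move=> x Cx U; apply. Qed.

Lemma lspanD C x y : lspan C x -> lspan C y -> lspan C (x + y).
Proof. by move=> hx hy U CU; rewrite memvD ?hx ?hy. Qed.

Lemma lspanZ C (t : R) x : lspan C x -> lspan C (t *: x).
Proof. by move=> hx U CU; rewrite memvZ ?hx. Qed.

Lemma lspan_fix C (h : 'End(E)) :
  (forall x, C x -> h x = x) -> forall x, lspan C x -> h x = x.
Proof.
move=> hC x /(_ (lker (h - \1%VF))) xk; apply/eqP; rewrite -subr_eq0.
suff: x \in lker (h - \1%VF) by rewrite memv_ker add_lfunE opp_lfunE id_lfunE.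
by apply: xk => y /hC hy; rewrite /= memv_ker add_lfunE opp_lfunE id_lfunE hy subrr.
Qed.

(** A subspace of least dimension containing [C] lies in every other one, since otherwise the
    intersection would be smaller. *)
Lemma lspan_vspace C : exists U : {vspace E}, lspan C = [set` U].
Proof.
pose P m := `[< exists U : {vspace E}, C `<=` [set` U] /\ \dim U = m >].
have exP : exists m, P m.
  by exists (\dim {:E}); apply/asboolP; exists fullv; split=> // x _; apply: memvf.
case: (ex_minnP exP) => m /asboolP[U [CU dU]] mmin.
exists U; apply/seteqP; split=> [x|x xU U' CU']; first by apply.
have sU : (U :&: U' <= U)%VS by apply: capvSl.
have dI : (m <= \dim (U :&: U'))%N.
  apply: mmin; apply/asboolP; exists (U :&: U')%VS; split=> // y Cy /=.
  by rewrite memv_cap CU//= CU'.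
have /eqP eU : (U :&: U' == U)%VS by rewrite eqEdim sU dU.
by move: xU; rewrite /= -eU memv_cap => /andP[].
Qed.

End LinearSpan.

Lemma lspan_image (R : realType) (E E' : vectType R) (C : set E)
    (C' : set E') (f : 'Hom(E, E')) :
  (forall x, C x -> C' (f x)) -> forall x, lspan C x -> lspan C' (f x).
Proof.
move=> fC x hx U' CU'; rewrite memv_preim; apply: hx => y Cy /=.
by rewrite -memv_preim; apply/CU'/fC.
Qed.

(** The generalised inverse of [f \o projv U] returns some preimage; projecting it to [U] gives the
    one in [U], unique by injectivity. *)
Lemma linear_left_inverse (R : realType) (E E' : vectType R) (U : {vspace E})
    (f : 'Hom(E, E')) :
  (forall x, x \in U -> f x = 0 -> x = 0) ->
  exists g : 'Hom(E', E), forall x, x \in U -> g (f x) = x.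
Proof.
move=> f0; pose h := (f \o projv U)%VF.
exists (projv U \o h^-1)%VF => x xU; rewrite lfunE /=.
have hx : h x = f x by rewrite lfunE /= projv_id.
have e : f (projv U (h^-1%VF (f x))) = f x.
  have : h (h^-1%VF (h x)) = h x by apply: limg_lfunVK; apply: memv_img (memvf _).
  by rewrite hx lfunE.
apply/eqP; rewrite -subr_eq0; apply/eqP/f0; first by rewrite memvB ?memv_proj.
by rewrite linearB /= e subrr.
Qed.

(** * Linear isomorphisms of cones *)

(** Two maps of the ambient spaces, mutually inverse on the cones only and therefore on their spans.
    Unlike a bijection without chosen inverse, such a pair is inverted and composed for free. *)
Definition cone_iso (R : realType) (E E' : vectType R) (C : set E)
    (C' : set E') (f : 'Hom(E, E')) (g : 'Hom(E', E)) :=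
  (forall x, C x -> C' (f x) /\ g (f x) = x) /\
  (forall y, C' y -> C (g y) /\ f (g y) = y).

Lemma cone_iso_sym (R : realType) (E E' : vectType R) (C : set E)
    (C' : set E') (f : 'Hom(E, E')) (g : 'Hom(E', E)) :
  cone_iso C C' f g -> cone_iso C' C g f.
Proof. by case. Qed.

Lemma cone_iso_trans (R : realType) (E E' E'' : vectType R) (C : set E)
    (C' : set E') (C'' : set E'') (f : 'Hom(E, E')) (g : 'Hom(E', E))
    (f' : 'Hom(E', E'')) (g' : 'Hom(E'', E')) :
  cone_iso C C' f g -> cone_iso C' C'' f' g' ->
  cone_iso C C'' (f' \o f)%VF (g \o g')%VF.
Proof.
move=> [fC gC] [fC' gC']; split=> x hx; rewrite !comp_lfunE.
  by have [/[dup] h /fC'[? ->] ?] := fC _ hx.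
by have [/[dup] h /gC[? ->] ?] := gC' _ hx.
Qed.

Section ConeIso.
Variables (R : realType) (E E' : vectType R) (C : set E) (C' : set E').
Variables (f : 'Hom(E, E')) (g : 'Hom(E', E)).
Hypothesis fg : cone_iso C C' f g.

Lemma cone_iso_image : f @` C = C'.
Proof.
apply/seteqP; split=> [_ [x Cx <-]|y C'y]; first by have [] := fg.1 x Cx.
by have [? ?] := fg.2 y C'y; exists (g y).
Qed.

Lemma cone_iso_lspan x : lspan C x -> lspan C' (f x).
Proof. by apply: lspan_image => y /fg.1[]. Qed.

Lemma cone_isoK x : lspan C x -> g (f x) = x.
Proof.
move=> hx; have := @lspan_fix _ _ C (g \o f)%VF _ x hx.
by rewrite lfunE; apply=> y /fg.1[_]; rewrite lfunE.
Qed.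

Lemma cone_iso_sub (F : set E) : F `<=` C -> cone_iso F (f @` F) f g.
Proof.
move=> FC; split=> [x Fx|_ [x Fx <-]].
  by split; [exists x | have [] := fg.1 x (FC _ Fx)].
by have [_ ->] := fg.1 x (FC _ Fx).
Qed.

Lemma cone_iso_convex : @convex_set R E C -> @convex_set R E' C'.
Proof.
move=> /convex_setE cC; apply/convex_setE => x y t C'x C'y t0 t1.
have [Cx fx] := fg.2 _ C'x; have [Cy fy] := fg.2 _ C'y.
have /fg.1[+ _] := cC _ _ t Cx Cy t0 t1.
by rewrite linearD !linearZ /= fx fy.
Qed.

End ConeIso.

Lemma cone_iso_lspan_iso (R : realType) (E E' : vectType R) (C : set E)
    (C' : set E') (f : 'Hom(E, E')) (g : 'Hom(E', E)) :
  cone_iso C C' f g -> cone_iso (lspan C) (lspan C') f g.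
Proof.
move=> fg; split=> x hx.
  by split; [apply: cone_iso_lspan fg _ hx | apply: cone_isoK fg _ hx].
split; first exact: cone_iso_lspan (cone_iso_sym fg) _ hx.
exact: cone_isoK (cone_iso_sym fg) _ hx.
Qed.

Lemma cone_iso_set_bij (R : realType) (E E' : vectType R) (C : set E)
    (C' : set E') (f : 'Hom(E, E')) (g : 'Hom(E', E)) :
  cone_iso C C' f g -> set_bij C C' f.
Proof.
move=> fg; split=> [x /fg.1[]//|x y /set_mem Cx /set_mem Cy e|y C'y].
  by have [_ <-] := fg.1 _ Cx; have [_ <-] := fg.1 _ Cy; rewrite e.
by have [? ?] := fg.2 _ C'y; exists (g y).
Qed.

Lemma cone_iso_linearly_isomorphic (R : realType) (E E' : vectType R)
    (C : set E) (C' : set E') (f : 'Hom(E, E')) (g : 'Hom(E', E)) :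
  cone_iso C C' f g -> linearly_isomorphic C C'.
Proof.
move=> fg; exists f; split; last exact: cone_iso_image fg.
exact: cone_iso_set_bij (cone_iso_lspan_iso fg).
Qed.

Lemma linearly_isomorphic_cone_iso (R : realType) (E E' : vectType R)
    (C : set E) (C' : set E') :
  linearly_isomorphic C C' -> exists f g, cone_iso C C' f g.
Proof.
move=> [f [[ff fi fs] fC]]; have [U CU] := lspan_vspace C.
have [|g gf] := @linear_left_inverse _ _ _ U f.
  move=> x xU fx0; have lx : lspan C x by rewrite CU.
  apply: fi; rewrite ?inE ?linear0 //; first by rewrite CU /= mem0v.
have gC x : C x -> g (f x) = x.
  by move=> /sub_lspan; rewrite CU => /gf.
exists f, g; split=> [x Cx|y]; first by rewrite gC// -fC; split=> //; exists x.
by rewrite -fC => -[x Cx <-]; rewrite gC.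
Qed.

(** * Invariance of faces, extreme rays and Carathéodory numbers *)

Section FaceTransport.
Variables (R : realType) (E E' : vectType R) (C : set E) (C' : set E').
Variables (f : 'Hom(E, E')) (g : 'Hom(E', E)).
Hypothesis fg : cone_iso C C' f g.

Lemma cone_iso_face (F : set E) : is_face C F -> is_face C' (f @` F).
Proof.
move=> [[x0 Fx0] FC Fc Ff]; have fgF := cone_iso_sub fg FC; split.
- by exists (f x0), x0.
- by move=> _ [x /FC Cx <-]; have [] := fg.1 x Cx.
- exact: cone_iso_convex fgF Fc.
- move=> x y t C'x C'y t01 [z Fz fz].
  have [Cx fx] := fg.2 _ C'x; have [Cy fy] := fg.2 _ C'y.
  have ez : z = (1 - t) *: g x + t *: g y.
    have [_ <-] := fg.1 _ (FC _ Fz).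
    by rewrite fz linearD !linearZ.
  have [Fx Fy] := Ff _ _ t Cx Cy t01 (eq_ind _ F Fz _ ez).
  by split; [exists (g x) | exists (g y)].
Qed.

Lemma cone_iso_extreme_ray (F : set E) :
  extreme_ray C F -> extreme_ray C' (f @` F).
Proof.
move=> [fF [U [eU dU]]]; split; first exact: cone_iso_face.
have [_ FC _ _] := fF; have fgF := cone_iso_lspan_iso (cone_iso_sub fg FC).
exists (f @: U)%VS; split.
  apply/seteqP; split=> [y|y /= /memv_imgP[x xU ->]].
    move=> /fgF.2[]; rewrite eU /= => gU <-; exact: memv_img.
  by have [] := fgF.1 x; rewrite // eU.
rewrite limg_dim_eq //; apply/eqP; rewrite -subv0; apply/subvP => x.
rewrite memv_cap memv_ker memv0 => /andP[xU /eqP fx].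
by have [|_ <-] := fgF.1 x; rewrite ?eU // fx linear0.
Qed.

Lemma cone_iso_in_sum_of_rays x k :
  in_sum_of_rays C x k -> in_sum_of_rays C' (f x) k.
Proof.
move=> [ray [hray [y yray ->]]]; exists (fun i => f @` ray i); split.
  by move=> i; apply: cone_iso_extreme_ray.
by exists (fun i => f (y i)) => [i|]; [exists (y i) | rewrite linear_sum].
Qed.

End FaceTransport.

Section CaratheodoryTransport.
Variables (R : realType) (E E' : vectType R) (C : set E) (C' : set E').
Variables (f : 'Hom(E, E')) (g : 'Hom(E', E)).
Hypothesis fg : cone_iso C C' f g.

Lemma cone_iso_caratheodory_at x k :
  C x -> caratheodory_at C x k -> caratheodory_at C' (f x) k.
Proof.
move=> Cx [h1 h2]; split; first exact: (cone_iso_in_sum_of_rays fg).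
move=> l /(cone_iso_in_sum_of_rays (cone_iso_sym fg)).
by have [_ ->] := fg.1 x Cx; apply: h2.
Qed.

Lemma cone_iso_caratheodory_number N :
  caratheodory_number C N -> caratheodory_number C' N.
Proof.
move=> [[x Cx hx] h]; split.
  by exists (f x); [have [] := fg.1 x Cx | exact: cone_iso_caratheodory_at].
move=> y /fg.2[Cgy <-]; have [k hk kN] := h _ Cgy.
by exists k => //; apply: cone_iso_caratheodory_at.
Qed.

End CaratheodoryTransport.

(** * Invariance of relative interior, homogeneity and rank *)

Lemma mx_nbhsP (R : realType) (n : nat) (X : 'M[R]_n) (A : set 'M[R]_n) :
  nbhs X A <-> exists2 e : R, 0 < e &
    forall Y : 'M[R]_n, (forall i j, `|X i j - Y i j| < e) -> A Y.
Proof.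
split=> [/nbhs_ballP[e /= e0 eA]|[e e0 eA]].
  by exists e => // Y XY; apply: eA; split.
by apply/nbhs_ballP; exists e => //= Y [_ XY]; apply: eA.
Qed.

Lemma linear_mx_continuous (R : realType) (n m : nat)
    (f : 'Hom('M[R]_n, 'M[R]_m)) : continuous f.
Proof.
have fE : (f : _ -> _) = fun X => \sum_ij X ij.1 ij.2 *: f (delta_mx ij.1 ij.2).
  apply/funext => X; rewrite -(pair_bigA _ (fun i j => X i j *: f (delta_mx i j))).
  rewrite [in LHS](matrix_sum_delta X) linear_sum; apply: eq_bigr => i _.
  by rewrite linear_sum; apply: eq_bigr => j _; rewrite linearZ.
rewrite fE; apply: continuous_big => [|ij _ X]; first exact: add_continuous.
exact: cvgZr_tmp (@coord_continuous _ _ _ ij.1 ij.2 X).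
Qed.

(** The neighbourhood of [x] is pulled back along [g], which is continuous and maps [f x] to [x]. *)
Lemma cone_iso_relative_interior_sub (R : realType) (n m : nat)
    (C : set 'M[R]_n) (C' : set 'M[R]_m) (f : 'Hom('M[R]_n, 'M[R]_m))
    (g : 'Hom('M[R]_m, 'M[R]_n)) x :
  cone_iso C C' f g -> relative_interior C x ->
  relative_interior C' (f x) /\ g (f x) = x.
Proof.
move=> fg [Cx xn]; have [C'x gfx] := fg.1 _ Cx; do 2!split => //.
have : \forall y \near f x, lspan C (g y) -> C (g y).
  have := @linear_mx_continuous _ _ _ g (f x); rewrite /continuous_at gfx.
  move=> /(_ _ xn). exact.
apply: filterS => y Cgy lC'y.
have [lCg fgy] := (cone_iso_lspan_iso fg).2 y lC'y.
by rewrite -fgy; apply: (fg.1 _ (Cgy lCg)).1.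
Qed.

Section MatrixTransport.
Variables (R : realType) (n m : nat).
Variables (f : 'Hom('M[R]_n, 'M[R]_m)) (g : 'Hom('M[R]_m, 'M[R]_n)).

Lemma cone_iso_relative_interior (C : set 'M[R]_n) (C' : set 'M[R]_m) :
  cone_iso C C' f g ->
  cone_iso (relative_interior C) (relative_interior C') f g.
Proof.
move=> fg; split=> x; first exact: cone_iso_relative_interior_sub.
exact/cone_iso_relative_interior_sub/cone_iso_sym.
Qed.

Lemma cone_iso_homogeneous (K : set 'M[R]_n) (K' : set 'M[R]_m) :
  cone_iso K K' f g -> homogeneous_cone K -> homogeneous_cone K'.
Proof.
move=> fg [[[x0 Kx0] Kc Kz] Kp Ko Kt]; split.
- split; first by exists (f x0); have [] := fg.1 _ Kx0.
    exact: cone_iso_convex fg Kc.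
  move=> y t /fg.2[Kgy <-] t0; rewrite -linearZ.
  by have [] := fg.1 _ (Kz _ _ Kgy t0).
- move=> [x [d [d0 xd]]]; apply: Kp; exists (g x), (g d); split; last first.
    by move=> t; rewrite -linearZ -linearD; have [] := fg.2 _ (xd t).
  (* [d] is a difference of two points of [K'], so it lies where [f] inverts [g]. *)
  have ld : lspan K' d.
    have -> : d = (x + 1 *: d) + (-1) *: (x + 0 *: d).
      by rewrite scale1r scale0r addr0 scaleN1r addrAC subrr add0r.
    by apply: lspanD; [|apply: lspanZ]; apply: sub_lspan.
  apply: contra_neq d0 => gd0.
  by have [_ <-] := (cone_iso_lspan_iso fg).2 _ ld; rewrite gd0 linear0.
- move=> y K'y; have [Kgy <-] := fg.2 _ K'y.
  by have [] := (cone_iso_relative_interior fg).1 _ (Ko _ Kgy).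
- move=> x y K'x K'y; have [Kx fx] := fg.2 _ K'x; have [Ky fy] := fg.2 _ K'y.
  have [h [[hf hi hs] hK hxy]] := Kt _ _ Kx Ky.
  have sfg := cone_iso_lspan_iso fg.
  exists (f \o h \o g)%VF; split.
  + split.
    * move=> z /sfg.2[lgz _]; rewrite !comp_lfunE /=.
      by have [] := sfg.1 _ (hf _ lgz).
    * move=> z z' /set_mem lz /set_mem lz'; rewrite !comp_lfunE /= => e.
      have [lgz <-] := sfg.2 _ lz; have [lgz' <-] := sfg.2 _ lz'.
      congr (f _); apply: hi; rewrite ?inE //.
      have [_ <-] := sfg.1 _ (hf _ lgz); have [_ <-] := sfg.1 _ (hf _ lgz').
      by rewrite e.
    * move=> z lz; have [lgz fz] := sfg.2 _ lz.
      have [w lw hw] := hs _ lgz; have [? gfw] := sfg.1 _ lw.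
      by exists (f w) => //; rewrite !comp_lfunE /= gfw hw.
  + apply/seteqP; split=> [_ [z /fg.2[Kgz _] <-]|z K'z].
      rewrite !comp_lfunE /=; apply: (fg.1 _ _).1; rewrite -hK.
      by exists (g z).
    have [Kgz fz] := fg.2 _ K'z; move: Kgz; rewrite -hK => -[w Kw hw].
    have [? gfw] := fg.1 _ Kw.
    by exists (f w) => //; rewrite !comp_lfunE /= gfw hw.
  + by rewrite !comp_lfunE /= hxy.
Qed.

Lemma cone_iso_has_ishi_representation (K : set 'M[R]_n) (K' : set 'M[R]_m) s :
  cone_iso K K' f g ->
  has_ishi_representation K s -> has_ishi_representation K' s.
Proof.
move=> fg [p [V [hV /linearly_isomorphic_cone_iso[f' [g' fg']]]]].
exists p, V; split=> //.
exact: cone_iso_linearly_isomorphic (cone_iso_trans (cone_iso_sym fg) fg').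
Qed.

End MatrixTransport.

Section RankOnFacesTransport.
Variables (R : realType) (n m : nat).
Variables (f : 'Hom('M[R]_n, 'M[R]_m)) (g : 'Hom('M[R]_m, 'M[R]_n)).

Lemma cone_iso_cone_rank (K : set 'M[R]_n) (K' : set 'M[R]_m) s :
  cone_iso K K' f g -> cone_rank K s -> cone_rank K' s.
Proof.
move=> fg [h hu]; split; first exact: cone_iso_has_ishi_representation fg h.
by move=> s' /(cone_iso_has_ishi_representation (cone_iso_sym fg))/hu.
Qed.

Definition rank_is_caratheodory_number (k : nat) (C : set 'M[R]_k) :=
  homogeneous_cone (relative_interior C) /\
  exists2 s : nat, cone_rank (relative_interior C) s & caratheodory_number C s.

Lemma cone_iso_rank_is_caratheodory_number (C : set 'M[R]_n)
    (C' : set 'M[R]_m) :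
  cone_iso C C' f g ->
  rank_is_caratheodory_number C -> rank_is_caratheodory_number C'.
Proof.
move=> fg [hC [s rs cs]]; have fgi := cone_iso_relative_interior fg.
split; first exact: cone_iso_homogeneous fgi hC.
exists s; first exact: cone_iso_cone_rank fgi rs.
exact: cone_iso_caratheodory_number fg _ cs.
Qed.

Lemma cone_iso_caratheodory_rank_on_faces (C : set 'M[R]_n)
    (C' : set 'M[R]_m) :
  cone_iso C C' f g ->
  caratheodory_rank_on_faces C -> caratheodory_rank_on_faces C'.
Proof.
move=> fg h F' fF' F'0; have fF := cone_iso_face (cone_iso_sym fg) fF'.
have [_ F'C' _ _] := fF'.
have fgF := cone_iso_sym (cone_iso_sub (cone_iso_sym fg) F'C').
apply: cone_iso_rank_is_caratheodory_number fgF _; apply: h => // gF0.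
apply: F'0; apply/seteqP; split=> [y F'y|_ ->].
  have : (g @` F') (g y) by exists y.
  by rewrite gF0 => /= gy; have [_ <-] := fg.2 _ (F'C' _ F'y); rewrite gy linear0.
have : (g @` F') 0 by rewrite gF0.
move=> [y F'y gy]; have [_ fy] := fg.2 _ (F'C' _ F'y).
by move: F'y; rewrite -fy gy linear0.
Qed.

End RankOnFacesTransport.

(** * Quadratic forms, semidefinite and definite matrices *)

Lemma trmx_scale (R : pzRingType) m n (a : R) (A : 'M[R]_(m, n)) :
  (a *: A)^T = a *: A^T.
Proof. exact: linearZ. Qed.

Lemma trmx_add (R : pzRingType) m n (A B : 'M[R]_(m, n)) :
  (A + B)^T = A^T + B^T.
Proof. exact: linearD. Qed.

Lemma trmx_sub (R : pzRingType) m n (A B : 'M[R]_(m, n)) :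
  (A - B)^T = A^T - B^T.
Proof. exact: linearB. Qed.

Section QuadraticForm.
Variables (R : realType) (n : nat).
Implicit Types (X Y T : 'M[R]_n) (v w : 'cV[R]_n).

Definition qf X v : R := (v^T *m X *m v) ord0 ord0.

Lemma qfD X Y v : qf (X + Y) v = qf X v + qf Y v.
Proof. by rewrite /qf mulmxDr mulmxDl mxE. Qed.

Lemma qfZ (t : R) X v : qf (t *: X) v = t * qf X v.
Proof. by rewrite /qf -scalemxAr -scalemxAl mxE. Qed.

Lemma qfN X v : qf (- X) v = - qf X v.
Proof. by rewrite -scaleN1r qfZ mulN1r. Qed.

Lemma qf_congr X T v : qf (T^T *m X *m T) v = qf X (T *m v).
Proof. by rewrite /qf trmx_mul !mulmxA. Qed.

Lemma qf1E v : qf 1%:M v = \sum_i v i ord0 ^+ 2.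
Proof.
rewrite /qf mulmx1 mxE; apply: eq_bigr => i _.
by rewrite mxE expr2.
Qed.

Lemma qf1_ge0 v : 0 <= qf 1%:M v.
Proof. by rewrite qf1E; apply: sumr_ge0 => i _; rewrite sqr_ge0. Qed.

Lemma qf1_eq0 v : (qf 1%:M v == 0) = (v == 0).
Proof.
apply/eqP/eqP => [|->]; last by rewrite /qf mulmx0 mxE.
rewrite qf1E => h; apply/colP => i; rewrite mxE; apply/eqP.
rewrite -(sqrf_eq0 (v i ord0)).
apply/eqP; have := psumr_eq0P _ h; apply=> // j _; exact: sqr_ge0.
Qed.

Lemma qf1_gt0 v : v != 0 -> 0 < qf 1%:M v.
Proof. by move=> v0; rewrite lt_neqAle eq_sym qf1_eq0 v0 qf1_ge0. Qed.

Lemma qf_gram T v : qf (T^T *m T) v = qf 1%:M (T *m v).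
Proof. by rewrite -qf_congr mulmx1. Qed.

(** Each product |v_i||v_j| is at most |v|^2, which is [qf 1%:M v]; any constant depending on [X]
    alone serves the later estimates. *)
Lemma qf_bound X v :
  `|qf X v| <= (\sum_i \sum_j `|X i j|) * qf 1%:M v.
Proof.
have -> : qf X v = \sum_i \sum_j v i ord0 * X i j * v j ord0.
  rewrite /qf -mulmxA mxE; apply: eq_bigr => i _.
  by rewrite !mxE mulr_sumr; apply: eq_bigr => j _; rewrite mulrA.
apply: le_trans (ler_norm_sum _ _ _) _; rewrite mulr_suml ler_sum// => i _.
apply: le_trans (ler_norm_sum _ _ _) _; rewrite mulr_suml ler_sum// => j _.
rewrite !normrM mulrAC mulrC ler_wpM2l//.
have h k : `|v k ord0| ^+ 2 <= qf 1%:M v.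
  rewrite qf1E (bigD1 k)//= real_normK ?num_real// lerDl.
  by apply: sumr_ge0 => l _; rewrite sqr_ge0.
have := h i; have := h j; have := sqr_ge0 (`|v i ord0| - `|v j ord0|).
by nra.
Qed.

Lemma mx_cv_eq0 m (A : 'M[R]_(m, n)) : (forall v : 'cV_n, A *m v = 0) -> A = 0.
Proof.
move=> h; apply/matrixP => i j.
by have /matrixP/(_ i ord0) := h (delta_mx j 0); rewrite -colE !mxE.
Qed.

Lemma gram_eq0 m (T : 'M[R]_(m, n)) : T^T *m T = 0 -> T = 0.
Proof.
move=> h; apply/matrixP => i j; rewrite mxE.
have /matrixP/(_ j j) := h; rewrite !mxE => /psumr_eq0P h0.
apply/eqP; rewrite -[_ == 0]sqrf_eq0 expr2.
have := h0 _ i isT; rewrite !mxE => ->// k _.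
by rewrite !mxE -expr2 sqr_ge0.
Qed.

(** With a = |Xv|^2 and q the form at Xv, the form at v + t Xv is 2ta + t^2 q, negative for small t
    < 0 unless a = 0. *)
Lemma psd_ker X v : psd_cone X -> qf X v = 0 -> X *m v = 0.
Proof.
move=> [XT Xp] Xv; apply/eqP; rewrite -qf1_eq0; set a := qf _ _.
have a0 : 0 <= a by apply: qf1_ge0.
rewrite eq_le a0 andbT leNgt; apply/negP => a_gt0.
set w := X *m v; set q := qf X w; have q0 : 0 <= q by apply: Xp.
have e2 : (w^T *m w) ord0 ord0 = a by rewrite /a /qf mulmx1.
have ew (t : R) : qf X (v + t *: w) = 2 * t * a + t ^+ 2 * q.
  have e1 : v^T *m X = w^T by rewrite /w trmx_mul XT.
  rewrite /qf [(_ + _)^T]raddfD /= [(_ *: _)^T]linearZ /= mulmxDl e1.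
  rewrite mulmxDr mulmxDl mulmxDl -!scalemxAl -!scalemxAr.
  have wv : (w^T *m v) ord0 ord0 = 0 by rewrite -e1; exact: Xv.
  have wXv : w^T *m X *m v = w^T *m w by rewrite -mulmxA.
  rewrite wXv !mxE -!e2 /q /qf !mxE in wv *.
  rewrite wv; ring.
(* At t = -a/(q + 1) one has tq = -a - t, so the form equals t(a - t) < 0; the 1 covers the case q =
   0. *)
have := Xp (v + (- a / (q + 1)) *: w); rewrite -/(qf _ _) ew.
have q1 : 0 < q + 1 by rewrite ltr_wpDl.
set t := - a / (q + 1); have ta : t * (q + 1) = - a by rewrite /t divfK ?gt_eqF.
have t0 : t < 0 by rewrite /t mulNr oppr_lt0 divr_gt0.
rewrite leNgt => /negP; apply; nra.
Qed.

Lemma psd_ker_mul X (A : 'M[R]_n) :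
  psd_cone X -> A^T *m X *m A = 0 -> X *m A = 0.
Proof.
move=> Xp h; apply: mx_cv_eq0 => v; rewrite -mulmxA.
by apply: psd_ker => //; rewrite -qf_congr h /qf mulmx0 mul0mx mxE.
Qed.

Lemma psd_gram T : psd_cone (T^T *m T).
Proof.
by split=> [|v]; [rewrite trmx_mul trmxK | rewrite -/(qf _ _) qf_gram qf1_ge0].
Qed.

(** For t < 0 the form of [X] would be both nonnegative and nonpositive, which forces X = 0. *)
Lemma psd_scale_ge0 X (t : R) :
  psd_cone X -> X != 0 -> psd_cone (t *: X) -> 0 <= t.
Proof.
move=> Xp X0 [_ h]; rewrite leNgt; apply/negP => t0; case/eqP: X0.
apply: mx_cv_eq0 => v; apply: psd_ker => //; apply: le_anti.
rewrite [X in _ && X]Xp.2 andbT; have := h v; rewrite -/(qf _ _) qfZ.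
by rewrite nmulr_rge0.
Qed.

Lemma psd_congr X T : psd_cone X -> psd_cone (T^T *m X *m T).
Proof.
move=> [XT Xp]; split=> [|v]; first by rewrite !trmx_mul trmxK XT mulmxA.
by rewrite -/(qf _ _) qf_congr; apply: Xp.
Qed.

Lemma psdD X Y : psd_cone X -> psd_cone Y -> psd_cone (X + Y).
Proof.
move=> [XT Xp] [YT Yp]; split=> [|v]; first by rewrite raddfD /= XT YT.
by rewrite -/(qf _ _) qfD addr_ge0 ?Xp ?Yp.
Qed.

Lemma psdZ (t : R) X : 0 <= t -> psd_cone X -> psd_cone (t *: X).
Proof.
move=> t0 [XT Xp]; split=> [|v]; first by rewrite linearZ /= XT.
by rewrite -/(qf _ _) qfZ mulr_ge0 ?Xp.
Qed.

Lemma psd_addr_ker X Y v : psd_cone X -> psd_cone Y ->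
  (X + Y) *m v = 0 -> X *m v = 0.
Proof.
move=> Xp Yp h; apply: psd_ker => //; apply: le_anti; rewrite [X in _ && X]Xp.2 andbT.
have : qf (X + Y) v = 0 by rewrite /qf -mulmxA h mulmx0 mxE.
by rewrite qfD => /eqP; rewrite addr_eq0 => /eqP ->; rewrite oppr_le0; apply: Yp.2.
Qed.

(** The kernel of X + Y always lies in that of X, and the rank bound makes them equal. This is meant
    for a point X of greatest rank in a face, where X + Y is again in the face. *)
Lemma psd_max_rank_ker X Y v : psd_cone X -> psd_cone Y ->
  (\rank (X + Y)%R <= \rank X)%N -> X *m v = 0 -> Y *m v = 0.
Proof.
move=> Xp Yp rk Xv; have [XT _] := Xp; have [YT _] := Yp.
have sub : (kermx (X + Y)%R <= kermx X)%MS.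
  apply/row_subP => i; apply/sub_kermxP.
  have h : row i (kermx (X + Y)%R) *m (X + Y) = 0 by apply/sub_kermxP/row_sub.
  apply: trmx_inj; rewrite trmx_mul XT trmx0; apply: (psd_addr_ker Xp Yp).
  have := congr1 trmx h; rewrite trmx_mul trmx_add XT YT => ->.
  by rewrite trmx0.
have rks : (\rank (kermx X) <= \rank (kermx (X + Y)%R))%N.
  by rewrite !mxrank_ker leq_sub2l.
have eqk : (kermx X <= kermx (X + Y)%R)%MS.
  by have [_ /esym] := mxrank_leqif_sup sub; rewrite eqn_leq rks (mxrankS sub) => ->.
have vX : v^T *m X = 0 by rewrite -XT -trmx_mul Xv trmx0.
have /sub_kermxP : (v^T <= kermx (X + Y)%R)%MS.
  by apply: submx_trans eqk; apply/sub_kermxP.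
rewrite mulmxDr vX add0r => vY.
by apply: trmx_inj; rewrite trmx_mul YT vY trmx0.
Qed.

Lemma pd_psd X : pd_cone X -> psd_cone X.
Proof.
move=> [XT Xp]; split=> // v; have [->|/Xp/ltW//] := eqVneq v 0.
by rewrite mulmx0 mxE.
Qed.

Lemma pd_psdD X Y : pd_cone X -> psd_cone Y -> pd_cone (X + Y).
Proof.
move=> [XT Xp] [YT Yp]; split=> [|v v0]; first by rewrite raddfD /= XT YT.
by rewrite -/(qf _ _) qfD ltr_pwDl ?Xp ?Yp.
Qed.

Lemma pd1 (t : R) : 0 < t -> pd_cone (t%:M : 'M[R]_n).
Proof.
move=> t0; split=> [|v v0]; first by rewrite tr_scalar_mx.
by rewrite -/(qf _ _) -scalemx1 qfZ mulr_gt0 ?qf1_gt0.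
Qed.

Lemma pd_congr X T : T \in unitmx -> pd_cone X -> pd_cone (T^T *m X *m T).
Proof.
move=> Tu [XT Xp]; split=> [|v v0]; first by rewrite !trmx_mul trmxK XT mulmxA.
rewrite -/(qf _ _) qf_congr; apply: Xp; apply: contra_neq v0 => Tv.
by rewrite -[v]mul1mx -(mulVmx Tu) -mulmxA Tv mulmx0.
Qed.

Lemma pd_gram T : T \in unitmx -> pd_cone (T^T *m T).
Proof. by move=> Tu; rewrite -[X in X *m _]mulmx1; apply/pd_congr/pd1. Qed.

Lemma inj_unitmx T : (forall v, T *m v = 0 -> v = 0) -> T \in unitmx.
Proof.
move=> h; rewrite -unitmx_tr -row_free_unit -kermx_eq0.
apply/eqP/row_matrixP => i; rewrite row0; apply: trmx_inj; rewrite trmx0.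
apply: h; apply: trmx_inj; rewrite trmx_mul trmxK trmx0.
by rewrite -row_mul mulmx_ker row0.
Qed.

Lemma pd_unit X : pd_cone X -> X \in unitmx.
Proof.
move=> [_ Xp]; apply: inj_unitmx => v Xv; apply/eqP; apply: contraT => /Xp.
by rewrite -mulmxA Xv mulmx0 mxE ltxx.
Qed.

(** Bounding the form of S^T S at T v, for S the inverse of T, gives |v|^2 <= (b + 1) |T v|^2. *)
Lemma gram_lower_bound T : T \in unitmx ->
  exists2 c : R, 0 < c & forall v, c * qf 1%:M v <= qf (T^T *m T) v.
Proof.
move=> Tu; set S := invmx T; pose b := \sum_i \sum_j `|(S^T *m S) i j|.
have b0 : 0 <= b by apply: sumr_ge0 => i _; apply: sumr_ge0.
exists (b + 1)^-1 => [|v]; first by rewrite invr_gt0 ltr_wpDl.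
rewrite mulrC ler_pdivrMr ?ltr_wpDl// qf_gram mulrDr mulr1.
have := qf_bound (S^T *m S) (T *m v); rewrite qf_gram mulmxA (mulVmx Tu) mul1mx.
rewrite ger0_norm ?qf1_ge0// -/b mulrC => h.
by apply: le_trans h _; rewrite lerDl qf1_ge0.
Qed.

(** The form of [X] is at least c|v|^2, and moving every entry by less than c/(n^2 + 1) changes it
    by less than c|v|^2 for v nonzero. *)
Lemma pd_near X T : T \in unitmx -> X = T^T *m T ->
  \forall Y \near X, Y^T = Y -> pd_cone Y.
Proof.
move=> /gram_lower_bound[c c0 hc] XE; apply/mx_nbhsP.
have nn : 0 < (n * n)%:R + 1 :> R by rewrite ltr_wpDl.
exists (c / ((n * n)%:R + 1)) => [|Y XY YT]; first by rewrite divr_gt0.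
split=> // v v0; rewrite -/(qf _ _).
have -> : Y = X - (X - Y) by rewrite subKr.
rewrite qfD qfN subr_gt0.
apply: le_lt_trans (ler_norm _) _; apply: le_lt_trans (qf_bound _ _) _.
apply: lt_le_trans (_ : c * qf 1%:M v <= _); last by rewrite XE hc.
rewrite ltr_pM2r ?qf1_gt0//.
apply: le_lt_trans (_ : (n * n)%:R * (c / ((n * n)%:R + 1)) < c).
  set d := c / _ in XY *; rewrite natrM -mulrA -[X in X%:R * _](card_ord n).
  rewrite -sum1_card natr_sum mulr_suml.
  apply: ler_sum => i _; rewrite mul1r.
  rewrite -[X in X%:R * _](card_ord n) -sum1_card natr_sum mulr_suml.
  by apply: ler_sum => j _; rewrite mul1r !mxE; apply/ltW/XY.
by rewrite mulrA ltr_pdivrMr// mulrC ltr_pM2l// ltrDl.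
Qed.

End QuadraticForm.

(** * Block matrices through selectors and idempotents *)

Section Selectors.
Variables (R : realType) (r : nat) (p : 'I_r -> nat).
Local Notation n := (\sum_i p i)%N.

(** The i-th block row of the identity. Blocks become products with it, so block computations reduce
    to associativity and to [selK], [sel_ortho] and [sum_sel]. *)
Definition sel i : 'M[R]_(p i, n) := submxcol 1%:M i.

Lemma selE m (A : 'M[R]_(n, m)) i : sel i *m A = submxcol A i.
Proof. by rewrite submxcol_mul mul1mx. Qed.

Lemma submxblock_sel (X : 'M[R]_n) i j :
  submxblock X i j = sel i *m X *m (sel j)^T.
Proof.
rewrite submxblockEv -selE; move: (sel i *m X) => A.
by apply: trmx_inj; rewrite tr_submxrow trmx_mul trmxK selE.
Qed.

Lemma selK i : sel i *m (sel i)^T = 1%:M.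
Proof.
have := submxblock_sel 1%:M i i; rewrite mulmx1 => <-.
by rewrite -mxdiagZ submxblock_diag.
Qed.

Lemma sel_ortho i j : i != j -> sel i *m (sel j)^T = 0.
Proof.
move=> ij; rewrite -[sel i]mulmx1 -submxblock_sel; apply/matrixP => a b.
by rewrite !mxE -val_eqE /= tagnat.eq_Rank (negPf ij).
Qed.

Lemma sum_sel : \sum_i (sel i)^T *m sel i = 1%:M.
Proof.
have e i : (sel i)^T = submxrow 1%:M i by rewrite tr_submxcol trmx1.
transitivity (\sum_i submxrow (1%:M : 'M[R]_n) i *m submxcol (1%:M : 'M[R]_n) i).
  by apply: eq_bigr => i _; rewrite e.
by rewrite -mul_mxrow_mxcol submxrowK submxcolK mul1mx.
Qed.

(* Locked: otherwise matching products would unfold blocks and idempotents. *)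
Definition blk (X : 'M[R]_n) i j : 'M[R]_(p i, p j) :=
  locked (sel i *m X *m (sel j)^T).

Lemma blkE X i j : blk X i j = sel i *m X *m (sel j)^T.
Proof. by rewrite /blk -lock. Qed.

Lemma blkP (X Y : 'M[R]_n) : (forall i j, blk X i j = blk Y i j) -> X = Y.
Proof. by move=> h; apply/mxblockP => i j; rewrite !submxblock_sel -!blkE. Qed.

Lemma blkD X Y i j : blk (X + Y) i j = blk X i j + blk Y i j.
Proof. by rewrite !blkE mulmxDr mulmxDl. Qed.

Lemma blkZ (t : R) X i j : blk (t *: X) i j = t *: blk X i j.
Proof. by rewrite !blkE -scalemxAr -scalemxAl. Qed.

Lemma blk0 i j : blk 0 i j = 0.
Proof. by rewrite !blkE mulmx0 mul0mx. Qed.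

Lemma blkT X i j : blk X^T i j = (blk X j i)^T.
Proof. by rewrite !blkE !trmx_mul trmxK mulmxA. Qed.

Lemma blkM X Y i j : blk (X *m Y) i j = \sum_k blk X i k *m blk Y k j.
Proof.
rewrite blkE -[X in X *m Y]mulmx1 -sum_sel mulmx_sumr mulmx_suml mulmx_sumr.
by rewrite mulmx_suml; apply: eq_bigr => k _; rewrite !blkE !mulmxA.
Qed.

Definition idem i : 'M[R]_n := locked ((sel i)^T *m sel i).

Lemma idemE i : idem i = (sel i)^T *m sel i.
Proof. by rewrite /idem -lock. Qed.

Lemma sum_idem : \sum_i idem i = 1%:M.
Proof. by rewrite -sum_sel; apply: eq_bigr => i _; rewrite idemE. Qed.

Lemma idemT i : (idem i)^T = idem i.
Proof. by rewrite idemE trmx_mul trmxK. Qed.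

Lemma idemK i : idem i *m idem i = idem i.
Proof. by rewrite !idemE mulmxA -[X in X *m _]mulmxA selK mulmx1. Qed.

Lemma idem_ortho i j : i != j -> idem i *m idem j = 0.
Proof.
by move=> ij; rewrite !idemE mulmxA -[X in X *m _]mulmxA sel_ortho // mulmx0 mul0mx.
Qed.

Lemma idem_blk X i j : idem i *m X *m idem j = (sel i)^T *m blk X i j *m sel j.
Proof. by rewrite !idemE !blkE !mulmxA. Qed.

Lemma blk_idem i : blk (idem i) i i = 1%:M.
Proof. by rewrite !blkE !idemE !mulmxA selK mul1mx selK. Qed.

Lemma sel_idem i : sel i *m idem i = sel i.
Proof. by rewrite !idemE mulmxA selK mul1mx. Qed.

Lemma sel_idem0 i j : i != j -> sel i *m idem j = 0.
Proof. by move=> ij; rewrite !idemE mulmxA sel_ortho// mul0mx. Qed.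

Lemma idem_sel i : idem i *m (sel i)^T = (sel i)^T.
Proof. by rewrite -idemT -trmx_mul sel_idem. Qed.

Lemma idem_sel0 i j : i != j -> idem i *m (sel j)^T = 0.
Proof. by move=> ij; rewrite -idemT -trmx_mul sel_idem0 ?trmx0 // eq_sym. Qed.

Lemma blk_idemM k X i j : blk (idem k *m X) i j = if i == k then blk X i j else 0.
Proof.
rewrite !blkE mulmxA; case: eqVneq => [->|ik]; first by rewrite sel_idem.
by rewrite sel_idem0 // !mul0mx.
Qed.

Lemma blk_Midem k X i j : blk (X *m idem k) i j = if j == k then blk X i j else 0.
Proof.
rewrite !blkE -!mulmxA; case: eqVneq => [->|jk]; first by rewrite idem_sel.
by rewrite idem_sel0 1?eq_sym // !mulmx0.
Qed.

Lemma eq_idemM m (X Y : 'M[R]_(n, m)) : (forall k, idem k *m X = idem k *m Y) -> X = Y.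
Proof.
move=> h; rewrite -[X]mul1mx -[Y]mul1mx -sum_idem !mulmx_suml.
by apply: eq_bigr.
Qed.

End Selectors.

Arguments sel {R r} p i.
Arguments idem {R r} p i.

(** * The triangular algebra and block Cholesky factorisation *)

Lemma memv_bigcapP (K : fieldType) (vT : vectType K) (I : finType)
    (U : I -> {vspace vT}) (x : vT) :
  reflect (forall i, x \in U i) (x \in (\bigcap_i U i)%VS).
Proof.
rewrite memvE; apply: (iffP subv_bigcapP) => h i.
  by rewrite memvE; apply: h.
by move=> _; rewrite -memvE.
Qed.

Section Triangular.
Variables (R : realType) (r : nat) (p : 'I_r -> nat).
Variable V : forall i j : 'I_r, {vspace 'M[R]_(p i, p j)}.
Hypothesis hV : ishi_axioms V.
Local Notation n := (\sum_i p i)%N.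
Local Notation E := (@idem R r p).
Implicit Types (X Y T U : 'M[R]_n).

Definition blk_lfun i j : 'Hom('M[R]_n, 'M[R]_(p i, p j)) :=
  linfun (mulmxr (sel p j)^T \o mulmx (sel p i)).

Lemma blk_lfunE i j X : blk_lfun i j X = blk X i j.
Proof. by rewrite lfunE blkE. Qed.

Definition tri : {vspace 'M[R]_n} :=
  (\bigcap_(ij : 'I_r * 'I_r) (blk_lfun ij.1 ij.2 @^-1:
     (if (ij.1 <= ij.2)%N then V ij.1 ij.2 else 0)))%VS.

Lemma triP T : reflect ((forall i j : 'I_r, (i <= j)%N -> blk T i j \in V i j) /\
    (forall i j : 'I_r, (j < i)%N -> blk T i j = 0)) (T \in tri).
Proof.
apply: (iffP (memv_bigcapP _ _)) => [h|[h1 h2] [i j]].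
  split=> i j ij; have := h (i, j); rewrite -memv_preim /= blk_lfunE.
    by rewrite ij.
  by rewrite leqNgt ij /= memv0 => /eqP.
rewrite -memv_preim /= blk_lfunE; case: leqP => ij; first exact: h1.
by rewrite memv0 h2.
Qed.

Lemma ishi_spaceP X : ishi_space V X <->
  X^T = X /\ forall i j : 'I_r, (i <= j)%N -> blk X i j \in V i j.
Proof.
by split=> -[h1 h2]; split=> // i j /h2; rewrite submxblock_sel blkE.
Qed.

Lemma ishi_spaceD X Y : ishi_space V X -> ishi_space V Y -> ishi_space V (X + Y).
Proof.
move=> /ishi_spaceP[XT XV] /ishi_spaceP[YT YV]; apply/ishi_spaceP; split.
  by rewrite trmx_add XT YT.
by move=> i j ij; rewrite blkD memvD ?XV ?YV.
Qed.

Lemma ishi_spaceZ (t : R) X : ishi_space V X -> ishi_space V (t *: X).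
Proof.
move=> /ishi_spaceP[XT XV]; apply/ishi_spaceP; split; first by rewrite trmx_scale XT.
by move=> i j ij; rewrite blkZ memvZ ?XV.
Qed.

Lemma ishi_spaceB X Y : ishi_space V X -> ishi_space V Y -> ishi_space V (X - Y).
Proof. by move=> hX hY; rewrite -scaleN1r; apply/ishi_spaceD/ishi_spaceZ. Qed.

Lemma triM T U : T \in tri -> U \in tri -> T *m U \in tri.
Proof.
move=> /triP[T1 T2] /triP[U1 U2]; apply/triP; split=> i j ij; rewrite blkM.
  apply: memv_suml => k _; case: (leqP i k) => ik; last by rewrite T2 // mul0mx mem0v.
  case: (leqP k j) => kj; last by rewrite U2 // mulmx0 mem0v.
  by apply: (ishi_V1 hV ik kj); [apply: T1 | apply: U1].
apply: big1 => k _; case: (leqP i k) => ik; last by rewrite T2 // mul0mx.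
by rewrite U2 ?mulmx0 //; apply: leq_trans ik.
Qed.

Lemma tri_idem k : E k \in tri.
Proof.
apply/triP; split=> i j ij; rewrite -[E k]mul1mx blk_Midem.
  case: eqVneq => [jk|_]; last exact: mem0v.
  rewrite !blkE mulmx1; case: (eqVneq i j) => [e|ne].
    by subst i; rewrite selK (ishi_diag hV) memv_line.
  by rewrite sel_ortho // mem0v.
case: eqVneq => // jk; rewrite !blkE mulmx1 sel_ortho //.
by apply: contraTneq ij => ->; rewrite ltnn.
Qed.

Lemma tri1 : 1%:M \in tri.
Proof. by rewrite -sum_idem; apply: memv_suml => k _; apply: tri_idem. Qed.

Lemma tri_idemM k T : T \in tri -> E k *m T \in tri.
Proof. by move=> hT; apply: triM => //; apply: tri_idem. Qed.

Lemma ishi_space_diag X k : ishi_space V X -> exists t : R, E k *m X *m E k = t *: E k.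
Proof.
move=> /ishi_spaceP[_ /(_ k k (leqnn k))]; rewrite (ishi_diag hV) => /vlineP[t bt].
by exists t; rewrite idem_blk bt -scalemxAr -scalemxAl mulmx1 idemE.
Qed.

Lemma idem_neq0 k : E k != 0.
Proof.
apply/eqP => Ek; have := blk_idem R p k; rewrite Ek blk0 => /matrixP.
have p0 := ishi_size hV k.
move=> /(_ (Ordinal p0) (Ordinal p0)); rewrite !mxE eqxx => /esym/eqP.
by rewrite oner_eq0.
Qed.

(** Block (i, j) is the sum over k <= i of T_ki^T T_kj, which lies in V_ij by [V2] if i < j and by
    [V3] if i = j. *)
Lemma ishi_space_gram T : T \in tri -> ishi_space V (T^T *m T).
Proof.
move=> /triP[T1 T2]; apply/ishi_spaceP; split; first by rewrite trmx_mul trmxK.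
move=> i j ij; rewrite blkM; apply: memv_suml => k _; rewrite blkT.
case: (leqP k i) => ki; last by rewrite T2 // trmx0 mul0mx mem0v.
move: ij; rewrite leq_eqVlt => /orP[/eqP/val_inj e|ij].
  by subst j; apply: (ishi_V3 hV ki); apply: T1.
by apply: (ishi_V2 hV ki ij); apply: T1 => //; apply: leq_trans (ltnW ij).
Qed.

Lemma ishi_space1 : ishi_space V 1%:M.
Proof. by have := ishi_space_gram tri1; rewrite trmx1 mulmx1. Qed.

(** Identified with the topological closure of [ishi_cone V] in [closure_ishi_cone]. *)
Definition ishi_closed_cone : set 'M[R]_n := @psd_cone R n `&` ishi_space V.
Local Notation C := ishi_closed_cone.

Lemma closed_cone_gram T : T \in tri -> C (T^T *m T).
Proof. by move=> hT; split; [apply: psd_gram | apply: ishi_space_gram]. Qed.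

Lemma closed_coneD X Y : C X -> C Y -> C (X + Y).
Proof. by move=> [? ?] [? ?]; split; [apply: psdD | apply: ishi_spaceD]. Qed.

Lemma closed_coneZ (t : R) X : 0 <= t -> C X -> C (t *: X).
Proof. by move=> t0 [? ?]; split; [apply: psdZ | apply: ishi_spaceZ]. Qed.

Lemma closed_cone0 : C 0.
Proof. by have := closed_cone_gram (mem0v tri); rewrite mulmx0. Qed.

(* [prow k T]: T is a single block row k, with positive pivot t on the diagonal
   block; [chol T] allows in each row either such a row or zero. The Gram
   matrices T^T T of the former span the extreme rays of the closed cone. *)
Definition prow (k : 'I_r) (T : 'M[R]_n) :=
  [/\ T \in tri, E k *m T = T & exists2 t : R, 0 < t & T *m E k = t *: E k].

Definition chol (T : 'M[R]_n) :=
  T \in tri /\ forall k, E k *m T = 0 \/ prow k (E k *m T).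

Definition supp (T : 'M[R]_n) : {set 'I_r} := [set k | E k *m T != 0].

Lemma prow_neq0 k T : prow k T -> T != 0.
Proof.
move=> [_ _ [t t0 Tk]]; apply/eqP => T0; move: Tk; rewrite T0 mul0mx.
by move/esym/eqP; rewrite scaler_eq0 (negPf (idem_neq0 k)) gt_eqF.
Qed.

(** Induction on the number d of rows left, the first m = r - d rows of X being zero. The next
    diagonal block is y E_k with y >= 0. If y > 0, its row scaled by y^(-1/2) is split off, and the
    Schur complement has one more zero row. *)
Lemma cholesky X : C X -> exists2 T, chol T & X = T^T *m T.
Proof.
suff main d m : (m + d)%N = r -> forall X, C X ->
    (forall k : 'I_r, (k < m)%N -> E k *m X = 0) ->
    exists2 T, chol T /\ (forall k : 'I_r, (k < m)%N -> E k *m T = 0) &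
      X = T^T *m T.
  by move=> CX; have [//|T [] ? _ ?] := main r 0%N (add0n r) X CX; exists T.
elim: d m => [|d IH] m; last first.
  move=> mr {}X CX X0; have mlt : (m < r)%N by rewrite -mr addnS ltnS leq_addr.
  have {}IH := IH m.+1 (etrans (addSnnS m d) mr).
  pose k := Ordinal mlt; have [Xpsd Xsp] := CX; have [XT Xp] := Xpsd.
  have split_le (P : 'I_r -> Prop) : (forall l : 'I_r, (l < m)%N -> P l) -> P k ->
      forall l : 'I_r, (l < m.+1)%N -> P l.
    move=> h hk l; rewrite ltnS leq_eqVlt => /orP[/eqP lm|/h//].
    by have -> : l = k by apply: val_inj.
  have [y Xy] := ishi_space_diag k Xsp.
  have y0 : 0 <= y.
    apply: (@psd_scale_ge0 _ _ (E k)); last by rewrite -Xy -{1}idemT; apply: psd_congr.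
      by rewrite -idemK -{1}idemT; apply: psd_gram.
    exact: idem_neq0.
  move: y0; rewrite le_eqVlt => /orP[/eqP y0|y_gt0].
    (* A semidefinite matrix with a zero diagonal block has the whole block row zero. *)
    have EX : E k *m X = 0.
      apply: trmx_inj; rewrite trmx_mul XT idemT trmx0; apply: psd_ker_mul => //.
      by rewrite idemT Xy -y0 scale0r.
    have [|T [cT T0] ->] := IH X CX; first exact: split_le.
    by exists T => //; split=> // l lm; apply: T0; apply: ltnW.
  pose rho : 'M[R]_n := (Num.sqrt y)^-1 *: (E k *m X).
  have sy : 0 < Num.sqrt y by rewrite sqrtr_gt0.
  have rtr : rho \in tri.
    have [_ hX] := (ishi_spaceP X).1 Xsp.
    apply: memvZ; apply/triP; split=> i j ij; rewrite blk_idemM.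
      by case: eqVneq => _; rewrite ?mem0v ?hX.
    (* Left of the pivot the row is zero, being the transpose of blocks in rows already
       eliminated. *)
    case: eqVneq => // ik; have jm : (j < m)%N by rewrite ik in ij.
    have := congr1 (fun Z => blk Z j i) (X0 j jm).
    by rewrite blk_idemM eqxx blk0 -[X in blk X i j]XT blkT => ->; rewrite trmx0.
  have Er : E k *m rho = rho by rewrite /rho -scalemxAr mulmxA idemK.
  have rE : rho *m E k = Num.sqrt y *: E k.
    rewrite /rho -scalemxAl Xy scalerA; congr (_ *: _).
    by rewrite -{2}[y]sqr_sqrtr ?ltW// expr2 mulKf ?gt_eqF.
  have rr : rho^T *m rho = y^-1 *: (X *m E k *m X).
    rewrite /rho trmx_scale -scalemxAl -scalemxAr scalerA -invfM -expr2.
    rewrite sqr_sqrtr ?ltW// trmx_mul XT idemT mulmxA -[X in _ *: (X *m _)]mulmxA.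
    by rewrite idemK.
  clearbody rho.
  have EXr : E k *m (X - rho^T *m rho) = 0.
    rewrite mulmxBr rr -scalemxAr !mulmxA Xy -!scalemxAl scalerA mulVf ?gt_eqF//.
    by rewrite scale1r subrr.
  have X'C : C (X - rho^T *m rho).
    split; last exact: ishi_spaceB (ishi_space_gram rtr).
    (* the Schur complement is the congruence of X by 1 - y^-1 E_k X *)
    have -> : X - rho^T *m rho =
        (1%:M - y^-1 *: (E k *m X))^T *m X *m (1%:M - y^-1 *: (E k *m X)).
      rewrite trmx_sub trmx1 trmx_scale trmx_mul XT idemT rr.
      set Z := X *m E k *m X.
      rewrite mulmxBl mul1mx -scalemxAl mulmxBr mulmx1 mulmxBl -!scalemxAr.
      rewrite -!scalemxAl mulmxA -/Z.
      have -> : X *m E k *m X *m (E k *m X) = y *: Z.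
        transitivity (X *m (E k *m X *m E k) *m X); first by rewrite !mulmxA.
        by rewrite Xy -scalemxAr -scalemxAl.
      by rewrite [y^-1 *: (y *: Z)]scalerA mulVf ?gt_eqF// scale1r subrr subr0.
    exact: psd_congr.
  have [|T [[Ttri cT] T0] XE] := IH _ X'C.
    apply: split_le EXr => l lm; rewrite mulmxBr rr X0 // -scalemxAr !mulmxA.
    by rewrite X0 // !mul0mx scaler0 subrr.
  have rT : rho^T *m T = 0.
    by rewrite -Er trmx_mul idemT -mulmxA T0 // mulmx0.
  exists (rho + T); last first.
    rewrite trmx_add mulmxDl !mulmxDr rT addr0 -XE.
    by rewrite -[T^T *m rho]trmxK trmx_mul trmxK rT trmx0 add0r addrC subrK.
  have El l : l != k -> E l *m rho = 0.
    by move=> lk; rewrite -Er mulmxA idem_ortho ?mul0mx.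
  split; last first.
    move=> l lm; rewrite mulmxDr El ?T0 ?addr0 //; first by apply: ltnW.
    by apply: contraTneq lm => ->; rewrite ltnn.
  split; first exact: memvD.
  move=> l; rewrite mulmxDr; case: (eqVneq l k) => [->|lk].
    right; rewrite Er T0 // addr0; split => //; by exists (Num.sqrt y).
  by rewrite El // add0r.
rewrite addn0 => -> {}X CX X0; exists 0; last first.
  by rewrite mulmx0; apply: eq_idemM => k; rewrite mulmx0 X0.
split; last by move=> k _; rewrite mulmx0.
by split=> [|k]; [apply: mem0v | left; rewrite mulmx0].
Qed.

End Triangular.

(** * Faces of a cone and sums of extreme rays *)

Section ConeFaces.
Variables (R : realType) (E : vectType R) (C : set E).
Hypothesis C0 : C 0.
Hypothesis CZ : forall (t : R) x, 0 <= t -> C x -> C (t *: x).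

(** For s > 1 the point x is inside the segment from 0 to s x, so the face contains both ends;
    factors at most 1 follow by convexity with 0. *)
Lemma face_scale (F : set E) (t : R) x :
  is_face C F -> 0 <= t -> F x -> F (t *: x).
Proof.
move=> [_ FC Fc Ff] t0 Fx.
have up s : 1 < s -> F 0 /\ F (s *: x).
  move=> s1; have s0 : 0 < s by apply: lt_trans s1.
  apply: (Ff 0 (s *: x) s^-1) => //; first by apply: CZ (FC _ Fx); apply: ltW.
    by rewrite invr_gt0 s0 invf_lt1.
  by rewrite scaler0 add0r scalerA mulVf ?gt_eqF // scale1r.
have [t1|/up[]//] := lerP t 1.
have [F0 _] := up 2 (ltr1n R 2).
have := (convex_setE F).1 Fc x 0 t Fx F0 t0 t1.
by rewrite scaler0 addr0.
Qed.

(** The sum x + y is the midpoint of 2x and 2y. *)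
Lemma face_summand (F : set E) x y :
  is_face C F -> C x -> C y -> F (x + y) -> F x.
Proof.
move=> fF Cx Cy Fxy; have [_ _ _ Ff] := fF.
have h : (1 - 2^-1 : R) = 2^-1 by field.
have i2 : 0 < (2^-1 : R) < 1 by apply/andP; split; lra.
have [] := Ff (2 *: x) (2 *: y) 2^-1 _ _ i2; try exact: CZ.
  by rewrite h !scalerA mulVf // !scale1r.
move=> F2x _; have := face_scale fF (ltW (andP i2).1) F2x.
by rewrite scalerA mulVf // scale1r.
Qed.

(** The endpoints of an open segment, with their positive weights, are summands of the point between
    them. *)
Lemma is_face_intro (F : set E) : F !=set0 -> F `<=` C ->
  (forall x y, F x -> F y -> F (x + y)) ->
  (forall (t : R) x, 0 <= t -> F x -> F (t *: x)) ->
  (forall x y, C x -> C y -> F (x + y) -> F x) -> is_face C F.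
Proof.
move=> Fn FC FD FZ Fs; split=> //.
  apply/convex_setE => x y t Fx Fy t0 t1; apply: FD; apply: FZ => //.
  by rewrite subr_ge0.
move=> x y t Cx Cy /andP[t0 t1] Fxy.
have t1' : 0 < 1 - t by rewrite subr_gt0.
have h1 : F ((1 - t) *: x) by apply: Fs Fxy; apply: CZ => //; apply: ltW.
have h2 : F (t *: y).
  by rewrite addrC in Fxy; apply: Fs Fxy; apply: CZ => //; apply: ltW.
have inv (s : R) z : 0 < s -> F (s *: z) -> F z.
  move=> s0 /(FZ s^-1); rewrite scalerA mulVf ?gt_eqF // scale1r; apply.
  by rewrite invr_ge0 ltW.
by split; [apply: inv h1 | apply: inv h2].
Qed.

End ConeFaces.

Section SumOfRays.
Variables (R : realType) (E : vectType R) (C : set E).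

Lemma in_sum_of_rays0 : in_sum_of_rays C 0 0.
Proof.
exists (fun=> set0); split=> [[]//|].
by exists (fun=> 0) => [[]//|]; rewrite big_ord0.
Qed.

Lemma in_sum_of_rays1 F x : extreme_ray C F -> F x -> in_sum_of_rays C x 1.
Proof.
move=> hF Fx; exists (fun=> F); split=> //.
by exists (fun=> x) => //; rewrite big_ord1.
Qed.

Lemma in_sum_of_raysD x y a b : in_sum_of_rays C x a ->
  in_sum_of_rays C y b -> in_sum_of_rays C (x + y) (a + b).
Proof.
move=> [ra [hra [xa xra ->]]] [rb [hrb [xb xrb ->]]].
exists (fun i => match fintype.split i with inl j => ra j | inr j => rb j end); split.
  by move=> i; case: fintype.split.
exists (fun i => match fintype.split i with inl j => xa j | inr j => xb j end).
  by move=> i; case: fintype.split.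
by rewrite big_split_ord /=; congr (_ + _); apply: eq_bigr => i _;
   rewrite ?(unsplitK (inl _)) ?(unsplitK (inr _)).
Qed.

Lemma in_sum_of_rays_sum (I : finType) (S : {set I}) (x : I -> E) :
  (forall i, i \in S -> in_sum_of_rays C (x i) 1) ->
  in_sum_of_rays C (\sum_(i in S) x i) #|S|.
Proof.
move=> h; rewrite cardE -big_enum /=.
have : forall i, i \in enum S -> in_sum_of_rays C (x i) 1.
  by move=> i; rewrite mem_enum; apply: h.
elim: (enum S) => [|i s IH] hs /=; first by rewrite big_nil; apply: in_sum_of_rays0.
rewrite big_cons -add1n; apply: in_sum_of_raysD.
  by apply: hs; rewrite mem_head.
by apply: IH => j js; apply: hs; rewrite in_cons js orbT.
Qed.

Lemma caratheodory_at_exists x k : in_sum_of_rays C x k ->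
  exists2 l, caratheodory_at C x l & (l <= k)%N.
Proof.
move=> hk; pose P l := `[< in_sum_of_rays C x l >].
have exP : exists l, P l by exists k; apply/asboolP.
case: (ex_minnP exP) => l /asboolP hl lmin; exists l; last exact/lmin/asboolP.
by split=> // l' hl'; apply/lmin/asboolP.
Qed.

Lemma caratheodory_number_intro N :
  (forall x, C x -> exists2 k, in_sum_of_rays C x k & (k <= N)%N) ->
  (exists2 x, C x & forall l, in_sum_of_rays C x l -> (N <= l)%N) ->
  caratheodory_number C N.
Proof.
move=> hub [x Cx hlb]; split=> [|y /hub[k /caratheodory_at_exists[l hl lk] kN]].
  exists x => //; have [k hk kN] := hub x Cx; split; last exact: hlb.
  by have -> : N = k by apply/eqP; rewrite eqn_leq kN hlb.
by exists l => //; apply: leq_trans kN.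
Qed.

End SumOfRays.

(** * Sums of block idempotents *)

Section IdempotentSums.
Variables (R : realType) (r : nat) (p : 'I_r -> nat).
Local Notation n := (\sum_i p i)%N.
Local Notation E := (@idem R r p).
Implicit Types (S : {set 'I_r}).

Definition idems S : 'M[R]_n := \sum_(k in S) E k.

Lemma idem_idems k S : E k *m idems S = if k \in S then E k else 0.
Proof.
rewrite /idems mulmx_sumr; case: ifP => kS.
  rewrite [LHS](bigD1 k) //= idemK [X in _ + X]big1 ?addr0 // => j /andP[_ jk].
  by rewrite idem_ortho // eq_sym.
by apply: big1 => j jS; rewrite idem_ortho //; apply: contraFneq kS => ->.
Qed.

Lemma idemsT S : (idems S)^T = idems S.
Proof.
rewrite /idems [LHS]raddf_sum /=; apply: eq_bigr => k _.
exact: idemT.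
Qed.

Lemma idems_idem k S : idems S *m E k = if k \in S then E k else 0.
Proof.
apply: trmx_inj; rewrite trmx_mul idemT idemsT idem_idems.
by case: ifP; rewrite ?idemT ?trmx0.
Qed.

Lemma idemsK S : idems S *m idems S = idems S.
Proof.
rewrite {1}/idems mulmx_suml; apply: eq_bigr => k kS.
by rewrite idem_idems kS.
Qed.

Lemma idems1 k : idems [set k] = E k.
Proof. exact: big_set1. Qed.

Lemma idemsC S : idems S + idems (~: S) = 1%:M.
Proof.
rewrite -sum_idem [RHS](bigID (mem S)) /=; congr (_ + _).
by apply: eq_bigl => k; rewrite inE.
Qed.

Lemma psd_idems S : psd_cone (idems S).
Proof. by rewrite -idemsK -{1}idemsT; apply: psd_gram. Qed.

Lemma mul_idems_supported m (Z : 'M[R]_(m, n)) S :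
  (forall k, k \notin S -> Z *m E k = 0) -> Z *m idems S = Z.
Proof.
move=> h; rewrite -[RHS]mulmx1 -(idemsC S) mulmxDr [X in _ = _ + X](_ : _ = 0).
  by rewrite addr0.
by rewrite mulmx_sumr [LHS]big1 // => k; rewrite inE => /h.
Qed.

(** On vectors in a block outside [S] the form of [idems p S] vanishes, so that of [Z] is at most 0
    and they lie in its kernel. *)
Lemma psd_le_idems_supported (c : R) Z S :
  psd_cone Z -> psd_cone (c *: idems S - Z) ->
  forall k, k \notin S -> Z *m E k = 0.
Proof.
move=> Zp [_ h] k kS; apply: mx_cv_eq0 => v; rewrite -mulmxA.
apply: psd_ker => //; apply: le_anti; rewrite [X in _ && X]Zp.2 andbT.
have := h (E k *m v); rewrite -/(qf _ _) qfD qfN qfZ.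
by rewrite /qf mulmxA -[_ *m idems S *m E k]mulmxA idems_idem (negPf kS)
  mulmx0 mul0mx mxE mulr0 add0r oppr_ge0.
Qed.

End IdempotentSums.

Arguments idems {R r} p S.

(** * Congruence by triangular matrices and the extreme rays *)

Section GroupAction.
Variables (R : realType) (r : nat) (p : 'I_r -> nat).
Variable V : forall i j : 'I_r, {vspace 'M[R]_(p i, p j)}.
Hypothesis hV : ishi_axioms V.
Local Notation n := (\sum_i p i)%N.
Local Notation E := (@idem R r p).
Local Notation ES := (@idems R r p).
Local Notation C := (ishi_closed_cone V).
Local Notation tri := (tri V).
Implicit Types (X Y T U G : 'M[R]_n).

Lemma tri_lower T (k j : 'I_r) : T \in tri -> (j < k)%N -> E k *m T *m E j = 0.
Proof. by move=> /triP[_ h] /h jk; rewrite idem_blk jk mulmx0 mul0mx. Qed.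

(** Back substitution: the block rows of G v = 0 are solved from the last one upwards, dividing by
    the positive pivots. *)
Lemma chol_full_unit G : G \in tri -> (forall k, prow V k (E k *m G)) ->
  G \in unitmx.
Proof.
move=> Gt Gp; apply: inj_unitmx => v Gv.
suff main d : forall k : 'I_r, (r - k <= d)%N -> E k *m v = 0.
  by apply: eq_idemM => k; rewrite mulmx0; apply: (main r); apply: leq_subr.
elim: d => [|d IH] k; first by rewrite leqn0 subn_eq0 leqNgt ltn_ord.
move=> kd; have [_ _ [t t0 Gk]] := Gp k.
have : E k *m G *m v = 0 by rewrite -mulmxA Gv mulmx0.
rewrite -[X in _ *m X]mul1mx -sum_idem mulmx_suml mulmx_sumr.
rewrite [X in X = 0 -> _](bigD1 k) //= mulmxA Gk [X in _ + X]big1 ?addr0 => [|j jk].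
  by rewrite -scalemxAl => /eqP; rewrite scaler_eq0 gt_eqF //= => /eqP.
case: (ltngtP j k) => [jk'|kj|/val_inj e]; last by rewrite e eqxx in jk.
  by rewrite mulmxA tri_lower // mul0mx.
rewrite IH ?mulmx0 //; rewrite -ltnS; apply: leq_trans kd.
by apply: ltn_sub2l.
Qed.

(** Left multiplication by G maps the finite-dimensional [tri] injectively into itself, hence onto;
    the preimage of 1 is the inverse. *)
Lemma tri_inv G : G \in tri -> G \in unitmx -> invmx G \in tri.
Proof.
move=> Gt Gu; pose f : 'End('M[R]_n) := linfun (mulmx G).
have fE X : f X = G *m X by rewrite lfunE.
have ff : (f @: tri <= tri)%VS.
  by apply/subvP => _ /memv_imgP[X Xt ->]; rewrite fE; apply: (triM hV).
have f0 : (tri :&: lker f)%VS = 0%VS.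
  apply/eqP; rewrite -subv0; apply/subvP => X; rewrite memv_cap memv_ker memv0 fE.
  by move=> /andP[_ /eqP GX]; rewrite -[X]mul1mx -(mulVmx Gu) -mulmxA GX mulmx0.
have /eqP fT : (f @: tri == tri)%VS by rewrite eqEdim ff (limg_dim_eq f0) leqnn.
have : 1%:M \in (f @: tri)%VS by rewrite fT tri1.
move=> /memv_imgP[X Xt]; rewrite fE => GX.
by rewrite -[invmx G]mulmx1 GX mulmxA (mulVmx Gu) mul1mx.
Qed.

(** That the product stays in V is visible only after factoring X = U^T U: it is then the Gram
    matrix of U T. *)
Lemma closed_cone_congr T X : T \in tri -> C X -> C (T^T *m X *m T).
Proof.
move=> Tt /(cholesky hV)[U [Ut _] ->].
have -> : T^T *m (U^T *m U) *m T = (U *m T)^T *m (U *m T).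
  by rewrite trmx_mul !mulmxA.
by apply: (closed_cone_gram hV); apply: (triM hV).
Qed.

Lemma congrVK G X : G \in unitmx ->
  G^T *m ((invmx G)^T *m X *m invmx G) *m G = X.
Proof.
move=> Gu; rewrite !mulmxA -trmx_mul (mulVmx Gu) trmx1 mul1mx.
by rewrite -mulmxA (mulVmx Gu) mulmx1.
Qed.

Lemma congrKV G X : G \in unitmx ->
  (invmx G)^T *m (G^T *m X *m G) *m invmx G = X.
Proof. by move=> Gu; have := @congrVK (invmx G) X; rewrite invmxK unitmx_inv; apply. Qed.

Lemma closed_cone_congrV G X : G \in tri -> G \in unitmx -> C (G^T *m X *m G) -> C X.
Proof.
by move=> Gt Gu /(closed_cone_congr (tri_inv Gt Gu)); rewrite congrKV.
Qed.

Lemma prow_idem k : prow V k (E k).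
Proof.
split; [exact: tri_idem | exact: idemK |].
by exists 1 => //; rewrite idemK scale1r.
Qed.

(** Identity rows replace the zero rows. For a Cholesky factor T this is an invertible G in [tri]
    with T^T T = G^T P G, where P = [idems p (supp T)]. *)
Definition complete T : 'M[R]_n := T + ES (~: supp T).

Lemma complete_row T k :
  E k *m complete T = if k \in supp T then E k *m T else E k.
Proof.
rewrite /complete mulmxDr idem_idems !inE negbK.
by case: eqP => [->|_] /=; rewrite ?add0r ?addr0.
Qed.

Lemma idems_complete T : ES (supp T) *m complete T = T.
Proof.
apply: eq_idemM => k; rewrite mulmxA idem_idems.
have := complete_row T k; case: ifP => [_ -> //|+ _].
by rewrite inE mul0mx => /negbFE/eqP.
Qed.

Lemma complete_tri T : T \in tri -> complete T \in tri.
Proof.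
by move=> Tt; apply: memvD => //; apply: memv_suml => k _; apply: (tri_idem hV).
Qed.

Lemma complete_unit T : chol V T -> complete T \in unitmx.
Proof.
move=> [Tt Tr]; apply: chol_full_unit => [|k]; first exact: complete_tri.
rewrite complete_row; case: ifP => kT; last exact: prow_idem.
by case: (Tr k) => // T0; move: kT; rewrite inE T0 eqxx.
Qed.

Lemma gram_complete T :
  T^T *m T = (complete T)^T *m ES (supp T) *m complete T.
Proof.
rewrite -{1 2}(idems_complete T) trmx_mul idemsT !mulmxA -[_ *m ES _ *m ES _]mulmxA.
by rewrite idemsK.
Qed.

Lemma gram_addr k U T : E k *m U = 0 -> E k *m T = T ->
  (U + T)^T *m (U + T) = U^T *m U + T^T *m T.
Proof.
move=> EU ET; have UT : U^T *m T = 0.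
  by rewrite -ET -[E k]idemT mulmxA -trmx_mul EU trmx0 mul0mx.
rewrite trmx_add mulmxDl !mulmxDr UT addr0; congr (_ + _).
by rewrite -[T^T *m U]trmxK trmx_mul trmxK UT trmx0 add0r.
Qed.

Lemma gram_rows T : T^T *m T = \sum_(k in supp T) (E k *m T)^T *m (E k *m T).
Proof.
have h k : (E k *m T)^T *m (E k *m T) = T^T *m E k *m T.
  by rewrite trmx_mul idemT mulmxA -[_ *m E k *m E k]mulmxA idemK.
rewrite -[X in _ *m X]mul1mx -sum_idem mulmx_suml mulmx_sumr.
rewrite [LHS](bigID (mem (supp T))) /= [X in _ + X]big1 ?addr0 => [|k].
  by apply: eq_bigr => k _; rewrite h mulmxA.
by rewrite inE negbK => /eqP ->; rewrite mulmx0.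
Qed.

Lemma prow_row k j T : prow V k T -> j != k -> E j *m T = 0.
Proof. by move=> [_ <- _] jk; rewrite mulmxA idem_ortho // mul0mx. Qed.

Lemma prow_chol k T : prow V k T -> chol V T.
Proof.
move=> hT; have [Tt Tk _] := hT; split=> // j.
by have [->|jk] := eqVneq j k; [right; rewrite Tk | left; apply: prow_row hT jk].
Qed.

Lemma prow_supp k T : prow V k T -> supp T = [set k]%SET.
Proof.
move=> hT; have [_ Tk _] := hT; apply/setP => j; rewrite !inE.
have [->|jk] := eqVneq j k; first by rewrite Tk (prow_neq0 hV hT).
by rewrite (prow_row hT jk) eqxx.
Qed.

(** Congruence by the inverse of G moves the ray to that of E_k. A summand Z of s E_k is supported
    on block k, and V_kk consists of scalar matrices, so Z is a multiple of E_k. *)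
Lemma extreme_ray_prow k T : prow V k T ->
  extreme_ray C [set s *: (T^T *m T) | s in [set s : R | 0 <= s]].
Proof.
move=> hT; have [Tt _ _] := hT; have T0 := prow_neq0 hV hT.
have gT := gram_complete T; rewrite (prow_supp hT) idems1 in gT.
set G := complete T in gT.
have Gu : G \in unitmx by apply/complete_unit/(prow_chol hT).
have Gt : G \in tri by apply: complete_tri.
set Q := T^T *m T; have CQ : C Q by apply: (closed_cone_gram hV).
split.
  apply: is_face_intro.
  - by move=> t x t0; apply: closed_coneZ.
  - by exists 0, 0; rewrite /= ?scale0r.
  - by move=> _ [s /= s0 <-]; apply: closed_coneZ.
  - by move=> _ _ [s /= s0 <-] [t /= t0 <-]; exists (s + t);
      rewrite /= ?addr_ge0 // scalerDl.
  - by move=> t _ t0 [s /= s0 <-]; exists (t * s); rewrite /= ?mulr_ge0 // scalerA.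
  move=> x y Cx Cy [s /= s0 e].
  pose Z := (invmx G)^T *m x *m invmx G; pose W := (invmx G)^T *m y *m invmx G.
  have xZ : x = G^T *m Z *m G by rewrite congrVK.
  have [Zp Zs] : C Z by apply: closed_cone_congr => //; apply: tri_inv.
  have [Wp _] : C W by apply: closed_cone_congr => //; apply: tri_inv.
  have sE : s *: E k = Z + W.
    rewrite /Z /W -mulmxDl -mulmxDr -e /Q gT -scalemxAr -scalemxAl.
    by rewrite congrKV.
  have Zk : Z *m E k = Z.
    rewrite -idems1; apply: mul_idems_supported.
    apply: (psd_le_idems_supported (c := s) Zp).
    by rewrite idems1 sE addrC addrA addNr add0r.
  have kZ : E k *m Z = Z.
    by apply: trmx_inj; rewrite trmx_mul idemT Zp.1.
  have [z zE] := ishi_space_diag hV k Zs.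
  rewrite kZ Zk in zE.
  have z0 : 0 <= z.
    apply: (@psd_scale_ge0 _ _ (E k)); last by rewrite -zE.
      by rewrite -idems1; apply: psd_idems.
    exact: (idem_neq0 hV).
  by exists z; rewrite //= /Q gT xZ zE -scalemxAr -scalemxAl.
have Q0 : Q != 0 by apply: contra_neq T0; apply: gram_eq0.
exists <[Q]>%VS; rewrite dim_vline Q0; split=> //.
apply/seteqP; split=> [x|x /= /vlineP[s ->] U hU].
  by apply=> _ [s _ <-] /=; rewrite memvZ ?memv_line.
by rewrite memvZ // hU //; exists 1; rewrite /= ?scale1r.
Qed.

Lemma in_sum_of_rays_prow k T : prow V k T -> in_sum_of_rays C (T^T *m T) 1.
Proof.
move=> hT; apply: in_sum_of_rays1 (extreme_ray_prow hT) _.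
by exists 1; rewrite /= ?scale1r.
Qed.

Lemma in_sum_of_rays_chol T : chol V T -> in_sum_of_rays C (T^T *m T) #|supp T|.
Proof.
move=> [_ hT]; rewrite gram_rows; apply: in_sum_of_rays_sum => k kT.
case: (hT k) => [T0|]; last exact: in_sum_of_rays_prow.
by move: kT; rewrite inE T0 eqxx.
Qed.

Lemma prowZ k T (c : R) : 0 < c -> prow V k T -> prow V k (c *: T).
Proof.
move=> c0 [Tt Tk [t t0 Te]]; split; [exact: memvZ | by rewrite -scalemxAr Tk |].
by exists (c * t); rewrite ?mulr_gt0 // -scalemxAl Te scalerA.
Qed.

Lemma gram_sqrtZ T (c : R) : 0 <= c ->
  (Num.sqrt c *: T)^T *m (Num.sqrt c *: T) = c *: (T^T *m T).
Proof.
move=> c0; rewrite trmx_scale -scalemxAl -scalemxAr scalerA -expr2.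
by rewrite sqr_sqrtr.
Qed.

(** Each row of a Cholesky factor of y contributes a summand of y, hence a point of the ray. One
    nonzero row thus spans it, and the remaining positive factor is absorbed into that row by a
    square root. *)
Lemma extreme_ray_elt F y : extreme_ray C F -> F y ->
  y = 0 \/ exists k T, prow V k T /\ y = T^T *m T.
Proof.
move=> [fF [U [FU dU]]] Fy; have [_ FC _ _] := fF.
have [U0 [Ut hU] yE] := cholesky hV (FC _ Fy).
have [->|y0] := eqVneq y 0; [by left | right].
have /set0Pn[k kS] : supp U0 != finset.set0.
  apply: contra_neq y0 => S0; rewrite yE gram_rows S0.
  exact: big_set0.
have [/eqP E0|hk] := hU k; first by move: kS; rewrite inE E0.
set T := E k *m U0 in hk; set Q := T^T *m T.
have CQ : C Q by apply: (closed_cone_gram hV); case: hk.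
have FQ : F Q.
  have [W CW yQ] : exists2 W, C W & y = Q + W.
    exists (\sum_(j in (supp U0 :\ k)%SET) (E j *m U0)^T *m (E j *m U0)).
      apply: (big_ind C); [exact: closed_cone0 | exact: closed_coneD |] => j _.
      by apply: (closed_cone_gram hV); apply: (tri_idemM hV).
    by rewrite yE gram_rows [LHS](big_setD1 k).
  apply: (face_summand (closed_cone0 hV) _ fF CQ CW); last by rewrite -yQ.
  by move=> t x; apply: closed_coneZ.
have Q0 : Q != 0 by apply: contra_neq (prow_neq0 hV hk); apply: gram_eq0.
have UQ : U = <[Q]>%VS.
  apply/eqP; rewrite eq_sym eqEdim dim_vline Q0 dU leqnn andbT -memvE.
  by have := sub_lspan FQ; rewrite FU.
have : y \in U by have := sub_lspan Fy; rewrite FU.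
rewrite UQ => /vlineP[c yc].
have c0 : 0 <= c.
  by apply: (@psd_scale_ge0 _ _ Q) => //; [case: CQ | rewrite -yc; case: (FC _ Fy)].
have c_gt0 : 0 < c.
  by rewrite lt_neqAle c0 andbT; apply: contra_neq y0 => e; rewrite yc -e scale0r.
exists k, (Num.sqrt c *: T); split; first by apply: prowZ => //; rewrite sqrtr_gt0.
by rewrite gram_sqrtZ.
Qed.

End GroupAction.

(** * The dimension condition and the Carathéodory number *)

Section CaratheodoryNumber.
Variables (R : realType) (r : nat) (p : 'I_r -> nat).
Variable V : forall i j : 'I_r, {vspace 'M[R]_(p i, p j)}.
Hypothesis hV : ishi_axioms V.
Local Notation n := (\sum_i p i)%N.
Local Notation E := (@idem R r p).
Local Notation C := (ishi_closed_cone V).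
Local Notation tri := (tri V).
Implicit Types (X Y T U : 'M[R]_n).

Definition dim_condition := forall i j k : 'I_r, (i < j)%N -> (j < k)%N ->
  V i j != 0%VS -> \dim (V i k) = \dim (V j k).

(** [V3] gives a scalar matrix, and its diagonal entries are sums of squares. Nonzero elements of
    V_ij are therefore isometries up to scale. *)
Lemma ishi_gram_scalar (i j : 'I_r) (A : 'M[R]_(p i, p j)) : (i <= j)%N ->
  A \in V i j -> A != 0 -> exists2 a : R, 0 < a & A^T *m A = a *: 1%:M.
Proof.
move=> ij AV A0; have := ishi_V3 hV ij AV; rewrite (ishi_diag hV) => /vlineP[a Aa].
exists a => //; rewrite lt_neqAle; apply/andP; split.
  apply: contra_neq A0 => a0; apply: gram_eq0; by rewrite Aa -a0 scale0r.
pose b := Ordinal (ishi_size hV j); have /matrixP/(_ b b) := Aa.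
rewrite !mxE eqxx mulr1 => <-; apply: sumr_ge0 => c _.
by rewrite mxE -expr2 sqr_ge0.
Qed.

Lemma mulmx_gram_inj (i j m : nat) (A : 'M[R]_(i, j)) (D : 'M[R]_(j, m)) (a : R) :
  0 < a -> A^T *m A = a *: 1%:M -> A *m D = 0 -> D = 0.
Proof.
move=> a0 Aa AD; have : A^T *m A *m D = 0 by rewrite -mulmxA AD mulmx0.
by rewrite Aa -scalemxAl mul1mx => /eqP; rewrite scaler_eq0 gt_eqF //= => /eqP.
Qed.

Section LeftMultiplication.
Variables (i j k : 'I_r) (A : 'M[R]_(p i, p j)).
Hypotheses (ij : (i <= j)%N) (jk : (j <= k)%N) (AV : A \in V i j) (A0 : A != 0).

Let f : 'Hom('M[R]_(p j, p k), 'M[R]_(p i, p k)) := linfun (mulmx A).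

Lemma ishi_lmul_sub : (f @: V j k <= V i k)%VS.
Proof.
apply/subvP => _ /memv_imgP[D DV ->]; rewrite lfunE /=.
exact: (ishi_V1 hV ij jk).
Qed.

Lemma ishi_lmul_dim : \dim (f @: V j k) = \dim (V j k).
Proof.
have [a a0 Aa] := ishi_gram_scalar ij AV A0.
rewrite limg_dim_eq //; apply/eqP; rewrite -subv0; apply/subvP => D.
rewrite memv_cap memv_ker memv0 lfunE /= => /andP[_ /eqP /(mulmx_gram_inj a0 Aa)].
by move=> ->.
Qed.

Lemma ishi_dim_le : (\dim (V j k) <= \dim (V i k))%N.
Proof. by rewrite -ishi_lmul_dim; apply: dimvS ishi_lmul_sub. Qed.

Lemma ishi_lmul_onto B : \dim (V i k) = \dim (V j k) -> B \in V i k ->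
  exists2 D, D \in V j k & B = A *m D.
Proof.
move=> d BV; have /eqP fV : (f @: V j k == V i k)%VS.
  by rewrite eqEdim ishi_lmul_sub ishi_lmul_dim d /=.
move: BV; rewrite -fV => /memv_imgP[D DV ->].
by exists D => //; rewrite lfunE.
Qed.

End LeftMultiplication.

Lemma tri_elementary (i j : 'I_r) A : (i <= j)%N -> A \in V i j ->
  (sel p i)^T *m A *m sel p j \in tri.
Proof.
move=> ij AV; set X := _ *m _.
have XE : X = E i *m X *m E j.
  by rewrite /X !mulmxA idem_sel -!mulmxA sel_idem.
apply/triP; split=> a b ab; rewrite XE blk_Midem blk_idemM.
  case: eqVneq => [e|_]; last exact: mem0v.
  case: eqVneq => [e'|_]; last exact: mem0v.
  subst a b; rewrite blkE /X !mulmxA selK mul1mx -mulmxA selK mulmx1 //.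
case: eqVneq => // e; case: eqVneq => // e'; subst a b.
by rewrite ltnNge ij in ab.
Qed.

(* A row with no pivot starts at some V_kj with k < j; under the dimension
   condition the block A there divides the whole row, so that A^T turns it into
   a row with a pivot at j and the same Gram matrix. *)
Lemma pivot_row k T : dim_condition -> T \in tri -> E k *m T = T ->
  T *m E k = 0 -> T != 0 ->
  exists (j : 'I_r) U, [/\ (k < j)%N, prow V j U & U^T *m U = T^T *m T].
Proof.
move=> cond Tt Tk Tk0 T0; have [Tu Tl] := triP _ _ Tt.
have bT a b : a != k -> blk T a b = 0.
  by move=> ak; rewrite -Tk blk_idemM (negPf ak).
have /existsP[j0 hj0] : [exists j, blk T k j != 0].
  apply: contraNT T0 => /existsPn h; apply/eqP/blkP => a b; rewrite blk0.
  have [->|/bT//] := eqVneq a k; apply/eqP; by have := h b; rewrite negbK.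
case: (@arg_minnP _ j0 (fun j => blk T k j != 0) (fun j : 'I_r => val j) hj0).
(* The first nonzero block of the row; it lies to the right of k because the pivot block is zero. *)
move=> j hj jmin.
have kj : (k < j)%N.
  rewrite ltnNge; apply: contra hj => jk; apply/eqP.
  have [e|ne] := eqVneq j k; last by apply: Tl; rewrite ltn_neqAle ne.
  by have := congr1 (fun Z => blk Z k j) Tk0; rewrite e blk_Midem eqxx blk0.
set A := blk T k j in hj; have AV : A \in V k j by apply: Tu; apply: ltnW.
have [a a0 Aa] := ishi_gram_scalar (ltnW kj) AV hj.
(* Since A^T A = a I, this factor turns A into an isometry. *)
pose c := (Num.sqrt a)^-1; have c0 : 0 < c by rewrite invr_gt0 sqrtr_gt0.
have cc : c * c * a = 1.
  rewrite /c -invfM -expr2 sqr_sqrtr ?ltW // mulVf ?gt_eqF //.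
pose U : 'M[R]_n := c *: ((sel p j)^T *m A^T *m sel p k *m T).
have bU x y : blk U x y =
    if x == j then c *: ((sel p x *m (sel p j)^T) *m A^T *m blk T k y) else 0.
  have -> : blk U x y = c *: ((sel p x *m (sel p j)^T) *m A^T *m blk T k y).
    by rewrite /U blkZ !blkE !mulmxA.
  by case: eqVneq => // xj; rewrite sel_ortho // !mul0mx scaler0.
have bUj y : blk U j y = c *: (A^T *m blk T k y).
  by rewrite bU eqxx selK mul1mx.
have bTlow (y : 'I_r) : (y < j)%N -> blk T k y = 0.
  move=> yj; apply/eqP; rewrite -[_ == _]negbK; apply/negP => /jmin.
  by rewrite leqNgt yj.
have bUjj : blk U j j = Num.sqrt a *: 1%:M.
  rewrite bUj Aa scalerA; congr (_ *: _).
  by rewrite /c -{2}[a]sqr_sqrtr ?ltW // expr2 mulKf // gt_eqF // sqrtr_gt0.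
have Ut : U \in tri.
  apply/triP; split=> x y xy.
    have [e|ne] := eqVneq x j; last by rewrite bU (negPf ne) mem0v.
    subst x; move: xy; rewrite leq_eqVlt => /orP[/eqP/val_inj e|jy].
      by subst y; rewrite bUjj memvZ // (ishi_diag hV) memv_line.
    rewrite bUj memvZ //; apply: (ishi_V2 hV (ltnW kj) jy) => //.
    by apply: Tu; apply: ltnW; apply: ltn_trans jy.
  have [e|ne] := eqVneq x j; last by rewrite bU (negPf ne).
  by subst x; rewrite bUj bTlow // mulmx0 scaler0.
exists j, U; split=> //.
  have jU : E j *m U = U by rewrite /U -scalemxAr !mulmxA idem_sel.
  split=> //; exists (Num.sqrt a); first by rewrite sqrtr_gt0.
  by rewrite -jU idem_blk bUjj -scalemxAr -scalemxAl mulmx1 idemE.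
apply: blkP => x y; rewrite !blkM.
rewrite [LHS](bigD1 j) //= [X in _ + X]big1 ?addr0 => [|z zj]; last first.
  by rewrite [blk U z y]bU (negPf zj) mulmx0.
rewrite [RHS](bigD1 k) //= [X in _ = _ + X]big1 ?addr0 => [|z zk]; last first.
  by rewrite [blk T z y]bT // mulmx0.
rewrite !blkT !bUj trmx_scale trmx_mul trmxK -scalemxAl -scalemxAr scalerA.
(* On multiples of A the product A A^T acts as the scalar a, which restores the Gram matrix. The
   quotient D is 0 before j, the identity at j, and comes from the dimension condition after j. *)
have [D ->] : exists D, blk T k y = A *m D.
  have [yj|jy|/val_inj e] := ltngtP y j.
  - by exists 0; rewrite mulmx0 bTlow.
  - have [||D DV ->] := @ishi_lmul_onto k j y A (ltnW kj) (ltnW jy) AV hj (blk T k y).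
    + apply: cond => //; apply: contraNneq hj => V0; move: AV; rewrite V0 memv0.
      by move/eqP->.
    + by apply: Tu; apply: ltnW; apply: ltn_trans jy.
    by exists D.
  - by subst y; exists 1%:M; rewrite mulmx1.
by rewrite [A^T *m _]mulmxA Aa -scalemxAl mul1mx -!scalemxAr scalerA cc scale1r mulmxA.
Qed.

(** Rotation of the two rows by the angle with cosine t/q and sine u/q: the pivots (t, u) become (q,
    0) and the sum of the Gram matrices is unchanged. *)
Lemma prow_combination k T U : prow V k T -> prow V k U ->
  exists T' U', [/\ prow V k T', U' \in tri, E k *m U' = U', U' *m E k = 0 &
    T'^T *m T' + U'^T *m U' = T^T *m T + U^T *m U].
Proof.
move=> [Tt Tk [t t0 Te]] [Ut Uk [u u0 Ue]].
pose q := Num.sqrt (t ^+ 2 + u ^+ 2).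
have q2 : q ^+ 2 = t ^+ 2 + u ^+ 2 by rewrite sqr_sqrtr // addr_ge0 ?sqr_ge0.
have q0 : 0 < q by rewrite sqrtr_gt0 addr_gt0 ?exprn_gt0.
pose a := t / q; pose b := u / q.
have ab : a ^+ 2 + b ^+ 2 = 1.
  by rewrite !expr_div_n -mulrDl q2 divff // -q2 expf_neq0 // gt_eqF.
exists (a *: T + b *: U), (b *: T - a *: U); split.
- split; first by rewrite memvD ?memvZ.
    by rewrite mulmxDr -!scalemxAr Tk Uk.
  exists q => //; rewrite mulmxDl -!scalemxAl Te Ue !scalerA -scalerDl.
  congr (_ *: _); rewrite /a /b mulrAC [u / q * u]mulrAC -mulrDl -!expr2 -q2.
  by rewrite expr2 mulfK // gt_eqF.
- by rewrite memvB ?memvZ.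
- by rewrite mulmxBr -!scalemxAr Tk Uk.
- rewrite mulmxBl -!scalemxAl Te Ue !scalerA -scalerBl.
  by rewrite /a /b mulrAC [t / q * u]mulrAC [u * t]mulrC subrr scale0r.
- rewrite trmx_add trmx_sub !trmx_scale !mulmxDl !mulmxDr !mulNmx !mulmxN.
  rewrite -!scalemxAl -!scalemxAr !scalerA.
  set P := T^T *m T; set Q := U^T *m U; set W := T^T *m U; set W' := U^T *m T.
  rewrite -[P in RHS]scale1r -[Q in RHS]scale1r -ab !scalerDl !expr2.
  move: P Q W W' => P Q W W'; clearbody a b.
  by apply/matrixP => x y; rewrite !mxE; ring.
Qed.

(** Induction on r - k. If row k of T is free, U fills it. Otherwise the rotation leaves a row
    without pivot, which is zero or is exchanged for a row with pivot j > k to be added next. Only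
    the final insertion enlarges the support. *)
Lemma chol_add_prow k T U : dim_condition -> chol V T -> prow V k U ->
  exists T', [/\ chol V T', T'^T *m T' = T^T *m T + U^T *m U &
    (#|supp T'| <= #|supp T|.+1)%N].
Proof.
move=> cond; have [d kd] := ubnP (r - k); elim: d k T U kd => // d IH k T U kd.
move=> cT hU; have [Tt Tr] := cT; case: (Tr k) => [Tk|hT].
  have [Ut Uk _] := hU; exists (T + U); split; last 1 first.
  - have -> : #|supp T|.+1 = #|k |: supp T|.
      by rewrite cardsU1 inE Tk eqxx.
    apply: subset_leq_card; apply/fintype.subsetP => j; rewrite !inE mulmxDr.
    by have [//|jk] := eqVneq j k; rewrite (prow_row hU jk) addr0.
  - split; first exact: memvD.
    move=> j; rewrite mulmxDr; have [->|jk] := eqVneq j k.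
      by right; rewrite Tk add0r Uk.
    by rewrite (prow_row hU jk) addr0.
  - exact: gram_addr Tk Uk.
have [T' [U' [hT' U't U'k U'k0 e]]] := prow_combination hT hU.
have [T't T'k _] := hT'.
(* T with row k deleted, to make room for the rotated row [T']. *)
pose W := T - E k *m T; have Wk : E k *m W = 0.
  by rewrite mulmxBr mulmxA idemK subrr.
have Wt : W \in tri by rewrite memvB ?(tri_idemM hV).
have Wj j : j != k -> E j *m W = E j *m T.
  by move=> jk; rewrite mulmxBr mulmxA idem_ortho // mul0mx subr0.
have TW : T = W + E k *m T by rewrite subrK.
have cT' : chol V (W + T').
  split; first exact: memvD.
  move=> j; rewrite mulmxDr; have [->|jk] := eqVneq j k.
    by right; rewrite Wk add0r T'k.
  by rewrite (prow_row hT' jk) addr0 Wj.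
have sT' : (#|supp (W + T')| <= #|supp T|)%N.
  apply: subset_leq_card; apply/fintype.subsetP => j; rewrite !inE mulmxDr.
  have [->|jk] := eqVneq j k; first by rewrite (prow_neq0 hV hT).
  by rewrite (prow_row hT' jk) addr0 Wj.
have eq : (W + T')^T *m (W + T') + U'^T *m U' = T^T *m T + U^T *m U.
  rewrite (gram_addr Wk T'k) -addrA e addrA; congr (_ + _).
  have Ek : E k *m (E k *m T) = E k *m T by rewrite mulmxA idemK.
  by rewrite -(gram_addr Wk Ek) -TW.
have [U'0|U'0] := eqVneq U' 0.
  by exists (W + T'); split=> //; [rewrite -eq U'0 mulmx0 addr0 | apply: leqW].
have [j [U2 [kj hU2 eU2]]] := pivot_row cond U't U'k U'k0 U'0.
have [|T2 [cT2 eT2 sT2]] := IH j (W + T') U2 _ cT' hU2.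
  rewrite ltnS in kd; apply: leq_trans kd; by apply: ltn_sub2l.
exists T2; split=> //; first by rewrite eT2 eU2.
by apply: leq_trans sT2 _; rewrite ltnS.
Qed.

Lemma in_sum_of_rays_chol_le x l : dim_condition -> in_sum_of_rays C x l ->
  exists T, [/\ chol V T, x = T^T *m T & (#|supp T| <= l)%N].
Proof.
move=> cond [ray [hray [y yray ->]]].
elim: l ray hray y yray => [|l IH] ray hray y yray.
  exists 0; split; first by split=> [|k]; [apply: mem0v | left; rewrite mulmx0].
    by rewrite mulmx0 [LHS]big_ord0.
  by rewrite leqn0 cards_eq0; apply/eqP/setP => k; rewrite !inE mulmx0 eqxx.
rewrite [\sum_(i < l.+1) _]big_ord_recr /=.
have [T [cT -> sT]] := IH (fun i => ray (widen_ord (leqnSn l) i))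
  (fun i => hray _) (fun i => y (widen_ord (leqnSn l) i)) (fun i => yray _).
case: (extreme_ray_elt hV (hray ord_max) (yray ord_max)) => [->|[k [U [hU ->]]]].
  by exists T; rewrite addr0; split=> //; apply: leqW.
have [T' [cT' <- sT']] := chol_add_prow cond cT hU.
by exists T'; split=> //; apply: leq_trans sT' _.
Qed.

Lemma unit_supp T : T \in unitmx -> supp T = [set: 'I_r]%SET.
Proof.
move=> Tu; apply/setP => k; rewrite !inE; apply: contra_neq (idem_neq0 hV k) => e.
by rewrite -[E k]mulmx1 -(mulmxV Tu) mulmxA e mul0mx.
Qed.

Lemma closed_cone_sum_le x : C x ->
  exists2 k, in_sum_of_rays C x k & (k <= r)%N.
Proof.
move=> /(cholesky hV)[T cT ->]; exists #|supp T|; first exact: in_sum_of_rays_chol.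
by rewrite -[X in (_ <= X)%N]card_ord; apply: max_card.
Qed.

Lemma dim_condition_caratheodory : dim_condition -> caratheodory_number C r.
Proof.
move=> cond; apply: caratheodory_number_intro; first exact: closed_cone_sum_le.
exists 1%:M => [|l /(in_sum_of_rays_chol_le cond)[T [cT eT sT]]].
  by have := closed_cone_gram hV (tri1 hV); rewrite trmx1 mulmx1.
have Tu : T \in unitmx.
  by have := @unitmx1 R n; rewrite eT unitmx_mul => /andP[].
by move: sT; rewrite (unit_supp Tu) cardsT card_ord.
Qed.

(** Pivots multiply: T vanishes left of block k and U below the diagonal, so in T U E_k only the
    term through block k survives. *)
Lemma prow_mul k T U : prow V k T -> chol V U -> supp U = [set: 'I_r]%SET ->
  prow V k (T *m U).
Proof.
move=> [Tt Tk [t t0 Te]] [Ut Ur] sU.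
have [_ _ [u u0 Ue]] : prow V k (E k *m U).
  by case: (Ur k) => // U0; have := finset.in_setT k; rewrite -sU inE U0 eqxx.
split; [exact: (triM hV) | by rewrite mulmxA Tk |].
exists (t * u); first exact: mulr_gt0.
rewrite -[T in T *m U]mulmx1 -sum_idem mulmx_sumr !mulmx_suml.
rewrite [LHS](bigD1 k) //= [X in _ + X]big1 ?addr0 => [|j jk].
  rewrite Te -!scalemxAl Ue -scalerA; congr (_ *: _).
have [j_lt_k|k_lt_j|/val_inj e] := ltngtP j k; last by rewrite e eqxx in jk.
  by rewrite -[T]Tk (tri_lower Tt) // !mul0mx.
by rewrite -!mulmxA [E j *m _]mulmxA (tri_lower Ut) // mulmx0.
Qed.

(* If the condition fails at (i, j, k), there are partial isometries A in V_ij
   and B in V_ik with A^T B = 0, and then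
   E_i + E_j + E_k = ((E_i+A+B)^T (E_i+A+B) + (E_i-A-B)^T (E_i-A-B)) / 2. *)
Lemma idem3_two_rows (i j k : 'I_r) : (i < j)%N -> (j < k)%N -> V i j != 0%VS ->
  \dim (V i k) <> \dim (V j k) ->
  exists T U, [/\ prow V i T, prow V i U & E i + E j + E k = T^T *m T + U^T *m U].
Proof.
move=> ij jk Vij dn; have ik := ltn_trans ij jk.
have normalize (a b : 'I_r) (A : 'M[R]_(p a, p b)) : (a < b)%N -> A \in V a b -> A != 0 ->
    exists A', [/\ A' \in V a b, A'^T *m A' = 1%:M & exists c : R, A' = c *: A].
  move=> /ltnW ab AV A0; have [c c0 Ac] := ishi_gram_scalar ab AV A0.
  exists ((Num.sqrt c)^-1 *: A); split; [exact: memvZ | | by exists (Num.sqrt c)^-1].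
  rewrite trmx_scale -scalemxAl -scalemxAr Ac !scalerA -invfM -expr2.
  by rewrite sqr_sqrtr ?ltW // mulVf ?gt_eqF // scale1r.
have [A1 [A1V A1A1 _]] : exists A', [/\ A' \in V i j, A'^T *m A' = 1%:M & True].
  have [|A' [? ? _]] := normalize i j (vpick (V i j)) ij (memv_pick _).
    by rewrite vpick0.
  by exists A'.
have A10 : A1 != 0.
  apply/eqP => A0; move: A1A1; rewrite A0 mulmx0 => /matrixP.
  pose b := Ordinal (ishi_size hV j); move=> /(_ b b); rewrite !mxE eqxx.
  by move/esym/eqP; rewrite oner_eq0.
have dlt : (\dim (V j k) < \dim (V i k))%N.
  have := ishi_dim_le (ltnW ij) (ltnW jk) A1V A10.
  by rewrite leq_eqVlt => /orP[/eqP e|//]; case: dn.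
pose f : 'Hom('M[R]_(p i, p k), 'M[R]_(p j, p k)) := linfun (mulmx A1^T).
have fV : (f @: V i k <= V j k)%VS.
  apply/subvP => _ /memv_imgP[D DV ->]; rewrite lfunE /=.
  exact: (ishi_V2 hV (ltnW ij) jk).
(* [A1^T] maps V_ik into the strictly smaller V_jk, so it kills a nonzero element. *)
have ker0 : (V i k :&: lker f)%VS != 0%VS.
  apply: contraTneq dlt => k0; rewrite -leqNgt -(limg_dim_eq k0).
  exact: dimvS fV.
set B0 := vpick (V i k :&: lker f); have B00 : B0 != 0 by rewrite vpick0.
have := memv_pick (V i k :&: lker f)%VS; rewrite memv_cap memv_ker lfunE /= -/B0.
move=> /andP[B0V /eqP AB0].
have [B1 [B1V B1B1 [c Bc]]] := normalize i k B0 ik B0V B00.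
have AB1 : A1^T *m B1 = 0 by rewrite Bc -scalemxAr AB0 scaler0.
pose A : 'M[R]_n := (sel p i)^T *m A1 *m sel p j.
pose B : 'M[R]_n := (sel p i)^T *m B1 *m sel p k.
have gr (a b : 'I_r) (P : 'M[R]_(p i, p a)) (Q : 'M[R]_(p i, p b)) :
    ((sel p i)^T *m P *m sel p a)^T *m ((sel p i)^T *m Q *m sel p b) =
    (sel p a)^T *m (P^T *m Q) *m sel p b.
  by rewrite !trmx_mul trmxK !mulmxA -[_ *m sel p i *m _]mulmxA selK mulmx1.
have AA : A^T *m A = E j by rewrite gr A1A1 mulmx1 idemE.
have BB : B^T *m B = E k by rewrite gr B1B1 mulmx1 idemE.
have AB : A^T *m B = 0 by rewrite gr AB1 mulmx0 mul0mx.
have BA : B^T *m A = 0 by rewrite -[LHS]trmxK trmx_mul trmxK AB trmx0.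
have iA : E i *m A = A by rewrite /A !mulmxA idem_sel.
have iB : E i *m B = B by rewrite /B !mulmxA idem_sel.
have Ai : A *m E i = 0.
  by rewrite /A -mulmxA sel_idem0 ?mulmx0 // -val_eqE /= gtn_eqF.
have Bi : B *m E i = 0.
  by rewrite /B -mulmxA sel_idem0 ?mulmx0 // -val_eqE /= gtn_eqF.
have At : A \in tri by apply: tri_elementary => //; apply: ltnW.
have Bt : B \in tri by apply: tri_elementary => //; apply: ltnW.
have hp (s : R) : prow V i (E i + s *: (A + B)).
  split; first by rewrite memvD ?memvZ ?memvD ?(tri_idem hV).
    by rewrite mulmxDr idemK -scalemxAr mulmxDr iA iB.
  exists 1 => //.
  by rewrite mulmxDl idemK -scalemxAl mulmxDl Ai Bi addr0 scaler0 addr0 scale1r.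
(* The factor 1/2 of the identity, distributed over both sides of each Gram matrix. *)
pose d : R := Num.sqrt 2^-1.
have d0 : 0 < d by rewrite sqrtr_gt0 invr_gt0.
exists (d *: (E i + 1 *: (A + B))), (d *: (E i + (-1) *: (A + B))).
split; try exact: prowZ.
have gs (s : R) : (E i + s *: (A + B))^T *m (E i + s *: (A + B)) =
    E i + s *: ((A + B) + (A + B)^T) + s ^+ 2 *: (E j + E k).
  rewrite trmx_add trmx_scale idemT mulmxDl !mulmxDr idemK.
  rewrite -!scalemxAl -!scalemxAr mulmxDr iA iB.
  have -> : (A + B)^T *m E i = (A + B)^T.
    by rewrite -idemT -trmx_mul mulmxDr iA iB.
  have -> : (A + B)^T *m (A + B) = E j + E k.
    by rewrite trmx_add mulmxDl !mulmxDr AA BB AB BA addr0 add0r.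
  move: (E i) (A + B) (E j + E k) ((A + B)^T) => P W Q W'.
  by apply/matrixP => x y; rewrite !mxE; ring.
rewrite !gram_sqrtZ ?invr_ge0 // !gs -scalerDr.
move: (E i) (E j) (E k) (A + B) => P Q Q' W.
by apply/matrixP => x y; rewrite !mxE; field.
Qed.

(** A point x needing r rays has a Cholesky factor T without zero rows. Congruence by T carries the
    two-row expression of E_i + E_j + E_k to the contribution of these three rows of T, so a failure
    of the condition would write x with r - 1 rays. *)
Lemma caratheodory_dim_condition : caratheodory_number C r -> dim_condition.
Proof.
move=> [[x /(cholesky hV)[T cT xE] [_ xmin]] _] i j k ij jk Vij.
apply/eqP; apply: contraT => /eqP dn.
have sT : supp T = [set: 'I_r]%SET.
  apply/eqP; rewrite eqEcard finset.subsetT cardsT card_ord /=.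
  by apply: xmin; rewrite xE; apply: in_sum_of_rays_chol.
have [U [W [hU hW e]]] := idem3_two_rows ij jk Vij dn.
have ijk : i != j /\ (i != k /\ j != k).
  by rewrite -!val_eqE /= !ltn_eqF // (ltn_trans ij jk).
pose S := (i |: (j |: [set k]))%SET; have cS : #|S| = 3.
  by move: ijk => [ij' [ik' jk']]; rewrite /S !cardsU1 cards1 !inE negb_or ij' ik' jk'.
have h l : l \in ~: S -> in_sum_of_rays C ((E l *m T)^T *m (E l *m T)) 1.
  move=> _; have [_ /(_ l)[Tl|]] := cT; last exact: in_sum_of_rays_prow.
  by have := finset.in_setT l; rewrite -sT inE Tl eqxx.
have eT : x = \sum_(l in ~: S) (E l *m T)^T *m (E l *m T) +
    ((U *m T)^T *m (U *m T) + (W *m T)^T *m (W *m T)).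
  have hE l : (E l *m T)^T *m (E l *m T) = T^T *m E l *m T.
    by rewrite trmx_mul idemT mulmxA -[_ *m E l *m E l]mulmxA idemK.
  rewrite xE -[X in X *m T]mulmx1 -(idemsC R p S) mulmxDr mulmxDl addrC; congr (_ + _).
    rewrite /idems mulmx_sumr mulmx_suml; apply: eq_bigr => l _; by rewrite hE.
  have -> : idems p S = E i + E j + E k.
    move: ijk => [ij' [ik' jk']]; rewrite /idems /S.
    rewrite [LHS]big_setU1 /=; last by rewrite !inE negb_or ij'.
    rewrite [X in _ + X]big_setU1 /=; last by rewrite !inE.
    by rewrite [X in _ + (_ + X)]big_set1 addrA.
  rewrite e !trmx_mul mulmxDr mulmxDl !mulmxA //.
suff : (r <= #|~: S| + (1 + 1))%N.
  have := cardsC S; rewrite cS card_ord; move: #|~: S|%SET => m rE.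
  by rewrite -[X in (X <= _)%N]rE addnC leq_add2l.
apply: xmin; rewrite eT; apply: in_sum_of_raysD; first exact: in_sum_of_rays_sum.
by apply: in_sum_of_raysD; apply: (@in_sum_of_rays_prow _ _ _ _ hV i); apply: prow_mul.
Qed.

End CaratheodoryNumber.

(** * Closure, relative interior and homogeneity *)

Lemma half_scalar_entry (R : realType) (e : R) (b : bool) :
  0 < e -> `|2^-1 * e * b%:R| < e.
Proof.
move=> e0; rewrite !normrM ger0_norm ?invr_ge0 // gtr0_norm //.
case: b; rewrite ?normr0 ?mulr0 // normr1 mulr1.
by rewrite gtr_pMl // invf_lt1 // ltr1n.
Qed.

Section ConeTopology.
Variables (R : realType) (r : nat) (p : 'I_r -> nat).
Variable V : forall i j : 'I_r, {vspace 'M[R]_(p i, p j)}.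
Hypothesis hV : ishi_axioms V.
Local Notation n := (\sum_i p i)%N.
Local Notation C := (ishi_closed_cone V).
Local Notation K := (ishi_cone V).
Implicit Types (X Y T U G : 'M[R]_n).

Definition ishi_vspace : {vspace 'M[R]_n} :=
  (lker (linfun trmx - \1%VF) :&: \bigcap_(ij : 'I_r * 'I_r)
     (blk_lfun R p ij.1 ij.2 @^-1:
        (if (ij.1 <= ij.2)%N then V ij.1 ij.2 else fullv)))%VS.

Lemma ishi_vspaceP X : X \in ishi_vspace <-> ishi_space V X.
Proof.
rewrite memv_cap memv_ker add_lfunE opp_lfunE id_lfunE lfunE /= subr_eq0.
split=> [/andP[/eqP XT /memv_bigcapP h]|/ishi_spaceP[XT h]].
  apply/ishi_spaceP; split=> // i j ij; have := h (i, j).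
  by rewrite -memv_preim blk_lfunE /= ij.
rewrite XT eqxx /=; apply/memv_bigcapP => -[i j]; rewrite -memv_preim blk_lfunE /=.
by case: ifP => [/h//|_]; apply: memvf.
Qed.

Lemma lspan_ishi_space (A : set 'M[R]_n) X :
  A `<=` ishi_space V -> lspan A X -> ishi_space V X.
Proof.
move=> AV h; apply/ishi_vspaceP; apply: h => Y /AV hY.
exact/ishi_vspaceP.
Qed.

(** A square factor of an invertible Gram matrix is invertible. The open cone is thus the orbit of 1
    under congruence by invertible elements of [tri V]. *)
Lemma ishi_cone_gramP X :
  K X <-> exists2 G, G \in tri V /\ G \in unitmx & X = G^T *m G.
Proof.
split=> [[Xp Xs]|[G [Gt Gu] ->]]; last first.
  by split; [apply: pd_gram | apply: (ishi_space_gram hV)].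
have [T [Tt _] XT] := cholesky hV (conj (pd_psd Xp) Xs); exists T => //; split=> //.
by have := pd_unit Xp; rewrite XT unitmx_mul => /andP[].
Qed.

Lemma ishi_cone_closedD X Y : K X -> C Y -> K (X + Y).
Proof. by move=> [? ?] [? ?]; split; [apply: pd_psdD | apply: ishi_spaceD]. Qed.

Lemma ishi_cone_closed X : K X -> C X.
Proof. by move=> [/pd_psd]. Qed.

Lemma ishi_cone_scalar (t : R) : 0 < t -> K (t *: 1%:M).
Proof.
move=> t0; split; first by rewrite scalemx1; apply: pd1.
by apply/ishi_spaceZ/ishi_space1.
Qed.

(** A negative entry at X would stay negative on a neighbourhood, which meets A. *)
Lemma closure_coord_ge0 (A : set 'M[R]_n) m (f : 'Hom('M[R]_n, 'M[R]_m)) a b X :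
  (forall Y, A Y -> 0 <= f Y a b) -> closure A X -> 0 <= f X a b.
Proof.
move=> fA AX; rewrite leNgt; apply/negP => fX.
have : nbhs X [set Y | f Y a b < 0].
  have fc : continuous (fun Y : 'M[R]_n => f Y a b).
    move=> Y; apply: (@continuous_comp _ _ _ f (fun M : 'M[R]_m => M a b)).
      exact: linear_mx_continuous.
    exact: coord_continuous.
  exact: (fc X _ (lt_nbhsl fX)).
by move=> /AX[Y [/fA fY]] /=; rewrite ltNge fY.
Qed.

(** U is the zero set of the linear map 1 - [projv U], and each vanishing entry is a pair of sign
    conditions that pass to the closure. *)
Lemma closure_vspace (U : {vspace 'M[R]_n}) X : closure [set` U] X -> X \in U.
Proof.
move=> UX; suff : (\1%VF - projv U) X = 0.
  rewrite add_lfunE opp_lfunE id_lfunE => /eqP; rewrite subr_eq0 => /eqP ->.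
  exact: memv_proj.
have f0 Y : Y \in U -> (\1%VF - projv U) Y = 0.
  by move=> YU; rewrite add_lfunE opp_lfunE id_lfunE projv_id // subrr.
apply/matrixP => a b; rewrite [RHS]mxE; apply: le_anti; apply/andP; split.
  have := @closure_coord_ge0 _ _ (- (\1%VF - projv U)) a b X _ UX.
  rewrite opp_lfunE mxE oppr_ge0; apply=> Y /f0 Y0.
  by rewrite opp_lfunE Y0 mxE mxE oppr0.
by apply: closure_coord_ge0 UX => Y /f0 ->; rewrite mxE.
Qed.

(** A semidefinite X in V is approximated by X + (e/2) 1, which is positive definite. *)
Lemma closure_ishi_cone : closure K = C.
Proof.
apply/seteqP; split=> [X KX|X CX B /mx_nbhsP[e e0 eB]]; last first.
  exists (2^-1 * e *: 1%:M + X); split.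
    by apply: ishi_cone_closedD => //; apply: ishi_cone_scalar; rewrite mulr_gt0.
  apply: eB => i j; rewrite !mxE opprD addrCA subrr addr0 normrN.
  exact: half_scalar_entry.
have Xs : ishi_space V X.
  apply/ishi_vspaceP/closure_vspace; apply: closureS KX => Y [_ Ys].
  exact/ishi_vspaceP.
split=> //; split; first by have [] := Xs.
move=> v; pose f : 'Hom('M[R]_n, 'M[R]_1) := linfun (mulmxr v \o mulmx v^T).
have fE Y : f Y = v^T *m Y *m v by rewrite lfunE.
rewrite -fE; apply: closure_coord_ge0 KX => Y [/pd_psd[_ Yp] _].
by rewrite fE.
Qed.

Lemma ishi_cone_near X : K X -> \forall Y \near X, ishi_space V Y -> K Y.
Proof.
move=> /ishi_cone_gramP[G [_ Gu] XE].
apply: filterS (pd_near Gu XE) => Y h Ys; split=> //.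
by apply: h; case: Ys.
Qed.

Lemma ishi_cone_relative_interior : K `<=` relative_interior K.
Proof.
move=> X KX; split=> //; apply: filterS (ishi_cone_near KX) => Y h lY.
by apply: h; apply: lspan_ishi_space lY => Z [].
Qed.

Lemma closed_cone_sub_lspan X : C X -> lspan K X.
Proof.
move=> CX; have -> : X = (1 *: 1%:M + X) + (-1) *: (1 *: 1%:M).
  by rewrite scaleN1r addrAC subrr add0r.
apply: lspanD; last apply: lspanZ; apply: sub_lspan; last exact: ishi_cone_scalar.
by apply: ishi_cone_closedD => //; apply: ishi_cone_scalar.
Qed.

(** From a relative interior point a small multiple of 1 can be subtracted within the cone, so the
    point is positive definite. *)
Lemma relative_interior_closed_cone : relative_interior C = K.
Proof.
apply/seteqP; split=> [X [CX /mx_nbhsP[e e0 eX]]|X KX]; last first.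
  split; first exact: ishi_cone_closed.
  apply: filterS (ishi_cone_near KX) => Y h lY; apply: ishi_cone_closed.
  by apply: h; apply: lspan_ishi_space lY => Z [].
have t0 : 0 < 2^-1 * e by rewrite mulr_gt0.
have -> : X = (2^-1 * e) *: 1%:M + (X - (2^-1 * e) *: 1%:M) by rewrite subrKC.
apply: ishi_cone_closedD; first exact: ishi_cone_scalar.
apply: eX => [i j|].
  rewrite !mxE opprB addrC subrK.
  exact: half_scalar_entry.
rewrite -scaleNr; apply: lspanD; first exact: sub_lspan.
apply: lspanZ; apply: sub_lspan.
by have := ishi_cone_closed (ishi_cone_scalar ltr01); rewrite scale1r.
Qed.

Definition congr_lfun G : 'End('M[R]_n) := linfun (mulmxr G \o mulmx G^T).

Lemma congr_lfunE G X : congr_lfun G X = G^T *m X *m G.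
Proof. by rewrite lfunE. Qed.

Lemma congr_ishi_cone G X : G \in tri V -> G \in unitmx -> K X -> K (G^T *m X *m G).
Proof.
move=> Gt Gu /ishi_cone_gramP[T [Tt Tu] ->]; apply/ishi_cone_gramP.
exists (T *m G); last by rewrite trmx_mul !mulmxA.
by rewrite unitmx_mul Tu Gu (triM hV).
Qed.

Lemma cone_iso_congr G : G \in tri V -> G \in unitmx ->
  cone_iso K K (congr_lfun G) (congr_lfun (invmx G)).
Proof.
move=> Gt Gu; split=> X KX; rewrite !congr_lfunE.
  by rewrite congrKV //; split=> //; apply: congr_ishi_cone.
rewrite congrVK //; split=> //; apply: congr_ishi_cone => //.
  exact: (tri_inv hV).
by rewrite unitmx_inv.
Qed.

Lemma ishi_cone_homogeneous : homogeneous_cone K.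
Proof.
split.
- split.
  + by exists (1 *: 1%:M); apply: ishi_cone_scalar.
  + apply/convex_setE => X Y t KX KY t0 t1.
    have cZ s Z : 0 <= s -> K Z -> C (s *: Z).
      by move=> s0 /ishi_cone_closed; apply: closed_coneZ.
    have KZ s Z : 0 < s -> K Z -> K (s *: Z).
      move=> s0 [[ZT Zp] Zs]; split; last exact: ishi_spaceZ.
      split=> [|v v0]; first by rewrite trmx_scale ZT.
      by rewrite -/(qf _ _) qfZ mulr_gt0 ?Zp.
    move: t0; rewrite le_eqVlt => /orP[/eqP <-|t0].
      by rewrite scale0r add0r subr0 scale1r.
    by apply: ishi_cone_closedD; [apply: KZ | apply: cZ; rewrite ?subr_ge0].
  + move=> X t [[XT Xp] Xs] t0; split; last exact: ishi_spaceZ.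
    split=> [|v v0]; first by rewrite trmx_scale XT.
    by rewrite -/(qf _ _) qfZ mulr_gt0 ?Xp.
- move=> [X [D [D0 XD]]]; case/eqP: D0.
  have KX : K X by have := XD 0; rewrite scale0r addr0.
  have DT : D^T = D.
    have [[+ _] _] := XD 1; have [[XT _] _] := KX.
    by rewrite scale1r trmx_add XT => /addrI.
  have D0 v : qf D v = 0.
    apply/eqP; rewrite -[_ == _]negbK; apply/negP => Dv.
    have v0 : v != 0 by apply: contraNneq Dv => ->; rewrite /qf mulmx0 mxE.
    (* At this parameter the form of the point on the line vanishes at v, although the whole line is
       positive definite. *)
    have [[_ /(_ _ v0)]] := XD (- (qf X v / qf D v)).
    by rewrite -/(qf _ _) qfD qfZ mulNr divfK // subrr ltxx.
  by apply: mx_cv_eq0 => v; apply: psd_ker => //; split=> // w; rewrite -/(qf _ _) D0.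
- exact: ishi_cone_relative_interior.
- move=> X Y /ishi_cone_gramP[G [Gt Gu] ->] /ishi_cone_gramP[H [Ht Hu] ->].
  (* Congruence by G^-1 H carries G^T G to H^T H. *)
  have it : invmx G *m H \in tri V by apply: (triM hV) => //; apply: (tri_inv hV).
  have iu : invmx G *m H \in unitmx by rewrite unitmx_mul unitmx_inv Gu.
  have fg := cone_iso_congr it iu; exists (congr_lfun (invmx G *m H)); split.
  + exact: cone_iso_set_bij (cone_iso_lspan_iso fg).
  + exact: cone_iso_image fg.
  + rewrite congr_lfunE trmx_mul !mulmxA -[_ *m (invmx G)^T *m _]mulmxA.
    rewrite -trmx_mul (mulmxV Gu) trmx1 mulmx1.
    by rewrite -[_ *m G *m invmx G]mulmxA (mulmxV Gu) mulmx1.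
Qed.

End ConeTopology.

(** * Chains of faces and uniqueness of the number of blocks *)

Section FaceChains.
Variables (R : realType) (E : vectType R).
Implicit Types (K : set E) (x y : E).

(* For K = ishi_cone V this is the closure of K, described without topology so
   that it is visibly invariant under linear isomorphisms. A chain of dominated,
   pairwise inequivalent points is a chain of faces; its length recovers r. *)
Definition alg_closure K : set E :=
  [set x | lspan K x /\ forall z, K z -> K (x + z)].

Definition dominated K x y := exists c : R, alg_closure K (c *: y - x).

Definition has_chain K (l : nat) := exists x : nat -> E,
  (forall i, (i <= l)%N -> alg_closure K (x i)) /\
  (forall i, (i < l)%N ->
     dominated K (x i) (x i.+1) /\ ~ dominated K (x i.+1) (x i)).

End FaceChains.

Section FaceChainsTransport.
Variables (R : realType) (E E' : vectType R) (K : set E) (K' : set E').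
Variables (f : 'Hom(E, E')) (g : 'Hom(E', E)).
Hypothesis fg : cone_iso K K' f g.

Lemma cone_iso_alg_closure x : alg_closure K x -> alg_closure K' (f x).
Proof.
move=> [lx hx]; split; first exact: (cone_iso_lspan fg).
move=> z /fg.2[Kz <-]; rewrite -linearD.
by have [] := fg.1 _ (hx _ Kz).
Qed.

Lemma cone_iso_dominated x y : dominated K x y -> dominated K' (f x) (f y).
Proof.
by move=> [c h]; exists c; rewrite -linearZ -linearB; apply: cone_iso_alg_closure.
Qed.

End FaceChainsTransport.

Lemma cone_iso_has_chain (R : realType) (E E' : vectType R) (K : set E)
    (K' : set E') (f : 'Hom(E, E')) (g : 'Hom(E', E)) l :
  cone_iso K K' f g -> has_chain K l -> has_chain K' l.
Proof.
move=> fg [x [hx hd]]; exists (fun i => f (x i)); split=> [i il|i il].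
  exact: (cone_iso_alg_closure fg) (hx i il).
have [h1 h2] := hd i il; split; first exact: (cone_iso_dominated fg).
move=> /(cone_iso_dominated (cone_iso_sym fg)).
have [lx _] := hx i (ltnW il); have [lx' _] := hx i.+1 il.
by rewrite !(cone_isoK fg).
Qed.

Section ChainLength.
Variables (R : realType) (r : nat) (p : 'I_r -> nat).
Variable V : forall i j : 'I_r, {vspace 'M[R]_(p i, p j)}.
Hypothesis hV : ishi_axioms V.
Local Notation n := (\sum_i p i)%N.
Local Notation E := (@idem R r p).
Local Notation ES := (@idems R r p).
Local Notation C := (ishi_closed_cone V).
Local Notation K := (ishi_cone V).
Implicit Types (X Y T U G : 'M[R]_n).

(** If the form of X were negative at v, some t > 0 would make the form of X + t 1 vanish at v,
    although t 1 lies in [K]. *)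
Lemma alg_closure_ishi_cone : alg_closure K = C.
Proof.
apply/seteqP; split=> [X [lX hX]|X CX]; last first.
  split; first exact: (closed_cone_sub_lspan hV).
  by move=> Z KZ; rewrite addrC; apply: ishi_cone_closedD.
have Xs : ishi_space V X by apply: lspan_ishi_space lX => Z [].
split=> //; split; first by case: Xs.
move=> v; rewrite -/(qf _ _) leNgt; apply/negP => Xv.
have v0 : v != 0 by apply: contraTneq Xv => ->; rewrite /qf mulmx0 mxE ltxx.
have v1 := qf1_gt0 v0.
have t0 : 0 < - qf X v / qf 1%:M v by rewrite divr_gt0 ?oppr_gt0.
have [[_ /(_ v v0) h] _] := hX _ (ishi_cone_scalar hV t0).
by move: h; rewrite -/(qf _ _) qfD qfZ divfK ?gt_eqF // subrr ltxx.
Qed.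

Lemma complete_chol T : chol V T -> chol V (complete T).
Proof.
move=> cT; have [Tt Tr] := cT; split=> [|k]; first exact: (complete_tri hV).
right; rewrite complete_row; case: ifP => kT; last exact: (prow_idem hV).
by case: (Tr k) => // T0; move: kT; rewrite inE T0 eqxx.
Qed.

Lemma complete_supp T : chol V T -> supp (complete T) = [set: 'I_r]%SET.
Proof.
by move=> cT; apply: (unit_supp hV); apply: (complete_unit hV cT).
Qed.

(** Congruence turns T^T T into the projection P onto the blocks in S = [supp T]. A point Z bounded
    by c P is supported on S, and a nonzero row of its factor has a pivot at its own index, so that
    index is in S. If all of S occurs, the factor is injective on these blocks and P is bounded by a
    multiple of Z. *)
Lemma dominated_chol T Y (c : R) : chol V T -> C Y -> C (c *: (T^T *m T) - Y) ->
  exists T', [/\ chol V T', Y = T'^T *m T', supp T' \subset supp T &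
    supp T' = supp T -> exists c' : R, C (c' *: Y - T^T *m T)].
Proof.
move=> cT CY; rewrite gram_complete; set G := complete T; set S := supp T.
have Gt : G \in tri V by apply: (complete_tri hV); case: cT.
have Gu : G \in unitmx by apply: (complete_unit hV cT).
pose Z := (invmx G)^T *m Y *m invmx G; have YZ : Y = G^T *m Z *m G by rewrite congrVK.
have CZ : C Z by apply: (closed_cone_congrV hV Gt Gu); rewrite -YZ.
move=> Cc; have {Cc} [Zc _] : C (c *: ES S - Z).
  by apply: (closed_cone_congrV hV Gt Gu); rewrite mulmxBr mulmxBl -YZ -scalemxAr -scalemxAl.
have Zsupp := psd_le_idems_supported CZ.1 Zc.
have [T' cT' ZT'] := cholesky hV CZ; have [T't T'r] := cT'.
have T'E k : k \notin S -> T' *m E k = 0.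
  move=> /Zsupp Zk; apply: gram_eq0; rewrite trmx_mul idemT mulmxA.
  by rewrite -[_ *m T'^T *m T']mulmxA -ZT' -mulmxA Zk mulmx0.
have sT'G : supp (T' *m G) = supp T'.
  apply/setP => k; rewrite !inE mulmxA; congr (~~ _); apply/eqP/eqP => [e|->].
    by rewrite -[LHS]mulmx1 -(mulmxV Gu) mulmxA e mul0mx.
  by rewrite mul0mx.
exists (T' *m G); split.
- split=> [|k]; first exact: (triM hV).
  rewrite mulmxA; case: (T'r k) => [->|h]; first by left; rewrite mul0mx.
  by right; apply: (prow_mul hV h (complete_chol cT) (complete_supp cT)).
- by rewrite YZ ZT' trmx_mul !mulmxA.
- rewrite sT'G; apply/fintype.subsetP => k; rewrite inE => T'k.
  apply: contraT => /T'E T'k0; case: (T'r k) => [e|[_ _ [t t0]]].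
    by rewrite e eqxx in T'k.
  rewrite -mulmxA T'k0 mulmx0 => /esym/eqP.
  by rewrite scaler_eq0 gt_eqF // (negPf (idem_neq0 hV k)).
rewrite sT'G => sT'.
(* On the blocks in S the completed factor agrees with [T'], the added identity rows living outside
   S, so its lower bound d is inherited there. *)
have [d d0 hd] := gram_lower_bound (complete_unit hV cT').
exists d^-1; rewrite YZ scalemxAl scalemxAr -mulmxBl -mulmxBr.
apply: (closed_cone_congr hV Gt); split; last first.
  apply: ishi_spaceB; first by apply: ishi_spaceZ; case: CZ.
  rewrite -idemsK -{1}idemsT; apply: (ishi_space_gram hV).
  by apply: memv_suml => k _; apply: (tri_idem hV).
split; first by rewrite trmx_sub trmx_scale CZ.1.1 idemsT.
move=> v; rewrite -/(qf _ _) qfD qfN qfZ subr_ge0 -ler_pdivrMl ?invr_gt0 // invrK.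
apply: le_trans (_ : qf (T'^T *m T') v <= _); last by rewrite ZT'.
have T'S : T' *m ES S = T' by apply: mul_idems_supported.
have -> : qf (ES S) v = qf 1%:M (ES S *m v).
  by rewrite -qf_gram idemsT idemsK.
apply: le_trans (hd _) _; rewrite !qf_gram mulmxA [complete T' *m _]mulmxDl T'S sT'.
rewrite [ES _ *m _](_ : _ = 0) ?addr0 //.
apply: trmx_inj; rewrite trmx_mul !idemsT trmx0.
rewrite {2}/idems mulmx_sumr [LHS]big1 // => k; rewrite inE => kS.
by rewrite idems_idem (negPf kS).
Qed.

(** Supports of Cholesky factors grow strictly along a chain, since equal supports would give
    domination both ways; the i-th one thus has at least i elements. *)
Lemma has_chain_le l : has_chain K l -> (l <= r)%N.
Proof.
move=> [x [hx hd]]; rewrite alg_closure_ishi_cone in hx.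
suff main i : (i <= l)%N -> forall T, chol V T -> x i = T^T *m T -> (i <= #|supp T|)%N.
  have [T cT xT] := cholesky hV (hx l (leqnn l)).
  apply: leq_trans (main l (leqnn l) T cT xT) _.
  by rewrite -[X in (_ <= X)%N]card_ord; apply: max_card.
elim: i => // i IH il T cT xT.
have [[c hc] hn] := hd i il; rewrite /dominated alg_closure_ishi_cone in hc hn.
rewrite xT in hc hn.
have [T' [cT' xT' sT' hT']] := dominated_chol cT (hx i (ltnW il)) hc.
apply: leq_ltn_trans (IH (ltnW il) T' cT' xT') _; apply: proper_card.
rewrite finset.properEneq sT' andbT; apply/eqP => /hT'[c' hc'].
by apply: hn; exists c'.
Qed.

(** The chain consists of the sums of the first i idempotents for i = 0, ..., r: r + 1 points
    starting at 0, hence r strict steps. *)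
Lemma has_chain_rank : has_chain K r.
Proof.
pose S i : {set 'I_r} := [set k : 'I_r | (k < i)%N]%SET.
have CS i : C (ES (S i)).
  rewrite -idemsK -{1}idemsT; apply: (closed_cone_gram hV).
  by apply: memv_suml => k _; apply: (tri_idem hV).
exists (fun i => ES (S i)); rewrite /dominated alg_closure_ishi_cone; split=> // i ir.
pose k := Ordinal ir; have ikS : k \notin S i by rewrite inE ltnn.
have eS : ES (S i.+1) = E k + ES (S i).
  have -> : S i.+1 = (k |: S i)%SET.
    by apply/setP => j; rewrite !inE ltnS leq_eqVlt -val_eqE.
  by rewrite /idems [LHS]big_setU1.
split.
  exists 1; rewrite scale1r eS addrK -idemK -{1}idemT.
  by apply: (closed_cone_gram hV); apply: (tri_idem hV).
move=> [c [[_ h] _]].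
(* Compression to the new block k, where the smaller point vanishes. *)
have : psd_cone (- 1 *: E k).
  have -> : -1 *: E k = (E k)^T *m (c *: ES (S i) - ES (S i.+1)) *m E k.
    rewrite idemT mulmxBr -scalemxAr eS mulmxDr !idem_idems (negPf ikS) scaler0.
    by rewrite addr0 sub0r mulNmx !idemK scaleN1r.
  by apply: psd_congr; split=> //; rewrite trmx_sub trmx_scale !idemsT.
have Ek : psd_cone (E k) by rewrite -idems1; apply: psd_idems.
by move=> /(psd_scale_ge0 Ek (idem_neq0 hV k)); rewrite ler0N1.
Qed.

End ChainLength.

Lemma ishi_rank_unique (R : realType) (n r s : nat) (K : set 'M[R]_n) :
  has_ishi_representation K r -> has_ishi_representation K s -> s = r.
Proof.
move=> [p [V [hV /linearly_isomorphic_cone_iso[f [g fg]]]]].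
move=> [q [W [hW /linearly_isomorphic_cone_iso[f' [g' fg']]]]].
have fgW := cone_iso_trans (cone_iso_sym fg) fg'.
apply/eqP; rewrite eqn_leq; apply/andP; split.
  apply: (has_chain_le hV).
  exact: cone_iso_has_chain (cone_iso_sym fgW) (has_chain_rank hW).
apply: (has_chain_le hW).
exact: cone_iso_has_chain fgW (has_chain_rank hV).
Qed.

(** * Subsystems of blocks *)

Section SubSystem.
Variables (R : realType) (r : nat) (p : 'I_r -> nat).
Variable V : forall i j : 'I_r, {vspace 'M[R]_(p i, p j)}.
Hypothesis hV : ishi_axioms V.
Variables (m : nat) (s : 'I_m -> 'I_r).
Hypothesis s_lt : forall i j : 'I_m, (i < j)%N -> (s i < s j)%N.

Definition sub_size (i : 'I_m) : nat := p (s i).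
Definition sub_spaces (i j : 'I_m) : {vspace 'M[R]_(sub_size i, sub_size j)} :=
  V (s i) (s j).

Local Notation n := (\sum_i p i)%N.
Local Notation q := sub_size.
Local Notation nq := (\sum_i q i)%N.
Local Notation C := (ishi_closed_cone V).

Lemma sub_le (i j : 'I_m) : (i <= j)%N -> (s i <= s j)%N.
Proof.
by rewrite leq_eqVlt => /orP[/eqP/val_inj ->//|/s_lt/ltnW].
Qed.

Lemma sub_inj : injective s.
Proof.
move=> i j e; apply: val_inj; have [ij|ij|//] := ltngtP i j.
  by have := s_lt ij; rewrite e ltnn.
by have := s_lt ij; rewrite e ltnn.
Qed.

Lemma sub_ishi_axioms : ishi_axioms sub_spaces.
Proof.
split=> [i|i|i j k ij jk A B|i j k ij jk A B|i j ij A].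
- exact: (ishi_size hV).
- exact: (ishi_diag hV).
- exact: (ishi_V1 hV (sub_le ij) (sub_le jk)).
- exact: (ishi_V2 hV (sub_le ij) (s_lt jk)).
- exact: (ishi_V3 hV (sub_le ij)).
Qed.

Lemma sub_dim_condition : dim_condition V -> dim_condition sub_spaces.
Proof. by move=> h i j k ij jk; apply: h; apply: s_lt. Qed.

(** A coisometry onto the selected blocks: [sub_selK] and [sub_selTK] make compression and extension
    by zero mutually inverse on matrices supported there. *)
Definition sub_sel : 'M[R]_(nq, n) := \mxcol_i sel p (s i).

Lemma sel_sub_sel i : sel q i *m sub_sel = sel p (s i).
Proof. by rewrite selE mxcolK. Qed.

Lemma sub_selK : sub_sel *m sub_sel^T = 1%:M.
Proof.
apply: blkP => i j; rewrite !blkE mulmxA sel_sub_sel mulmx1 -mulmxA -trmx_mul.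
rewrite sel_sub_sel; have [->|ij] := eqVneq i j.
  exact: etrans (selK R p (s j)) (esym (selK R q j)).
have sij : s i != s j by apply: contra_neq ij => /sub_inj.
exact: etrans (sel_ortho R p sij) (esym (sel_ortho R q ij)).
Qed.

Definition sub_image : {set 'I_r} := [set s i | i : 'I_m]%SET.

Lemma sub_selTK : sub_sel^T *m sub_sel = idems p sub_image.
Proof.
rewrite -[X in X *m sub_sel]mulmx1 -sum_idem mulmx_sumr mulmx_suml /idems.
rewrite [RHS]big_imset /=; last by move=> i j _ _; apply: sub_inj.
apply: eq_bigr => i _.
by rewrite !idemE !mulmxA -trmx_mul -mulmxA sel_sub_sel.
Qed.

Lemma sub_sel_idem k : k \notin sub_image -> sub_sel *m idem p k = 0.
Proof.
move=> kS; apply: gram_eq0; rewrite trmx_mul idemT mulmxA.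
rewrite -[_ *m sub_sel^T *m _]mulmxA sub_selTK idem_idems (negPf kS).
by rewrite mul0mx.
Qed.

Definition supported_cone : set 'M[R]_n :=
  [set X | C X /\ forall k, k \notin sub_image -> X *m idem p k = 0].

Definition restrict_lfun : 'Hom('M[R]_n, 'M[R]_nq) :=
  linfun (mulmxr sub_sel^T \o mulmx sub_sel).
Definition extend_lfun : 'Hom('M[R]_nq, 'M[R]_n) :=
  linfun (mulmxr sub_sel \o mulmx sub_sel^T).

Lemma cone_iso_restrict :
  cone_iso supported_cone (ishi_closed_cone sub_spaces) restrict_lfun extend_lfun.
Proof.
have rE X : restrict_lfun X = sub_sel *m X *m sub_sel^T by rewrite lfunE.
have eE Z : extend_lfun Z = sub_sel^T *m Z *m sub_sel by rewrite lfunE.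
have qfr X v : qf (sub_sel *m X *m sub_sel^T) v = qf X (sub_sel^T *m v).
  by rewrite /qf trmx_mul trmxK !mulmxA.
have qfe Z v : qf (sub_sel^T *m Z *m sub_sel) v = qf Z (sub_sel *m v).
  by rewrite /qf trmx_mul !mulmxA.
split=> [X [[[XT Xp] Xs] XS]|Z [[ZT Zp] Zs]]; rewrite !rE !eE.
  split; last first.
    rewrite !mulmxA sub_selTK -[_ *m sub_sel^T *m sub_sel]mulmxA sub_selTK.
    rewrite -mulmxA mul_idems_supported //; apply: trmx_inj.
    by rewrite trmx_mul XT idemsT mul_idems_supported.
  split.
    split=> [|v]; first by rewrite !trmx_mul trmxK XT mulmxA.
    by rewrite -/(qf _ _) qfr; apply: Xp.
  apply/ishi_spaceP; split; first by rewrite !trmx_mul trmxK XT mulmxA.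
  move=> i j ij; have [_ /(_ _ _ (sub_le ij))] := (ishi_spaceP V X).1 Xs.
  rewrite !blkE !mulmxA sel_sub_sel -[_ *m sub_sel^T *m _]mulmxA -trmx_mul.
  by rewrite sel_sub_sel.
split; last first.
  rewrite !mulmxA sub_selK mul1mx -mulmxA sub_selK mulmx1 //.
have UT : (sub_sel^T *m Z *m sub_sel)^T = sub_sel^T *m Z *m sub_sel.
  by rewrite !trmx_mul trmxK ZT mulmxA.
have US k : k \notin sub_image -> sub_sel^T *m Z *m sub_sel *m idem p k = 0.
  by move=> kS; rewrite -mulmxA sub_sel_idem // mulmx0.
split=> //; split.
  by split=> // v; rewrite -/(qf _ _) qfe; apply: Zp.
apply/ishi_spaceP; split=> // a b ab.
(* Blocks with an index outside [sub_image] vanish; for the row index this goes through symmetry. *)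
have [/imsetP[j _ bj]|bS] := boolP (b \in sub_image); last first.
  have := congr1 (fun Y => blk Y a b) (US b bS).
  by rewrite blk_Midem eqxx blk0 => ->; apply: mem0v.
have [/imsetP[i _ ai]|aS] := boolP (a \in sub_image); last first.
  have := congr1 (fun Y => blk Y b a) (US a aS).
  by rewrite blk_Midem eqxx blk0 -{2}UT blkT => ->; rewrite trmx0 mem0v.
subst a b; have ij : (i <= j)%N.
  by rewrite leqNgt; apply: contraL ab => /s_lt; rewrite -ltnNge.
have [_ /(_ _ _ ij)] := (ishi_spaceP sub_spaces Z).1 Zs.
have ss i' : sel p (s i') *m sub_sel^T = sel q i'.
  by rewrite -sel_sub_sel -mulmxA sub_selK mulmx1.
rewrite !blkE !mulmxA ss -[_ *m sub_sel *m _]mulmxA.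
by rewrite -[sub_sel *m (sel p (s j))^T]trmxK trmx_mul trmxK ss.
Qed.

End SubSystem.

(** The enumeration of [S] filters that of all indices, hence is increasing; a subsystem has to keep
    the block order. *)
Lemma enum_val_ltn (r : nat) (S : {set 'I_r}) (i j : 'I_#|S|) :
  (i < j)%N -> ((enum_val i : 'I_r) < (enum_val j : 'I_r))%N.
Proof.
move=> ij; pose x0 : 'I_r := enum_val i; rewrite !(enum_val_nth x0).
have tr : transitive (fun a b : 'I_r => (a < b)%N) by move=> a b c; apply: ltn_trans.
apply: (sorted_ltn_nth tr) => //; rewrite ?inE -?cardE ?ltn_ord //.
rewrite {1}/enum_mem; apply: sorted_filter => //.
rewrite -enumT; have := iota_ltn_sorted 0 r; rewrite -val_enum_ord.
by rewrite sorted_map.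
Qed.

(** * Structure of the faces *)

Section Faces.
Variables (R : realType) (r : nat) (p : 'I_r -> nat).
Variable V : forall i j : 'I_r, {vspace 'M[R]_(p i, p j)}.
Hypothesis hV : ishi_axioms V.
Local Notation n := (\sum_i p i)%N.
Local Notation C := (ishi_closed_cone V).
Implicit Types (X Y T G : 'M[R]_n).

(** A point X = G^T P G of greatest rank generates F, with P = [idems p S]. A point supported on S
    is bounded by a multiple of P, so its congruence by G is a summand of a point of F; conversely
    each Y in F vanishes on the kernel of X, which puts its pullback on S. *)
Lemma face_iso F : is_face C F ->
  exists (m : nat) (s : 'I_m -> 'I_r), (forall i j : 'I_m, (i < j)%N -> (s i < s j)%N) /\
  exists f g, cone_iso (ishi_closed_cone (sub_spaces V s)) F f g.
Proof.
move=> fF; have [[X0 FX0] FC Fc _] := fF.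
have CZ (t : R) x : 0 <= t -> C x -> C (t *: x) by apply: closed_coneZ.
have C0 := closed_cone0 hV.
pose P k := `[< exists2 X, F X & \rank X = k >].
have exP : exists k, P k by exists (\rank X0); apply/asboolP; exists X0.
have ubP k : P k -> (k <= n)%N by move=> /asboolP[X _ <-]; apply: rank_leq_row.
case: (ex_maxnP exP ubP) => k /asboolP[X FX rX] kmax.
have [T cT XT] := cholesky hV (FC _ FX).
pose S := supp T; pose G := complete T; pose s : 'I_#|S| -> 'I_r := @enum_val _ (mem S).
have Gt : G \in tri V by apply: (complete_tri hV); case: cT.
have Gu : G \in unitmx by apply: (complete_unit hV cT).
have XG : X = G^T *m idems p S *m G by rewrite XT gram_complete.
have s_lt : forall i j : 'I_#|S|, (i < j)%N -> (s i < s j)%N by exact: enum_val_ltn.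
have sS : sub_image s = S.
  apply/setP => a; apply/imsetP/idP => [[i _ ->]|aS]; first exact: enum_valP.
  by exists (enum_rank_in aS a); rewrite // /s enum_rankK_in.
have fgS := cone_iso_sym (@cone_iso_restrict _ _ _ V _ _ s_lt).
exists #|S|, s; split=> //.
suff fgG : cone_iso (supported_cone V s) F (congr_lfun G) (congr_lfun (invmx G)).
  exists (congr_lfun G \o extend_lfun R p s)%VF.
  exists (restrict_lfun R p s \o congr_lfun (invmx G))%VF.
  exact: cone_iso_trans fgS fgG.
split=> Y; rewrite !congr_lfunE /supported_cone /= sS.
  move=> [CY YS]; rewrite congrKV //; split=> //.
  pose b := \sum_i \sum_j `|Y i j|; have b0 : 0 <= b.
    by apply: sumr_ge0 => i _; apply: sumr_ge0.
  have CW : C ((b + 1) *: idems p S - Y).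
    have Ss : ishi_space V (idems p S).
      rewrite -idemsK -{1}idemsT; apply: (ishi_space_gram hV).
      by apply: memv_suml => l _; apply: (tri_idem hV).
    split; last by apply: ishi_spaceB; [apply: ishi_spaceZ | case: CY].
    split; first by rewrite trmx_sub trmx_scale idemsT CY.1.1.
    move=> v; rewrite -/(qf _ _) qfD qfN qfZ subr_ge0.
    have YE : Y = (idems p S)^T *m Y *m idems p S.
      rewrite -mulmxA mul_idems_supported //; apply: trmx_inj.
      by rewrite trmx_mul trmxK CY.1.1 mul_idems_supported.
    rewrite {1}YE qf_congr -{2}idemsK -{2}idemsT qf_gram.
    apply: le_trans (ler_norm _) _; apply: le_trans (qf_bound _ _) _.
    by rewrite ler_wpM2r ?qf1_ge0 // lerDl.
  have b1 : 0 < b + 1 by rewrite ltr_wpDl.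
  have h : F (G^T *m Y *m G + G^T *m ((b + 1) *: idems p S - Y) *m G).
    rewrite -mulmxDl -mulmxDr addrC subrK -scalemxAr -scalemxAl -XG.
    by apply: (face_scale C0 CZ fF) => //; apply: ltW.
  by apply: (face_summand C0 CZ fF) h; apply: (closed_cone_congr hV).
move=> FY; rewrite congrVK //; split=> //.
have CY := FC _ FY; have CX := FC _ FX.
split; first by apply: (closed_cone_congr hV) => //; apply: (tri_inv hV).
(* Twice the midpoint of X and Y. *)
have FXY : F (X + Y).
  have h1 : (1 - 2^-1 : R) = 2^-1 by field.
  have := (convex_setE F).1 Fc X Y 2^-1 FX FY; rewrite h1 -scalerDr => h.
  have i2 : 0 <= 2^-1 :> R by rewrite invr_ge0.
  have i1 : 2^-1 <= 1 :> R by rewrite invf_le1 // ler1n.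
  have := face_scale C0 CZ fF (ler0n R 2) (h i2 i1).
  by rewrite scalerA mulfV // scale1r.
have rXY : (\rank (X + Y)%R <= \rank X)%N.
  by rewrite rX; apply: kmax; apply/asboolP; exists (X + Y).
move=> l lS; apply: mx_cv_eq0 => v; rewrite -!mulmxA.
rewrite [Y *m _](psd_max_rank_ker CX.1 CY.1 rXY) ?mulmx0 //.
rewrite XG !mulmxA -[_ *m G *m invmx G]mulmxA (mulmxV Gu) mulmx1.
by rewrite -[_ *m idems p S *m idem p l]mulmxA idems_idem (negPf lS) mulmx0 mul0mx.
Qed.

Lemma closed_cone_rank_is_caratheodory_number :
  dim_condition V -> rank_is_caratheodory_number C.
Proof.
move=> cond; rewrite /rank_is_caratheodory_number relative_interior_closed_cone //.
split; first exact: ishi_cone_homogeneous.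
exists r; last exact: dim_condition_caratheodory.
have h : has_ishi_representation (ishi_cone V) r.
  exists p, V; split=> //.
  apply: (@cone_iso_linearly_isomorphic _ _ _ _ _ \1%VF \1%VF).
  by split=> x Kx; rewrite !id_lfunE.
by split=> // s' hs'; apply: ishi_rank_unique hs'.
Qed.

End Faces.

Lemma dim_condition_rank_on_faces (R : realType) (r : nat) (p : 'I_r -> nat)
    (V : forall i j : 'I_r, {vspace 'M[R]_(p i, p j)}) :
  ishi_axioms V -> dim_condition V ->
  caratheodory_rank_on_faces (ishi_closed_cone V).
Proof.
move=> hV cond F fF _; have [m [s [s_lt [f [g fg]]]]] := face_iso hV fF.
apply: (cone_iso_rank_is_caratheodory_number fg).
apply: closed_cone_rank_is_caratheodory_number; first exact: sub_ishi_axioms.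
exact: sub_dim_condition.
Qed.

(** * Trace inner product and orthonormal bases *)

Section InnerProduct.
Variable R : realType.

(** The formula of [frob], for rectangular blocks. *)
Definition ip m n (A B : 'M[R]_(m, n)) : R := \tr (A^T *m B).

Lemma ipC m n (A B : 'M[R]_(m, n)) : ip A B = ip B A.
Proof. by rewrite /ip -mxtrace_tr trmx_mul trmxK. Qed.

Lemma ipDr m n (A B D : 'M[R]_(m, n)) : ip A (B + D) = ip A B + ip A D.
Proof. by rewrite /ip mulmxDr mxtraceD. Qed.

Lemma ipZr m n (t : R) (A B : 'M[R]_(m, n)) : ip A (t *: B) = t * ip A B.
Proof. by rewrite /ip -scalemxAr mxtraceZ. Qed.

Lemma ipDl m n (A B D : 'M[R]_(m, n)) : ip (A + B) D = ip A D + ip B D.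
Proof. by rewrite ipC ipDr ![ip D _]ipC. Qed.

Lemma ipZl m n (t : R) (A B : 'M[R]_(m, n)) : ip (t *: A) B = t * ip A B.
Proof. by rewrite ipC ipZr ipC. Qed.

Lemma ip0r m n (A : 'M[R]_(m, n)) : ip A 0 = 0.
Proof. by rewrite /ip mulmx0 mxtrace0. Qed.

Lemma ip_sumr m n (I : finType) (A : 'M[R]_(m, n)) (B : I -> 'M[R]_(m, n)) :
  ip A (\sum_i B i) = \sum_i ip A (B i).
Proof. by apply: (big_morph (ip A)); [apply: ipDr | apply: ip0r]. Qed.

Lemma ip_suml m n (I : finType) (A : I -> 'M[R]_(m, n)) (B : 'M[R]_(m, n)) :
  ip (\sum_i A i) B = \sum_i ip (A i) B.
Proof. by rewrite ipC ip_sumr; apply: eq_bigr => i _; rewrite ipC. Qed.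

Lemma ip_mulr m n k (A : 'M[R]_(m, n)) (S : 'M[R]_(n, k)) (B : 'M[R]_(m, k)) :
  ip (A *m S) B = ip A (B *m S^T).
Proof. by rewrite /ip trmx_mul -mulmxA mxtrace_mulC mulmxA. Qed.

Lemma ip_mull m n k (A : 'M[R]_(k, n)) (S : 'M[R]_(m, k)) (B : 'M[R]_(m, n)) :
  ip (S *m A) B = ip A (S^T *m B).
Proof. by rewrite /ip trmx_mul mulmxA. Qed.

Lemma ip_eq0 m n (A : 'M[R]_(m, n)) : (ip A A == 0) = (A == 0).
Proof.
apply/eqP/eqP => [h|->]; last by rewrite ip0r.
have d j : (A^T *m A) j j = \sum_i A i j ^+ 2.
  by rewrite mxE; apply: eq_bigr => i _; rewrite mxE expr2.
have dp j : 0 <= (A^T *m A) j j by rewrite d; apply: sumr_ge0 => i _; apply: sqr_ge0.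
have d0 j : (A^T *m A) j j = 0 by apply: (psumr_eq0P _ h).
apply/matrixP => i j; rewrite mxE; apply/eqP; rewrite -(sqrf_eq0 (A i j)); apply/eqP.
have := d0 j; rewrite d => /psumr_eq0P; apply=> // k _.
exact: sqr_ge0.
Qed.

Lemma ip_ge0 m n (A : 'M[R]_(m, n)) : 0 <= ip A A.
Proof.
apply: sumr_ge0 => j _; rewrite mxE; apply: sumr_ge0 => i _.
by rewrite mxE -expr2 sqr_ge0.
Qed.

Lemma ip_linear m n (A : 'M[R]_(m, n)) : linear_for *%R (ip A).
Proof. by move=> t B D; rewrite ipDr ipZr. Qed.

HB.instance Definition _ m n (A : 'M[R]_(m, n)) :=
  GRing.isLinear.Build R 'M[R]_(m, n) R *%R (ip A) (@ip_linear m n A).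

Definition is_onb m n (U : {vspace 'M[R]_(m, n)}) k (b : 'I_k -> 'M[R]_(m, n)) :=
  [/\ forall i, b i \in U, forall i j, ip (b i) (b j) = (i == j)%:R &
      forall x, x \in U -> x = \sum_i ip (b i) x *: b i].

(** Gram-Schmidt by induction on the dimension: a unit vector u of U is added to a basis of its
    orthogonal complement in U. *)
Lemma onb_exists m n (U : {vspace 'M[R]_(m, n)}) :
  exists k (b : 'I_k -> 'M[R]_(m, n)), is_onb U b.
Proof.
have [d dU] := ubnP (\dim U); elim: d U dU => // d IH U dU.
have [U0|U0] := eqVneq U 0%VS.
  exists 0%N, (fun=> 0); split=> [[]//|[]//|x].
  by rewrite U0 memv0 => /eqP ->; rewrite [RHS]big_ord0.
set v := vpick U; have v0 : v != 0 by rewrite vpick0.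
have vv : 0 < ip v v by rewrite lt_neqAle eq_sym ip_eq0 v0 ip_ge0.
pose u := (Num.sqrt (ip v v))^-1 *: v.
have uU : u \in U by rewrite memvZ ?memv_pick.
have uu : ip u u = 1.
  rewrite ipZl ipZr mulrA -invfM -expr2 sqr_sqrtr ?ltW // mulVf ?gt_eqF //.
clearbody u.
pose f : 'Hom('M[R]_(m, n), R^o) := linfun (ip u).
have fE x : f x = ip u x by rewrite lfunE.
pose W := (U :&: lker f)%VS.
have WP x : (x \in W) = (x \in U) && (ip u x == 0) by rewrite memv_cap memv_ker fE.
have dW : (\dim W < d)%N.
  rewrite ltnS in dU; apply: leq_trans dU; rewrite ltn_neqAle dimvS ?capvSl // andbT.
  apply/eqP => e; have /eqP WU : (W == U)%VS by rewrite eqEdim capvSl e /=.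
  by move: uU; rewrite -WU WP uu oner_eq0 andbF.
have [k [b [bW bo bx]]] := IH W dW.
have bU i : b i \in U by move: (bW i); rewrite WP => /andP[].
have ub i : ip u (b i) = 0 by move: (bW i); rewrite WP => /andP[_ /eqP].
exists k.+1, (fun i => if unlift ord0 i is Some j then b j else u); split.
- by move=> i; case: unliftP.
- move=> i j; case: (unliftP ord0 i) => [i'|] ->; case: (unliftP ord0 j) => [j'|] ->.
  + by rewrite bo (inj_eq (@lift_inj _ _)).
  + by rewrite ipC ub.
  + by rewrite ub.
  + by rewrite uu eqxx.
- move=> x xU; rewrite [RHS]big_ord_recl unlift_none.
  have xW : x - ip u x *: u \in W.
    by rewrite WP memvB ?memvZ // andTb -scaleNr ipDr ipZr uu mulr1 subrr.
  rewrite -[LHS](subrKC (ip u x *: u)); congr (_ + _); rewrite [LHS](bx _ xW).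
  apply: eq_bigr => i _; rewrite liftK; congr (_ *: _).
  by rewrite -scaleNr ipDr ipZr [ip (b i) u]ipC ub mulr0 addr0.
Qed.

(** The basis is fixed once by choice, because its size becomes a block size and must occur in
    types. *)
Definition onb_size m n (U : {vspace 'M[R]_(m, n)}) : nat := sval (cid (onb_exists U)).

Definition onb m n (U : {vspace 'M[R]_(m, n)}) : 'I_(onb_size U) -> 'M[R]_(m, n) :=
  sval (cid (svalP (cid (onb_exists U)))).

Arguments onb {m n} U _.

Lemma onbP m n (U : {vspace 'M[R]_(m, n)}) : is_onb U (onb U).
Proof. exact: svalP (cid (svalP (cid (onb_exists U)))). Qed.

Lemma onb_mem m n (U : {vspace 'M[R]_(m, n)}) a : onb U a \in U.
Proof. by have [] := onbP U. Qed.

Lemma onb_parseval m n (U : {vspace 'M[R]_(m, n)}) x y : x \in U ->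
  \sum_a ip (onb U a) x * ip (onb U a) y = ip x y.
Proof.
move=> xU; have [_ _ /(_ _ xU) xE] := onbP U.
by rewrite [in RHS]xE ip_suml; apply: eq_bigr => a _; rewrite ipZl.
Qed.

Lemma orthogonal_projection m n (U : {vspace 'M[R]_(m, n)}) (B : 'M[R]_(m, n)) :
  exists2 W, W \in U & forall x, x \in U -> ip x W = ip x B.
Proof.
exists (\sum_a ip (onb U a) B *: onb U a).
  by apply: memv_suml => a _; rewrite memvZ ?onb_mem.
move=> x xU; rewrite ip_sumr -(onb_parseval B xU); apply: eq_bigr => a _.
by rewrite ipZr mulrC [ip x _]ipC.
Qed.

End InnerProduct.

Arguments onb {R m n} U _.

(** * The Ishi representation of the dual cone *)

Section DualRepresentation.
Variables (R : realType) (r : nat) (p : 'I_r -> nat).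
Variable V : forall i j : 'I_r, {vspace 'M[R]_(p i, p j)}.
Hypothesis hV : ishi_axioms V.
Local Notation n := (\sum_i p i)%N.

(* The j-th block columns of the elements of tri V. Right multiplication by
   Y in V_jk maps colspace j to colspace k; its matrices [Rmx Y] in orthonormal
   bases give, in reversed order, an Ishi representation of the dual cone. *)
Definition colspace (j : 'I_r) : {vspace 'M[R]_(n, p j)} :=
  (\bigcap_i (linfun (mulmx (sel p i)) @^-1: (if (i <= j)%N then V i j else 0)))%VS.

Lemma colspaceP (j : 'I_r) (A : 'M[R]_(n, p j)) : reflect
  ((forall i : 'I_r, (i <= j)%N -> sel p i *m A \in V i j) /\
   (forall i : 'I_r, (j < i)%N -> sel p i *m A = 0)) (A \in colspace j).
Proof.
apply: (iffP (memv_bigcapP _ _)) => [h|[h1 h2] i].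
  split=> i ij; have := h i; rewrite -memv_preim lfunE /=; first by rewrite ij.
  by rewrite leqNgt ij /= memv0 => /eqP.
rewrite -memv_preim lfunE /=; case: leqP => ij; first exact: h1.
by rewrite memv0 h2.
Qed.

Lemma colspace_mul (j k : 'I_r) A Y : (j <= k)%N -> A \in colspace j ->
  Y \in V j k -> A *m Y \in colspace k.
Proof.
move=> jk /colspaceP[A1 A2] YV; apply/colspaceP; split=> i ik; rewrite mulmxA.
  case: (leqP i j) => ij; last by rewrite A2 // mul0mx mem0v.
  by apply: (ishi_V1 hV ij jk) => //; apply: A1.
by rewrite A2 ?mul0mx //; apply: leq_ltn_trans ik.
Qed.

Lemma mul_selE m k (A : 'M[R]_(n, m)) (B : 'M[R]_(n, k)) :
  A^T *m B = \sum_i (sel p i *m A)^T *m (sel p i *m B).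
Proof.
rewrite -[X in _ *m X]mul1mx -sum_sel mulmx_suml mulmx_sumr.
by apply: eq_bigr => i _; rewrite trmx_mul !mulmxA.
Qed.

Lemma colspace_trmul (j k : 'I_r) A B : (j < k)%N -> A \in colspace j ->
  B \in colspace k -> A^T *m B \in V j k.
Proof.
move=> jk /colspaceP[A1 A2] /colspaceP[B1 B2]; rewrite mul_selE.
apply: memv_suml => i _; case: (leqP i j) => ij; last by rewrite A2 // trmx0 mul0mx mem0v.
apply: (ishi_V2 hV ij jk); [exact: A1 | apply: B1].
exact: leq_trans (ltnW jk).
Qed.

Lemma colspace_gram j A : A \in colspace j -> A^T *m A \in V j j.
Proof.
move=> /colspaceP[A1 A2]; rewrite mul_selE; apply: memv_suml => i _.
case: (leqP i j) => ij; last by rewrite A2 // mulmx0 mem0v.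
by apply: (ishi_V3 hV ij); apply: A1.
Qed.

Lemma colspace_sel j : (sel p j)^T \in colspace j.
Proof.
apply/colspaceP; split=> i ij.
  have [e|ne] := eqVneq i j; last by rewrite sel_ortho ?mem0v.
  by subst i; rewrite selK (ishi_diag hV) memv_line.
by rewrite sel_ortho // -val_eqE /= gtn_eqF.
Qed.

Lemma size_neq0 j : (p j)%:R != 0 :> R.
Proof. by rewrite pnatr_eq0 -lt0n (ishi_size hV). Qed.

(* Right multiplication by Y is a similarity of the j-th column space: polarise
   [V3], which makes A^T B + B^T A a scalar matrix. *)
Lemma ip_colspace_mul j k A B (Y : 'M[R]_(p j, k)) : A \in colspace j ->
  B \in colspace j -> ip (A *m Y) (B *m Y) = ip A B * (ip Y Y / (p j)%:R).
Proof.
move=> AM BM.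
have : A^T *m B + B^T *m A \in V j j.
  have -> : A^T *m B + B^T *m A = (A + B)^T *m (A + B) - A^T *m A - B^T *m B.
    rewrite trmx_add mulmxDl !mulmxDr.
    move: (A^T *m A) (A^T *m B) (B^T *m A) (B^T *m B) => a b c d.
    by apply/matrixP => x y; rewrite !mxE; ring.
  by rewrite !memvB ?colspace_gram ?memvD.
rewrite (ishi_diag hV) => /vlineP[t tE].
(* From A^T B + B^T A = t I, the trace gives 2<A, B>, and the pairing of Y with this matrix times Y
   gives 2<AY, BY>. *)
have h1 : 2 * ip A B = t * (p j)%:R.
  have -> : 2 * ip A B = ip A B + ip B A by rewrite [ip B A]ipC; ring.
  by rewrite /ip -mxtraceD tE mxtraceZ mxtrace1.
have h2 : 2 * ip (A *m Y) (B *m Y) = t * ip Y Y.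
  have -> : 2 * ip (A *m Y) (B *m Y) = ip (A *m Y) (B *m Y) + ip (B *m Y) (A *m Y).
    by rewrite [ip (B *m Y) _]ipC; ring.
  rewrite !ip_mull -ipDr !mulmxA -mulmxDl tE -scalemxAl mul1mx.
  by rewrite ipZr.
have p0 := size_neq0 j.
apply: (@mulfI _ 2) => //; rewrite h2 [RHS]mulrA h1 -[RHS]mulrA.
by congr (_ * _); rewrite mulrC divfK.
Qed.

Definition csize j := onb_size (colspace j).
Definition cbas j : 'I_(csize j) -> 'M[R]_(n, p j) := onb (colspace j).

Definition Rmx j k (Y : 'M[R]_(p j, p k)) : 'M[R]_(csize k, csize j) :=
  \matrix_(a, b) ip (cbas a) (cbas b *m Y).

Lemma Rmx_is_linear j k : linear (@Rmx j k).
Proof.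
move=> t Y Z; apply/matrixP => a b.
by rewrite !mxE mulmxDr -scalemxAr ipDr ipZr.
Qed.

HB.instance Definition _ j k :=
  GRing.isLinear.Build R 'M[R]_(p j, p k) 'M[R]_(csize k, csize j) _ (@Rmx j k)
    (@Rmx_is_linear j k).

Lemma cbas_mem j a : @cbas j a \in colspace j.
Proof. exact: onb_mem. Qed.

Lemma cbas_parseval j x y : x \in colspace j ->
  \sum_a ip (@cbas j a) x * ip (@cbas j a) y = ip x y.
Proof. exact: onb_parseval. Qed.

(** The source of [V1] for the dual: right multiplications compose in the opposite order, whence the
    reversed blocks. Parseval applies because basis vectors times Y stay in [colspace k]. *)
Lemma Rmx_mul (j k l : 'I_r) Y Z : (j <= k)%N -> Y \in V j k ->
  @Rmx k l Z *m @Rmx j k Y = Rmx (Y *m Z).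
Proof.
move=> jk YV; apply/matrixP => a b; rewrite !mxE mulmxA.
rewrite [RHS]ipC ip_mulr -(cbas_parseval _ (colspace_mul jk (cbas_mem b) YV)).
apply: eq_bigr => c _; rewrite !mxE mulrC; congr (_ * _).
by rewrite -ip_mulr ipC.
Qed.

(** The source of [V2] for the dual. The entries are <A Y, B Z> = <B^T A, Z Y^T> with A in
    [colspace k] and B in [colspace j]. Here B^T A is in V_jk, so Z Y^T may be replaced by its
    orthogonal projection to V_jk. *)
Lemma Rmx_trmul (j k l : 'I_r) Y Z : (j < k)%N -> (k <= l)%N -> Y \in V k l ->
  exists2 W, W \in V j k & (@Rmx k l Y)^T *m @Rmx j l Z = Rmx W.
Proof.
move=> jk kl YV; have [W WV hW] := orthogonal_projection (V j k) (Z *m Y^T).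
exists W => //; apply/matrixP => a b; rewrite !mxE.
rewrite [RHS]ipC ip_mull ipC hW; last first.
  by apply: colspace_trmul => //; apply: cbas_mem.
rewrite [RHS]ipC -ip_mull mulmxA [RHS]ipC -ip_mulr.
rewrite -(cbas_parseval _ (colspace_mul kl (cbas_mem a) YV)).
by apply: eq_bigr => c _; rewrite !mxE.
Qed.

(** The source of [V3] for the dual: the entries are <A Y, B Y> for basis vectors A, B, and right
    multiplication by Y is a similarity. *)
Lemma Rmx_gram (j k : 'I_r) Y : (j <= k)%N -> Y \in V j k ->
  (@Rmx j k Y)^T *m Rmx Y = (ip Y Y / (p j)%:R) *: 1%:M.
Proof.
move=> jk YV; apply/matrixP => a b; rewrite !mxE.
have [_ o _] := onbP (colspace j).
transitivity (ip (cbas a *m Y) (cbas b *m Y)); last first.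
  by rewrite ip_colspace_mul ?cbas_mem // [ip (cbas a) _]o mulrC.
rewrite -(cbas_parseval _ (colspace_mul jk (cbas_mem a) YV)).
by apply: eq_bigr => c _; rewrite !mxE.
Qed.

Lemma Rmx1 j : Rmx (1%:M : 'M[R]_(p j)) = 1%:M.
Proof.
apply/matrixP => a b; rewrite !mxE mulmx1.
by have [_ o _] := onbP (colspace j); rewrite [LHS]o.
Qed.

Lemma csize_gt0 j : (0 < csize j)%N.
Proof.
rewrite lt0n; apply/eqP => c0; have [_ _ /(_ _ (colspace_sel j))] := onbP (colspace j).
rewrite [X in _ = X]big1 => [|a _]; last first.
  by have := ltn_ord a; rewrite [X in (_ < X)%N]c0.
move=> s0; have := size_neq0 j; rewrite -(mxtrace1 R (p j)) -selK s0 mulmx0 mxtrace0.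
by rewrite eqxx.
Qed.

(** The norm of Y is read off from a diagonal entry of the Gram matrix; one exists by
    [csize_gt0]. *)
Lemma Rmx_eq0 (j k : 'I_r) Y : (j <= k)%N -> Y \in V j k -> @Rmx j k Y = 0 -> Y = 0.
Proof.
move=> jk YV Y0; have := Rmx_gram jk YV; rewrite Y0 mulmx0 => /matrixP.
pose a := Ordinal (csize_gt0 j); move=> /(_ a a); rewrite !mxE eqxx mulr1.
move=> /esym/eqP; rewrite mulf_eq0 invr_eq0 (negPf (size_neq0 j)) orbF ip_eq0.
by move=> /eqP.
Qed.

Definition dual_size (i : 'I_r) : nat := csize (rev_ord i).
Definition dual_spaces (i j : 'I_r) : {vspace 'M[R]_(dual_size i, dual_size j)} :=
  (linfun (@Rmx (rev_ord j) (rev_ord i)) @: V (rev_ord j) (rev_ord i))%VS.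

Lemma dual_spacesP i j Z : Z \in dual_spaces i j <->
  exists2 Y, Y \in V (rev_ord j) (rev_ord i) & Z = Rmx Y.
Proof.
split=> [/memv_imgP[Y YV ->]|[Y YV ->]]; first by exists Y; rewrite // lfunE.
by apply/memv_imgP; exists Y; rewrite // lfunE.
Qed.

Lemma rev_ord_leq (i j : 'I_r) : (rev_ord i <= rev_ord j)%N = (j <= i)%N.
Proof. by rewrite /= leq_sub2lE. Qed.

Lemma rev_ord_ltn (i j : 'I_r) : (rev_ord i < rev_ord j)%N = (j < i)%N.
Proof. by rewrite !ltnNge rev_ord_leq. Qed.

Lemma dual_ishi_axioms : ishi_axioms dual_spaces.
Proof.
split=> [i|i|i j k ij jk A B|i j k ij jk A B|i j ij A].
- exact: csize_gt0.
- rewrite /dual_spaces (ishi_diag hV) limg_line lfunE /=.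
  by congr (<[_]>%VS); apply: Rmx1.
- move=> /dual_spacesP[Y YV ->] /dual_spacesP[Z ZV ->]; apply/dual_spacesP.
  rewrite -rev_ord_leq in ij; rewrite -rev_ord_leq in jk.
  exists (Z *m Y); first exact: (ishi_V1 hV jk ij).
  by rewrite Rmx_mul.
- move=> /dual_spacesP[Y YV ->] /dual_spacesP[Z ZV ->]; apply/dual_spacesP.
  rewrite -rev_ord_leq in ij; rewrite -rev_ord_ltn in jk.
  by have [W WV ->] := Rmx_trmul Z jk ij YV; exists W.
- move=> /dual_spacesP[Y YV ->]; rewrite -rev_ord_leq in ij.
  apply/dual_spacesP; exists ((ip Y Y / (p (rev_ord j))%:R) *: 1%:M).
    by rewrite (ishi_diag hV) memvZ ?memv_line.
  by rewrite Rmx_gram // linearZ /= Rmx1.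
Qed.

Lemma dual_spaces_dim (i j : 'I_r) : (i <= j)%N ->
  \dim (dual_spaces i j) = \dim (V (rev_ord j) (rev_ord i)).
Proof.
move=> ij; apply: limg_dim_eq; apply/eqP; rewrite -subv0; apply/subvP => Y.
rewrite memv_cap memv_ker memv0 lfunE /= => /andP[YV /eqP Y0].
by apply/eqP; apply: Rmx_eq0 Y0; rewrite ?rev_ord_leq.
Qed.

Lemma dual_dim_condition : dim_condition dual_spaces <->
  (forall k j i : 'I_r, (k < j)%N -> (j < i)%N -> V j i != 0%VS ->
     \dim (V k i) = \dim (V k j)).
Proof.
split=> h i j k ij jk.
  move=> Vjk; have := h (rev_ord k) (rev_ord j) (rev_ord i).
  rewrite !rev_ord_ltn !dual_spaces_dim ?rev_ord_leq ?(ltnW ij) ?(ltnW jk) //;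
    last exact: ltnW (ltn_trans ij jk).
  rewrite !rev_ordK; apply=> //; apply: contra_neq Vjk => e.
  by apply/eqP; rewrite -dimv_eq0 -(rev_ordK k) -(rev_ordK j) -dual_spaces_dim
    ?rev_ord_leq ?(ltnW jk) // e dimv0.
move=> Vij; rewrite !dual_spaces_dim ?(ltnW jk) ?(ltnW (ltn_trans ij jk)) //.
apply: h; rewrite ?rev_ord_ltn //; apply: contra_neq Vij => e.
by apply/eqP; rewrite -dimv_eq0 dual_spaces_dim ?(ltnW ij) // e dimv0.
Qed.

End DualRepresentation.

(** * The dual cone as a closed Ishi cone *)

Section DualCone.
Variables (R : realType) (r : nat) (p : 'I_r -> nat).
Variable V : forall i j : 'I_r, {vspace 'M[R]_(p i, p j)}.
Hypothesis hV : ishi_axioms V.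
Local Notation n := (\sum_i p i)%N.
Local Notation q := (dual_size V).
Local Notation nq := (\sum_i q i)%N.
Local Notation cb j := (@cbas R r p V j).
Implicit Types (X Y T U : 'M[R]_n).

(* dual_mx Y represents the quadratic form U |-> tr (U Y U^T) on tri V, and
   every point of the cone is U^T U: hence Y is in the dual cone iff
   dual_mx Y is positive semidefinite. *)
Definition dual_mx Y : 'M[R]_nq :=
  \mxblock_(i, j) (\matrix_(a < q i, b < q j)
    ip (cb (rev_ord i) a *m blk Y (rev_ord i) (rev_ord j)) (cb (rev_ord j) b)).

Lemma blk_dual_mx Y i j a b : blk (dual_mx Y) i j a b =
  ip (cb (rev_ord i) a *m blk Y (rev_ord i) (rev_ord j)) (cb (rev_ord j) b).
Proof. by rewrite blkE -submxblock_sel mxblockK mxE. Qed.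

Lemma dual_mx_is_linear : linear dual_mx.
Proof.
move=> t X Y; apply: blkP => i j; apply/matrixP => a b; rewrite blkD blkZ !mxE.
by rewrite !blk_dual_mx blkD blkZ mulmxDr -scalemxAr ipDl ipZl.
Qed.

HB.instance Definition _ :=
  GRing.isLinear.Build R 'M[R]_n 'M[R]_nq _ dual_mx dual_mx_is_linear.

Lemma blk_dual_mx_Rmx Y i j : Y^T = Y ->
  blk (dual_mx Y) i j = Rmx V (blk Y (rev_ord j) (rev_ord i)).
Proof.
move=> YT; apply/matrixP => a b; rewrite blk_dual_mx mxE ip_mulr.
by rewrite -{1}YT blkT trmxK.
Qed.

Lemma dual_mx_space Y : ishi_space V Y -> ishi_space (dual_spaces V) (dual_mx Y).
Proof.
move=> /ishi_spaceP[YT Ys]; apply/ishi_spaceP; split.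
  apply: blkP => i j; rewrite blkT; apply/matrixP => a b; rewrite mxE !blk_dual_mx.
  by rewrite ip_mulr ipC -{1}YT blkT trmxK.
move=> i j ij; apply/dual_spacesP; exists (blk Y (rev_ord j) (rev_ord i)).
  by apply: Ys; rewrite rev_ord_leq.
exact: blk_dual_mx_Rmx.
Qed.

Lemma dual_mx_inj Y : ishi_space V Y -> dual_mx Y = 0 -> Y = 0.
Proof.
move=> /ishi_spaceP[YT Ys] Y0.
have h (i j : 'I_r) : (i <= j)%N -> blk Y (rev_ord j) (rev_ord i) = 0.
  move=> ij; apply: (Rmx_eq0 hV); rewrite ?Ys ?rev_ord_leq //.
  by rewrite -(blk_dual_mx_Rmx _ _ YT) Y0 blk0.
apply: blkP => a b; rewrite blk0 -(rev_ordK a) -(rev_ordK b).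
case: (leqP (rev_ord b) (rev_ord a)) => ab; first exact: h.
by rewrite -YT blkT h ?trmx0 // ltnW.
Qed.

Lemma dual_mx_onto Z : ishi_space (dual_spaces V) Z ->
  exists2 Y, ishi_space V Y & dual_mx Y = Z.
Proof.
move=> /ishi_spaceP[ZT Zs].
(* Only i <= j carries information; elsewhere 0 is a default that makes the choice total. *)
have ex (i j : 'I_r) : exists y : 'M[R]_(p (rev_ord j), p (rev_ord i)),
    (i <= j)%N -> y \in V (rev_ord j) (rev_ord i) /\ blk Z i j = Rmx V y.
  case: (boolP (i <= j)%N) => ij; last by exists 0.
  by have /dual_spacesP[Y YV ZY] := Zs i j ij; exists Y.
pose y i j := sval (cid (ex i j)).
have yV (i j : 'I_r) : (i <= j)%N -> y i j \in V (rev_ord j) (rev_ord i).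
  by move=> /(svalP (cid (ex i j)))[].
have yZ (i j : 'I_r) : (i <= j)%N -> blk Z i j = Rmx V (y i j).
  by move=> /(svalP (cid (ex i j)))[].
clearbody y.
pose t (i j : 'I_r) := if (i <= j)%N then y i j else (y j i)^T.
pose Y : 'M[R]_n :=
  \sum_i \sum_j (sel p (rev_ord j))^T *m t i j *m sel p (rev_ord i).
have bY i0 j0 : blk Y (rev_ord j0) (rev_ord i0) = t i0 j0.
  rewrite blkE /Y mulmx_sumr mulmx_suml.
  rewrite [LHS](bigD1 i0) //= [X in _ + X]big1 ?addr0 => [|i ii0]; last first.
    rewrite mulmx_sumr mulmx_suml; apply: big1 => j _.
    by rewrite -!mulmxA sel_ortho ?mulmx0 // (inj_eq rev_ord_inj).
  rewrite mulmx_sumr mulmx_suml.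
  rewrite [LHS](bigD1 j0) //= [X in _ + X]big1 ?addr0 => [|j jj0].
    by rewrite !mulmxA selK mul1mx -mulmxA selK mulmx1.
  by rewrite !mulmxA sel_ortho ?mul0mx // (inj_eq rev_ord_inj) eq_sym.
have rev_ex (a : 'I_r) : exists i, a = rev_ord i.
  by exists (rev_ord a); rewrite rev_ordK.
have YT : Y^T = Y.
  apply: blkP => a b; have [j ->] := rev_ex a; have [i ->] := rev_ex b.
  rewrite blkT !bY /t; case: (ltngtP i j) => [//|//|/val_inj e]; first by rewrite trmxK.
  (* Diagonal blocks are scalar, hence symmetric. *)
  subst j; have := yV i i (leqnn i); rewrite (ishi_diag hV) => /vlineP[c ->].
  by rewrite trmx_scale trmx1.
have Ys : ishi_space V Y.
  apply/ishi_spaceP; split=> // a b; have [j ->] := rev_ex a; have [i ->] := rev_ex b.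
  by rewrite rev_ord_leq bY /t => ij; rewrite ij yV.
exists Y => //; have [DT _] := dual_mx_space Ys.
have low (i j : 'I_r) : (i <= j)%N -> blk (dual_mx Y) i j = blk Z i j.
  by move=> ij; rewrite blk_dual_mx_Rmx // bY yZ // /t ij.
apply: blkP => i j; case: (leqP i j) => ij; first exact: low.
by rewrite -DT -ZT !blkT low // ltnW.
Qed.

Lemma ip_congr U Y : ip (U *m Y) U = frob (U^T *m U) Y.
Proof. by rewrite ip_mull ipC. Qed.

(** The triangular matrix whose block columns have coordinates [v] in the chosen orthonormal bases,
    taken in reversed block order. *)
Definition upper_of (v : 'cV[R]_nq) : 'M[R]_n :=
  \sum_i (\sum_a (sel q i *m v) a ord0 *: cb (rev_ord i) a) *m sel p (rev_ord i).

Lemma upper_of_tri v : upper_of v \in tri V.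
Proof.
apply: memv_suml => i _; set A := \sum_a _ *: _.
have /colspaceP[A1 A2] : A \in colspace V (rev_ord i).
  by apply: memv_suml => a _; rewrite memvZ ?cbas_mem.
apply/triP; split=> a b ab; rewrite blkE mulmxA -mulmxA.
  have [e|ne] := eqVneq (rev_ord i) b; last by rewrite sel_ortho // mulmx0 mem0v.
  by subst b; rewrite selK mulmx1 A1.
have [e|ne] := eqVneq (rev_ord i) b; last by rewrite sel_ortho // mulmx0.
by subst b; rewrite selK mulmx1 A2.
Qed.

Lemma upper_of_onto U : U \in tri V -> exists v, upper_of v = U.
Proof.
move=> /triP[U1 U2].
exists (\mxcol_i \col_a ip (cb (rev_ord i) a) (U *m (sel p (rev_ord i))^T)).
rewrite -[RHS]mulmx1 -sum_sel mulmx_sumr /upper_of.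
rewrite [RHS](reindex_inj rev_ord_inj) /=; apply: eq_bigr => i _.
rewrite mulmxA; congr (_ *m _).
have UM : U *m (sel p (rev_ord i))^T \in colspace V (rev_ord i).
  by apply/colspaceP; split=> a ai; rewrite mulmxA -blkE; [apply: U1 | apply: U2].
have [_ _ /(_ _ UM) e] := onbP (colspace V (rev_ord i)).
rewrite [RHS]e; apply: eq_bigr => a _; congr (_ *: _).
by rewrite selE mxcolK mxE.
Qed.

(** tr(U Y U^T) splits over pairs of block columns into terms <U_i Y_ij, U_j>, and the entries of
    [dual_mx Y] are these pairings on the bases. *)
Lemma qf_dual_mx Y v : qf (dual_mx Y) v = frob ((upper_of v)^T *m upper_of v) Y.
Proof.
rewrite -ip_congr /upper_of.
rewrite mulmx_suml ip_suml.
have -> : qf (dual_mx Y) v =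
    \sum_i \sum_j ((sel q i *m v)^T *m blk (dual_mx Y) i j *m (sel q j *m v)) ord0 ord0.
  rewrite /qf -[X in v^T *m X]mul1mx -[X in _ *m (_ *m X) *m _]mulmx1 -!sum_sel.
  rewrite !mulmx_suml mulmx_sumr mulmx_suml summxE; apply: eq_bigr => i _.
  rewrite !mulmx_sumr mulmx_suml summxE; apply: eq_bigr => j _.
  by rewrite blkE trmx_mul !mulmxA.
apply: eq_bigr => i _; rewrite ip_sumr; apply: eq_bigr => j _.
have -> A B : ip (A *m sel p (rev_ord i) *m Y) (B *m sel p (rev_ord j)) =
    ip (A *m blk Y (rev_ord i) (rev_ord j)) B.
  by rewrite [LHS]ipC ip_mulr ipC blkE !mulmxA.
move: (sel q i *m v) (sel q j *m v) => x y.
rewrite mulmx_suml ip_suml -mulmxA mxE; apply: eq_bigr => a _.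
rewrite mxE -scalemxAl ipZl; congr (_ * _).
rewrite mxE ip_sumr; apply: eq_bigr => b _.
by rewrite ipZr blk_dual_mx mulrC.
Qed.

(** Gram matrices of [tri V] are in general only in the closed cone; positivity on the open cone
    reaches them by adding e 1 with e > 0 small. *)
Lemma ishi_dualP Y : ishi_dual V Y <->
  ishi_space V Y /\ psd_cone (dual_mx Y).
Proof.
split=> [[Ys Yp]|[Ys [_ Yp]]]; split=> //.
  split=> [|v]; first by have [] := dual_mx_space Ys.
  rewrite -/(qf _ _) qf_dual_mx; set X := _ *m _.
  have CX : ishi_closed_cone V X by apply: (closed_cone_gram hV); apply: upper_of_tri.
  have h (e : R) : 0 < e -> 0 <= e * \tr Y + frob X Y.
    move=> e0; have := Yp _ (ishi_cone_closedD (ishi_cone_scalar hV e0) CX).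
    by rewrite /frob trmx_add trmx_scale trmx1 mulmxDl mxtraceD -scalemxAl mul1mx mxtraceZ.
  rewrite leNgt; apply/negP => neg.
  (* With e = -f/(2d), where f < 0 is the pairing of X with Y, the term e tr Y is at most -f/2; the
     total is then at most f/2 < 0. *)
  pose d := `|\tr Y| + 1; have d0 : 0 < d by rewrite ltr_wpDl.
  have := h (- frob X Y / (2 * d)); rewrite leNgt => /(_ _)/negP; apply.
    by rewrite divr_gt0 ?oppr_gt0 // mulr_gt0.
  have dY : \tr Y <= d by rewrite (le_trans (ler_norm _)) // lerDl.
  have -> : - frob X Y / (2 * d) * \tr Y = (- frob X Y / 2) * (\tr Y / d).
    by field; rewrite gt_eqF.
  have : \tr Y / d <= 1 by rewrite ler_pdivrMr // mul1r.
  move: (\tr Y / d) (frob X Y) neg => x y y0 x1; nra.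
move=> X /(ishi_cone_gramP hV)[G [Gt _] ->].
have [v <-] := upper_of_onto Gt; rewrite -qf_dual_mx; exact: Yp.
Qed.

Lemma cone_iso_dual : exists f g,
  cone_iso (ishi_closed_cone (dual_spaces V)) (ishi_dual V) f g.
Proof.
pose f : 'Hom('M[R]_n, 'M[R]_nq) := linfun dual_mx.
have fE Y : f Y = dual_mx Y by rewrite lfunE.
have [|g gf] := @linear_left_inverse _ _ _ (ishi_vspace V) f.
  by move=> Y /ishi_vspaceP Ys; rewrite fE; apply: dual_mx_inj.
have gK Y : ishi_space V Y -> g (dual_mx Y) = Y.
  by move=> /ishi_vspaceP/gf; rewrite fE.
exists g, f; split=> [Z [Zp Zs]|Y /ishi_dualP[Ys Yp]].
  have [Y Ys YZ] := dual_mx_onto Zs; subst Z.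
  by rewrite gK // fE; split=> //; apply/ishi_dualP.
by rewrite fE gK //; split=> //; split=> //; apply: dual_mx_space.
Qed.

End DualCone.

(** * Assembly of the two dual statements *)

Lemma dim_conditionP (R : realType) (r : nat) (p : 'I_r -> nat)
    (V : forall i j : 'I_r, {vspace 'M[R]_(p i, p j)}) : ishi_axioms V ->
  caratheodory_number (ishi_closed_cone V) r <-> dim_condition V.
Proof.
move=> hV; split; first exact: caratheodory_dim_condition.
exact: dim_condition_caratheodory.
Qed.

Theorem theorem4p3 (R : realType) (r : nat) (p : 'I_r -> nat)
    (V : forall i j : 'I_r, {vspace 'M[R]_(p i, p j)})
    (hr : (1 <= r)%N) (hV : ishi_axioms V) :
  let K := ishi_cone V in
  [/\ closure K = @psd_cone R (\sum_i p i) `&` ishi_space V,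
      (caratheodory_number (closure K) r <->
        (forall i j k : 'I_r, (i < j)%N -> (j < k)%N -> V i j != 0%VS ->
           \dim (V i k) = \dim (V j k))) /\
      (caratheodory_number (closure K) r ->
        caratheodory_rank_on_faces (closure K)) &
      (caratheodory_number (ishi_dual V) r <->
        (forall k j i : 'I_r, (k < j)%N -> (j < i)%N -> V j i != 0%VS ->
           \dim (V k i) = \dim (V k j))) /\
      (caratheodory_number (ishi_dual V) r ->
        caratheodory_rank_on_faces (ishi_dual V))].
Proof.
move=> K; have clK := closure_ishi_cone hV.
have [f [g fg]] := cone_iso_dual hV; have hD := dual_ishi_axioms hV.
have cD : caratheodory_number (ishi_dual V) r <-> dim_condition (dual_spaces V).
  rewrite -(dim_conditionP hD); split; last exact: cone_iso_caratheodory_number fg _.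
  exact: cone_iso_caratheodory_number (cone_iso_sym fg) _.
split=> //.
  rewrite /K clK; split; first exact: dim_conditionP.
  by move=> /(dim_conditionP hV); apply: dim_condition_rank_on_faces.
split; first by rewrite cD; apply: dual_dim_condition.
move=> /cD cond; apply: (cone_iso_caratheodory_rank_on_faces fg).
exact: dim_condition_rank_on_faces.
Qed.
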